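(* Let $n\geqslant 3$, let $R=I_n$ be the dihedral root system in $\mathbb{R}^2$ with positive roots $\alpha_0,\dots,\alpha_{n-1}$, let $W$ be its reflection group with rotations $r_j$ and reflections $s_j$ ($j\in\mathbb{Z}/n\mathbb{Z}$), let $\kappa:R\to(0,\infty)$ be a $W$-invariant multiplicity function, and let $E$ be the associated Dunkl kernel. Then, for every $w\in W$ and all $x,y\in\overline{\mathfrak{a}_+}$, $$E(x,w.y)\approx e^{\langle x,y\rangle}\Big(\prod_{\alpha\in R^+}(1+\langle\alpha,x\rangle\langle\alpha,y\rangle)^{-\kappa(\alpha)}\Big)\times F_w(x,y),$$ where $$F_w(x,y)=\begin{cases} 1 & \text{if } w=\mathrm{Id},\\[1ex] \dfrac{1}{1+\langle\alpha_0,x\rangle\langle\alpha_0,y\rangle} & \text{if } w=s_0,\\[2ex] \dfrac{1}{1+\langle\alpha_{n-1},x\rangle\langle\alpha_{n-1},y\rangle} & \text{if } w=s_1,\\[2ex] \dfrac{1}{1+\langle x,y\rangle} & \text{if } w=s_j \text{ with } 1<j<n,\\[2ex] \dfrac{1+\langle x,\tilde r.y\rangle}{(1+\langle\alpha_0,x\rangle\langle\alpha_0,y\rangle)(1+\langle\alpha_{n-1},x\rangle\langle\alpha_{n-1},y\rangle)(1+\langle x,y\rangle)} & \text{if } w=r_1,\\[2ex] \dfrac{1+\langle\tilde r.x,y\rangle}{(1+\langle\alpha_0,x\rangle\langle\alpha_0,y\rangle)(1+\langle\alpha_{n-1},x\rangle\langle\alpha_{n-1},y\rangle)(1+\langle x,y\rangle)}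 & \text{if } w=r_{n-1},\\[2ex] \dfrac{(1+\langle\tilde r.x,y\rangle)(1+\langle x,\tilde r.y\rangle)}{(1+\langle\alpha_0,x\rangle\langle\alpha_0,y\rangle)(1+\langle\alpha_{n-1},x\rangle\langle\alpha_{n-1},y\rangle)(1+\langle x,y\rangle)^2} & \text{if } w=r_j \text{ with } 1<j<n-1. \end{cases}$$ Here $\tilde r$ is the rotation of $\mathbb{R}^2$ about the origin by the angle $\frac{\pi}{2}-\frac{\pi}{n}$.
   Context: Let $n\geqslant3$ and $\mathfrak{a}=\mathbb{R}^2$ with its standard inner product $\langle\cdot,\cdot\rangle$. For $j\in\{0,\dots,n-1\}$ put $\alpha_j=(\cos\frac{\pi j}{n},\sin\frac{\pi j}{n})$. The dihedral root system is $R=I_n=\{\pm\alpha_j:0\leqslant j\leqslant n-1\}$ with positive roots $R^+=\{\alpha_0,\dots,\alpha_{n-1}\}$. The positive chamber is $\mathfrak{a}_+=\{x\in\mathbb{R}^2:\langle\alpha_0,x\rangle>0,\ \langle\alpha_{n-1},x\rangle>0\}$ and $\overline{\mathfrak{a}_+}$ is its closure. For a root $\alpha$, $s_\alpha$ is the orthogonal reflection with respect to $\alpha^\perp$. The reflection group $W$ generated by these reflections is the dihedral group of order $2n$, consisting, for $j\in\mathbb{Z}/n\mathbb{Z}$, of the rotations and reflections $$r_j=\begin{pmatrix}\cos\frac{2\pi j}{n}&-\sin\frac{2\pi j}{n}\\ \sin\frac{2\pi j}{n}&\cos\frac{2\pi j}{n}\end{pmatrix},\qquad s_j=\begin{pmatrix}-\cos\frac{2\pi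 j}{n}&\sin\frac{2\pi j}{n}\\ \sin\frac{2\pi j}{n}&\cos\frac{2\pi j}{n}\end{pmatrix}.$$ The rotation $\tilde r$ has matrix $\begin{pmatrix}\sin\frac{\pi}{n}&-\cos\frac{\pi}{n}\\ \cos\frac{\pi}{n}&\sin\frac{\pi}{n}\end{pmatrix}$. A multiplicity function $\kappa:R\to(0,\infty)$ is a function invariant under the action of $W$ on $R$. For $\xi\in\mathfrak{a}$ the Dunkl operator $T_\xi$ is $$T_\xi f(x)=\langle\xi,\nabla f(x)\rangle+\sum_{\alpha\in R^+}\kappa(\alpha)\,\langle\alpha,\xi\rangle\,\frac{f(x)-f(s_\alpha x)}{\langle\alpha,x\rangle}.$$ The Dunkl kernel $E$ is defined by: for every $y\in\mathfrak{a}$, $E(\cdot,y)$ is the unique smooth solution $f$ on $\mathfrak{a}$ of $T_\xi f=\langle\xi,y\rangle f$ for all $\xi\in\mathfrak{a}$, with $f(0)=1$. One has $E(x,y)>0$ for $x,y\in\mathfrak{a}$. The notation $f\approx g$ means that there are constants $C_1,C_2>0$, depending only on $n$ and $\kappa$ (not on $x,y$), such that $C_1 g\leqslant f\leqslant C_2 g$ for all $x,y\in\overline{\mathfrak{a}_+}$. *)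

(* Defs.v *)
From HB Require Import structures.
From mathcomp Require Import all_boot all_order all_algebra.
From mathcomp Require Import all_classical all_reals all_analysis.

Set Implicit Arguments.
Unset Strict Implicit.
Unset Printing Implicit Defensive.

Import Order.TTheory GRing.Theory Num.Theory.
Import numFieldNormedType.Exports.
Local Open Scope classical_set_scope.
Local Open Scope ring_scope.

(* The plane is the space of column vectors, so that matrices act on the
   left: w.y is [w *m y]. *)

Definition dotp (R : realType) (x y : 'cV[R]_2) : R := \sum_(i < 2) x i 0 * y i 0.

Definition vec2 (R : realType) (a b : R) : 'cV[R]_2 :=
  \col_(i < 2) (if i == 0 then a else b).

Definition mat2 (R : realType) (a b c d : R) : 'M[R]_2 :=
  \matrix_(i < 2, j < 2)
    (if i == 0 then if j == 0 then a else b else if j == 0 then c else d).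

Definition proot (R : realType) (n j : nat) : 'cV[R]_2 :=
  vec2 (cos (pi * j%:R / n%:R)) (sin (pi * j%:R / n%:R)).

Definition roots (R : realType) (n : nat) : set 'cV[R]_2 :=
  [set a | exists j : 'I_n, a = proot R n j \/ a = - proot R n j].

Definition reflection (R : realType) (a : 'cV[R]_2) : 'M[R]_2 :=
  1%:M - (2 / dotp a a) *: (a *m a^T).

(* Reflections are involutions, so closing under products is enough to obtain
   the generated group. *)
Inductive reflection_group (R : realType) (n : nat) : 'M[R]_2 -> Prop :=
| reflection_group1 : reflection_group n 1%:M
| reflection_groupM (a : 'cV[R]_2) (w : 'M[R]_2) :
    roots n a -> reflection_group n w ->
    reflection_group n (reflection a *m w).

Definition rot_mx (R : realType) (n j : nat) : 'M[R]_2 :=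
  let t := 2 * pi * j%:R / n%:R in mat2 (cos t) (- sin t) (sin t) (cos t).

Definition refl_mx (R : realType) (n j : nat) : 'M[R]_2 :=
  let t := 2 * pi * j%:R / n%:R in mat2 (- cos t) (sin t) (sin t) (cos t).

Definition rtilde (R : realType) (n : nat) : 'M[R]_2 :=
  let t := pi / n%:R in mat2 (sin t) (- cos t) (cos t) (sin t).

Definition pos_chamber (R : realType) (n : nat) : set 'cV[R]_2 :=
  [set x | 0 < dotp (proot R n 0) x /\ 0 < dotp (proot R n n.-1) x].

(* The values of [kappa] off the roots are irrelevant. *)
Definition multiplicity (R : realType) (n : nat) (kappa : 'cV[R]_2 -> R) : Prop :=
  (forall a, roots n a -> 0 < kappa a) /\
  (forall w a, reflection_group n w -> roots n a -> kappa (w *m a) = kappa a).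

Definition partial (R : realType) (i : 'I_2) (f : 'cV[R]_2 -> R) : 'cV[R]_2 -> R :=
  fun x => 'D_(delta_mx i 0) f x.

Definition gradient (R : realType) (f : 'cV[R]_2 -> R) (x : 'cV[R]_2) : 'cV[R]_2 :=
  \col_(i < 2) partial i f x.

Fixpoint Cn_class (R : realType) (k : nat) (f : 'cV[R]_2 -> R) : Prop :=
  if k is k'.+1 then
    (forall x, differentiable f x) /\ (forall i, Cn_class k' (partial i f))
  else continuous f.

Definition smooth (R : realType) (f : 'cV[R]_2 -> R) : Prop :=
  forall k, Cn_class k f.

(* [(f x - f (s_a x)) / <a, x>]. On the line [<a, x> = 0] the quotient is
   0/0 and stands for its continuous extension (which exists for smooth f);
   MathComp's convention [0 / 0 = 0] would give a wrong value there. *)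
Definition dunkl_quotient (R : realType) (a : 'cV[R]_2) (f : 'cV[R]_2 -> R)
    (x : 'cV[R]_2) : R :=
  let q z := (f z - f (reflection a *m z)) / dotp a z in
  if dotp a x != 0 then q x
  else lim (q z @[z --> within [set z | dotp a z != 0] (nbhs x)]).

Definition dunkl_op (R : realType) (n : nat) (kappa : 'cV[R]_2 -> R)
    (xi : 'cV[R]_2) (f : 'cV[R]_2 -> R) (x : 'cV[R]_2) : R :=
  dotp xi (gradient f x) +
  \sum_(j < n) kappa (proot R n j) * dotp (proot R n j) xi *
               dunkl_quotient (proot R n j) f x.

(* For each y the joint eigenvalue problem has exactly one solution, so this
   determines E. *)
Definition is_dunkl_kernel (R : realType) (n : nat) (kappa : 'cV[R]_2 -> R)
    (E : 'cV[R]_2 -> 'cV[R]_2 -> R) : Prop :=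
  forall y,
    [/\ smooth (E^~ y),
        forall xi x, dunkl_op n kappa xi (E^~ y) x = dotp xi y * E x y
      & E 0 y = 1].

(* The tests are mutually exclusive for n >= 3 and cover the whole group; the
   last default is never reached there. *)
Definition F_factor (R : realType) (n : nat) (w : 'M[R]_2) (x y : 'cV[R]_2) : R :=
  let a0 := 1 + dotp (proot R n 0) x * dotp (proot R n 0) y in
  let a1 := 1 + dotp (proot R n n.-1) x * dotp (proot R n n.-1) y in
  let xy := 1 + dotp x y in
  let x_ry := 1 + dotp x (rtilde R n *m y) in
  let rx_y := 1 + dotp (rtilde R n *m x) y in
  if w == 1%:M then 1
  else if w == refl_mx R n 0 then 1 / a0
  else if w == refl_mx R n 1 then 1 / a1
  else if [exists j : 'I_n, (1 < j)%N && (w == refl_mx R n j)] then 1 / xy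
  else if w == rot_mx R n 1 then x_ry / (a0 * a1 * xy)
  else if w == rot_mx R n n.-1 then rx_y / (a0 * a1 * xy)
  else if [exists j : 'I_n, (1 < j < n.-1)%N && (w == rot_mx R n j)] then
    rx_y * x_ry / (a0 * a1 * xy ^+ 2)
  else 0.

Definition kernel_estimate (R : realType) (n : nat) (kappa : 'cV[R]_2 -> R)
    (w : 'M[R]_2) (x y : 'cV[R]_2) : R :=
  expR (dotp x y) *
  (\prod_(j < n) (1 + dotp (proot R n j) x * dotp (proot R n j) y)
                   `^ (- kappa (proot R n j))) *
  F_factor n w x y.

(* Main.v *)
Require Import Defs.
From HB Require Import structures.
From mathcomp Require Import all_boot all_order all_algebra.
From mathcomp Require Import all_classical all_reals all_analysis.
From mathcomp Require Import ring lra.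

Set Implicit Arguments.
Unset Strict Implicit.
Unset Printing Implicit Defensive.

Import Order.TTheory GRing.Theory Num.Theory.
Import numFieldNormedType.Exports.
Local Open Scope classical_set_scope.
Local Open Scope ring_scope.

(** Fix [x] and [y] in the closed chamber and put
    [h w t = exp (- t <x, y>) * E (t x) (w y)] for [w] in the group. At the point
    [t x] and for [xi = x] the eigenvalue equation of the Dunkl operators loses
    its denominators. Together with the invariance [E (s x) (s y) = E x y] under
    reflections it becomes a system of ordinary differential equations over the
    group,

      [t h_w' = - t a_w h_w - \sum_alpha kappa alpha * (h_w - h_(s_alpha w))],
      [a_w = <x, y> - <x, w y> >= 0], [h_w = 1] at [t = 0].

    In logarithmic time this describes a random walk on the group which jumps
    from [w] to [s_alpha w] at rate [kappa alpha] and is killed at rate [t a_w].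
    The system has only one solution (an energy estimate, [flow_eq0], which also
    yields the invariance of [E]) and its solution is nonnegative ([flow_ge0]).
    The theorem says how large each [h w 1] is in terms of the killing rates.
    This is derived from the system alone, by differential inequalities whose
    constants do not depend on the rates, hence not on [x] and [y].

    - [flow_dominated]: the identity is never killed, and every element reaches
      it in at most two jumps through elements that are killed at most at a
      comparable rate, so it always carries a fixed proportion of the mass.
    - [relaxation_le] and [relaxation_ge]: a state killed at rate [a] and fed by a
      slowly varying quantity [v] has size [v / (1 + t a)]. So the reflection in
      [alpha] has size [h_id / (1 + t a)], and a rotation, which is fed by all
      reflections, mainly by the two simple ones, has size
      [h_id * (1 / P + 1 / Q) / (1 + t a)], where [P] and [Q] are the values of
      [1 + <alpha, t x> <alpha, y>] for the two simple roots.
    - [normalized_bounded]: [h_id] has the size of the product of the factors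
      [(1 + t <alpha, x> <alpha, y>) ^ - kappa alpha]. Between two consecutive
      scales of killing rates, the mass of the elements that are not killed yet
      leaks out at a constant rate, which is the sum of the [kappa alpha] over the
      factors that have started to decay ([normalized_stage]). There are at most
      four such regimes, with the whole group, four elements, two elements and
      the identity alone. Working with the mass of a set of elements makes the
      exchange between its elements disappear from the equations.
    - [chamber_rates]: in terms of the products [p], [q], [z1], [z2] of the
      distances of [x] and [y] to the walls all rates are explicit. The relation
      [z1 * z2 = p * q] makes one of the two rotations by [2 pi / n] slow, and
      through [mixed_product_near] it converts the uniform formula for the
      rotations into the cases of [F_factor]. *)

(** * Differential inequalities on a half-line *)

Section Calculus.
Variable R : realType.
Implicit Types (f g : R -> R) (t a b : R).

Lemma deriv_eq f t a b : is_derive t 1 f a -> a = b -> is_derive t 1 f b.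
Proof. by move=> + <-. Qed.

Lemma deriv_cst (c : R) t : is_derive t 1 (fun=> c) 0.
Proof. exact: is_derive_cst. Qed.

Lemma deriv_id t : is_derive t 1 (fun s : R => s) 1.
Proof. exact: is_derive_id. Qed.

Lemma derivD f g t a b : is_derive t 1 f a -> is_derive t 1 g b ->
  is_derive t 1 (fun s => f s + g s) (a + b).
Proof. by move=> ? ?; exact: (is_deriveD (f := f) (g := g)). Qed.

Lemma derivN f t a : is_derive t 1 f a -> is_derive t 1 (fun s => - f s) (- a).
Proof. by move=> ?; exact: (is_deriveN (f := f)). Qed.

Lemma derivB f g t a b : is_derive t 1 f a -> is_derive t 1 g b ->
  is_derive t 1 (fun s => f s - g s) (a - b).
Proof. by move=> fa gb; apply: derivD => //; exact: derivN. Qed.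

Lemma derivM f g t a b : is_derive t 1 f a -> is_derive t 1 g b ->
  is_derive t 1 (fun s => f s * g s) (a * g t + f t * b).
Proof.
move=> fa gb; apply: (deriv_eq (is_deriveM fa gb)).
by rewrite /GRing.scale/= addrC [g t * _]mulrC.
Qed.

Lemma derivZ f t a (c : R) :
  is_derive t 1 f a -> is_derive t 1 (fun s => c * f s) (c * a).
Proof.
move=> fa; apply: (deriv_eq (derivM (deriv_cst c t) fa)).
by rewrite mul0r add0r.
Qed.

Lemma deriv_sum (I : finType) (P : pred I) (F : I -> R -> R) (F' : I -> R) t :
  (forall i, P i -> is_derive t 1 (F i) (F' i)) ->
  is_derive t 1 (fun s => \sum_(i | P i) F i s) (\sum_(i | P i) F' i).
Proof.
move=> dF; rewrite (_ : (fun s => _) = \sum_(i | P i) F i); last first.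
  by apply/funext => s; rewrite fct_sumE.
elim/big_ind2 : _ => // [|f a g b fa gb]; first exact: deriv_cst.
exact: is_deriveD fa gb.
Qed.

Lemma deriv_expR f t a :
  is_derive t 1 f a -> is_derive t 1 (fun s => expR (f s)) (expR (f t) * a).
Proof. by move=> fa; exact: (is_derive1_comp (f := expR) (g := f)). Qed.

Lemma deriv_ln f t a : 0 < f t ->
  is_derive t 1 f a -> is_derive t 1 (fun s => ln (f s)) (a / f t).
Proof.
move=> f0 fa; apply: (deriv_eq (is_derive1_comp (is_derive1_ln f0) fa)).
by rewrite mulrC.
Qed.

Lemma deriv_inv f t a : f t != 0 ->
  is_derive t 1 f a -> is_derive t 1 (fun s => (f s)^-1) (- (a / f t ^+ 2)).
Proof.
move=> f0 fa; apply: (deriv_eq (is_deriveV f0 fa)).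
by rewrite /GRing.scale/= mulNr mulrC.
Qed.

Lemma deriv_exprn n t : is_derive t 1 (fun s : R => s ^+ n) (n%:R * t ^+ n.-1).
Proof.
rewrite (_ : (fun s => _) = (fun s : R => s) ^+ n); last first.
  by apply/funext => s; rewrite exprfctE.
apply: (deriv_eq (is_deriveX n (deriv_id t))).
by rewrite /GRing.scale/= mulr1.
Qed.

Lemma deriv_affine (a t : R) : is_derive t 1 (fun s => 1 + s * a) a.
Proof.
apply: (deriv_eq (derivD (deriv_cst 1 t) (derivM (deriv_id t) (deriv_cst a t)))).
by rewrite add0r mul1r mulr0 addr0.
Qed.

Lemma derive_ge0_le f (f' : R -> R) t1 t2 : t1 <= t2 ->
  (forall t, t1 <= t <= t2 -> is_derive t 1 f (f' t)) ->
  (forall t, t1 < t < t2 -> 0 <= f' t) -> f t1 <= f t2.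
Proof.
move=> t12 df f'0.
have sub t : t \in `]t1, t2[%R -> t1 <= t <= t2.
  by rewrite in_itv/= => /andP[/ltW -> /ltW ->].
apply: (@ger0_derive1_ndecr _ f t1 t2) => //.
- by move=> x /sub/df[].
- move=> x xt; rewrite derive1E; have [_ ->] := df _ (sub _ xt).
  by apply: f'0; move: xt; rewrite in_itv.
- apply: derivable_within_continuous => x; rewrite in_itv/= => xt.
  by have [] := df _ xt.
Qed.

(** The integrating factor of the singular operator [t d/dt + lam + a t] is
    [t ^ lam * exp (a * t)]; a natural exponent [lam] keeps it differentiable
    at [0]. *)
Lemma integrating_factor_le (lam : nat) (a : R) f (f' : R -> R) t1 t2 :
  (0 < lam)%N -> 0 <= t1 -> t1 <= t2 ->
  (forall t, 0 <= t <= t2 -> is_derive t 1 f (f' t)) ->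
  (forall t, 0 <= t <= t2 -> 0 <= t * f' t + (lam%:R + a * t) * f t) ->
  t1 ^+ lam * expR (a * t1) * f t1 <= t2 ^+ lam * expR (a * t2) * f t2.
Proof.
case: lam => // lam _ t1_ge0 t12 df f_ge0.
pose F s := s ^+ lam.+1 * expR (a * s) * f s.
pose F' s := s ^+ lam * expR (a * s) * (s * f' s + (lam.+1%:R + a * s) * f s).
have sub t : t1 <= t <= t2 -> 0 <= t <= t2.
  by move=> /andP[t1t ->]; rewrite (le_trans t1_ge0).
apply: (@derive_ge0_le F F') => // [t /sub tt|t /andP[t1t tt2]].
  have dE := deriv_expR (derivZ a (deriv_id t)).
  apply: (deriv_eq (derivM (derivM (deriv_exprn lam.+1 t) dE) (df t tt))).
  rewrite /F' /=; rewrite [t ^+ lam.+1]exprS; ring.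
have t_ge0 : 0 <= t by rewrite (le_trans t1_ge0) ?ltW.
apply: mulr_ge0; last by apply: f_ge0; rewrite t_ge0 ltW.
by rewrite mulr_ge0 ?expR_ge0// exprn_ge0.
Qed.

(** A solution of a linear differential inequality that is singular at [0]
    needs no initial condition: the integrating factor kills it there. *)
Lemma singular_ineq_ge0 (lam : nat) (a : R) f (f' : R -> R) : (0 < lam)%N ->
  (forall t, 0 <= t -> is_derive t 1 f (f' t)) ->
  (forall t, 0 <= t -> 0 <= t * f' t + (lam%:R + a * t) * f t) ->
  forall t, 0 <= t -> 0 <= f t.
Proof.
move=> lam0 df f_ge0 t; rewrite le_eqVlt => /predU1P[<-|t_gt0].
  have := f_ge0 0 (lexx _).
  by rewrite mul0r mulr0 addr0 add0r pmulr_rge0// ltr0n.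
have /= := @integrating_factor_le lam a f f' 0 t lam0 (lexx _) (ltW t_gt0).
rewrite expr0n eqn0Ngt lam0 /= !mul0r pmulr_rge0; last first.
  by rewrite mulr_gt0 ?expR_gt0// exprn_gt0.
by apply=> s /andP[s0 _]; [exact: df|exact: f_ge0].
Qed.

End Calculus.

Section Relaxation.
Variable R : realType.
Implicit Type t : R.

Lemma nat_above (x : R) : exists2 lam : nat, (0 < lam)%N & x <= lam%:R.
Proof.
exists (Num.bound `|x|).+1 => //.
rewrite (le_trans (ler_norm x)) // ltW // (lt_trans (archi_boundP _)) //.
by rewrite ltr_nat.
Qed.

Lemma inv1D_bounds (b : R) : 0 <= b -> 0 < (1 + b)^-1 <= 1.
Proof. by move=> b0; rewrite invr_gt0 ltr_pwDl //= invf_le1 ?ltr_pwDl // lerDl. Qed.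

Lemma mul_inv1D (b : R) : 0 <= b -> b * (1 + b)^-1 = 1 - (1 + b)^-1.
Proof.
move=> b0; have b1 : 1 + b != 0 by rewrite gt_eqF // ltr_pwDl.
by apply: (mulIf b1); rewrite mulrBl mul1r -mulrA mulVf // mulr1; ring.
Qed.

Variables (a : R) (v v' h h' : R -> R) (lam : nat).
Hypothesis a_ge0 : 0 <= a.
Hypothesis dv : forall t, 0 <= t -> is_derive t 1 v (v' t).
Hypothesis dh : forall t, 0 <= t -> is_derive t 1 h (h' t).
Hypothesis v_ge0 : forall t, 0 <= t -> 0 <= v t.

Let damped_derive (C t : R) : 0 <= t ->
  is_derive t 1 (fun s => C * (v s * (1 + s * a)^-1))
    (C * (v' t * (1 + t * a)^-1 + v t * - (a / (1 + t * a) ^+ 2))).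
Proof.
move=> t0; apply: derivZ; apply: derivM; first exact: dv.
apply: deriv_inv (deriv_affine _ _).
by rewrite gt_eqF // ltr_pwDl // mulr_ge0.
Qed.

(** Relaxation: a quantity [h] that is destroyed at rate [a] and fed by a source
    of size [v] has the size [v / (1 + t a)], provided that [v] varies at most
    like a power of [t]. The next two lemmas are the two halves of this. The
    bound [h <= C2 * v] takes care of the times [t] below [1 / a], at which the
    destruction has not set in yet. *)
Lemma relaxation_le (C1 C2 : R) : 0 <= C1 -> 0 <= C2 ->
  (forall t, 0 <= t -> - (lam%:R * v t) <= t * v' t) ->
  (forall t, 0 <= t -> t * h' t + t * a * h t <= C1 * v t) ->
  (forall t, 0 <= t -> h t <= C2 * v t) ->
  forall t, 0 <= t -> h t <= (C1 + (lam%:R + 2) * C2) * (v t * (1 + t * a)^-1).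
Proof.
move=> C1_ge0 C2_ge0 slow fed hv t t_ge0; rewrite -subr_ge0.
set C := C1 + _.
have C_ge0 : 0 <= C by rewrite addr_ge0 // mulr_ge0 // addr_ge0.
pose Y' s := C * (v' s * (1 + s * a)^-1 + v s * - (a / (1 + s * a) ^+ 2)) - h' s.
pose mu := lam.+2; have mu_gt0 : (0 < mu)%N by [].
have muE : mu%:R = lam%:R + 2 :> R by rewrite /mu -addn2 natrD.
move: mu mu_gt0 muE => mu mu_gt0 muE.
apply: (@singular_ineq_ge0 _ mu a
  (fun s => C * (v s * (1 + s * a)^-1) - h s) Y' mu_gt0 _ _ t t_ge0).
  by move=> s s0; apply: derivB; [exact: damped_derive|exact: dh].
move=> s s0; have b0 : 0 <= s * a by rewrite mulr_ge0.
have /andP[r0 r1] := inv1D_bounds b0; have br := mul_inv1D b0.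
rewrite /Y' -exprVn; set r := (1 + s * a)^-1 in r0 r1 br *.
have v0 := v_ge0 s0.
rewrite muE.
have slow' := ler_wpM2l (ltW r0) (slow s s0).
have slowC := ler_wpM2l C_ge0 slow'.
have hv' : (lam%:R + 2) * h s <= (lam%:R + 2) * (C2 * v s).
  by rewrite ler_wpM2l ?hv // addr_ge0.
have := fed s s0.
have -> : s * (C * (v' s * r + v s * - (a * r ^+ 2)) - h' s) +
    (lam%:R + 2 + a * s) * (C * (v s * r) - h s) =
  C * (r * (s * v' s)) - C * (v s * (s * a * r) * r)
  + (lam%:R + 2) * (C * (v s * r)) + C * (v s * (s * a * r))
  - (s * h' s + s * a * h s) - (lam%:R + 2) * h s by ring.
rewrite br.
have : C * (v s * (1 - r) * r) <= C * (v s * r).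
  rewrite ler_wpM2l // ler_wpM2r ?(ltW r0) // ler_piMr //; move: r0; lra.
have CE : C * v s = C1 * v s + (lam%:R + 2) * (C2 * v s) by rewrite /C; ring.
have : 0 <= C * (v s * r) by rewrite !mulr_ge0 // ltW.
move: slowC hv' CE; lra.
Qed.

Lemma relaxation_ge (c : R) : (0 < lam)%N -> 0 <= c ->
  (forall t, 0 <= t -> t * v' t <= lam%:R * v t) ->
  (forall t, 0 <= t -> c * v t <= t * h' t + (lam%:R + a * t) * h t) ->
  forall t, 0 <= t -> c / (2 * lam%:R) * (v t * (1 + t * a)^-1) <= h t.
Proof.
move=> lam_gt0 c_ge0 slow fed t t_ge0; rewrite -subr_ge0.
have lam1 : 1 <= lam%:R :> R by rewrite ler1n.
set C := c / _.
have C_ge0 : 0 <= C by rewrite divr_ge0 // mulr_ge0.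
pose Y' s := h' s - C * (v' s * (1 + s * a)^-1 + v s * - (a / (1 + s * a) ^+ 2)).
apply: (@singular_ineq_ge0 _ lam a
  (fun s => h s - C * (v s * (1 + s * a)^-1)) Y' lam_gt0 _ _ t t_ge0).
  by move=> s s0; apply: derivB; [exact: dh|exact: damped_derive].
move=> s s0; have b0 : 0 <= s * a by rewrite mulr_ge0.
have /andP[r0 r1] := inv1D_bounds b0; have br := mul_inv1D b0.
rewrite /Y' -exprVn; set r := (1 + s * a)^-1 in r0 r1 br *.
have v0 := v_ge0 s0.
have slowC := ler_wpM2l C_ge0 (ler_wpM2l (ltW r0) (slow s s0)).
have := fed s s0.
have -> : s * (h' s - C * (v' s * r + v s * - (a * r ^+ 2))) +
    (lam%:R + a * s) * (h s - C * (v s * r)) =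
  (s * h' s + (lam%:R + a * s) * h s) - C * (r * (s * v' s))
  + C * (v s * (s * a * r) * r)
  - lam%:R * (C * (v s * r)) - C * (v s * (s * a * r)) by ring.
rewrite br.
have : 0 <= C * (v s * (1 - r) * r).
  by rewrite !mulr_ge0 ?subr_ge0 // ltW.
have : 2 * (lam%:R * (C * (v s * r))) + C * (v s * (1 - r)) <= c * v s.
  have -> : c * v s = 2 * (lam%:R * (C * v s)).
    by rewrite /C; field; rewrite gt_eqF // ltr0n.
  have -> : 2 * (lam%:R * (C * (v s * r))) + C * (v s * (1 - r)) =
    2 * (lam%:R * (C * v s)) - (2 * lam%:R - 1) * (C * v s * (1 - r)) by ring.
  rewrite gerBl mulr_ge0 //; first by move: lam1; lra.
  by rewrite !mulr_ge0 // subr_ge0.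
move: slowC; lra.
Qed.

End Relaxation.

(** The logarithmic derivative of [phi] is bounded by that of
    [exp (B * (t * m - 1 / (t * M)))], whose variation between the times
    [1 / M] and [1 / m] is at most [2 * B]. *)
Lemma slow_variation (R : realType) (B m M D : R) (phi phi' : R -> R) (t1 t2 : R) :
  0 <= B -> 0 <= m -> 0 < M -> 0 < t1 -> t1 <= t2 ->
  (forall t, t1 <= t <= t2 -> is_derive t 1 phi (phi' t)) ->
  (forall t, t1 <= t <= t2 -> 0 <= phi t) ->
  (forall t, t1 <= t <= t2 ->
     `|t * phi' t| <= B * (t * m + (t * M)^-1) * phi t) ->
  1 <= D * (t1 * M) -> t2 * m <= D ->
  phi t1 <= expR (2 * B * D) * phi t2 /\ phi t2 <= expR (2 * B * D) * phi t1.
Proof.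
move=> B_ge0 m_ge0 M_gt0 t1_gt0 t12 dphi phi_ge0 phi_le Dt1 Dt2.
pose th (s : R) := B * (s * m - (s * M)^-1).
pose th' (s : R) := B * (m + M / (s * M) ^+ 2).
have s_gt0 (s : R) : t1 <= s <= t2 -> 0 < s by move=> /andP[/(lt_le_trans t1_gt0)].
have dth (s : R) : t1 <= s <= t2 -> is_derive s 1 th (th' s).
  move=> st; have s0 := s_gt0 s st; apply: derivZ.
  apply: (deriv_eq (derivB (derivM (deriv_id s) (deriv_cst m s))
    (deriv_inv _ (derivM (deriv_id s) (deriv_cst M s))))).
    by rewrite gt_eqF // mulr_gt0.
  by rewrite /=; ring.
have th'E (s : R) : 0 < s -> s * th' s = B * (s * m + (s * M)^-1).
  by move=> s0; rewrite /th'; field; rewrite !gt_eqF.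
have th12 : th t2 - th t1 <= 2 * B * D.
  have -> : th t2 - th t1 =
    B * (t2 * m + (t1 * M)^-1) - B * (t1 * m + (t2 * M)^-1) by rewrite /th; ring.
  have : (t1 * M)^-1 <= D.
    by rewrite -[leLHS]mul1r ler_pdivrMr // mulr_gt0.
  have t2_gt0 : 0 < t2 by exact: lt_le_trans t12.
  have : 0 <= B * (t1 * m + (t2 * M)^-1).
    by rewrite mulr_ge0 // addr_ge0 ?mulr_ge0 ?invr_ge0 ?mulr_ge0 // ltW.
  move=> p0 i1; have : B * (t2 * m + (t1 * M)^-1) <= B * (D + D).
    by rewrite ler_wpM2l // lerD.
  lra.
have split_th (c : R) : 0 <= c ->
    expR (th t2 - th t1) * c <= expR (2 * B * D) * c.
  by move=> c0; rewrite ler_wpM2r // ler_expR.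
have t1P : t1 <= t1 <= t2 by rewrite lexx.
have t2P : t1 <= t2 <= t2 by rewrite lexx t12.
have sub (s : R) : t1 < s < t2 -> t1 <= s <= t2 by move=> /andP[/ltW -> /ltW ->].
split.
  have : phi t1 * expR (th t1) <= phi t2 * expR (th t2).
    apply: (@derive_ge0_le _ (fun s => phi s * expR (th s))
      (fun s => expR (th s) * (phi' s + th' s * phi s)) t1 t2 t12) => s.
      move=> sP; apply: (deriv_eq (derivM (dphi s sP) (deriv_expR (dth s sP)))).
      by ring.
    move=> /sub sP; rewrite mulr_ge0 ?expR_ge0 //.
    have s0 := s_gt0 s sP; rewrite -(pmulr_rge0 _ s0) mulrDr mulrA th'E //.
    by have := phi_le s sP; rewrite ler_norml => /andP[]; lra.
  rewrite -ler_pdivlMr ?expR_gt0 // => /le_trans; apply.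
  apply: le_trans (split_th _ (phi_ge0 _ t2P)).
  by rewrite expRD expRN [leRHS]mulrC mulrA.
have : phi t2 * expR (- th t2) <= phi t1 * expR (- th t1).
  rewrite -lerN2.
  apply: (@derive_ge0_le _ (fun s => - (phi s * expR (- th s)))
    (fun s => expR (- th s) * (th' s * phi s - phi' s)) t1 t2 t12) => s.
    move=> sP; apply: (deriv_eq (derivN (derivM (dphi s sP)
      (deriv_expR (derivN (dth s sP)))))).
    by ring.
  move=> /sub sP; rewrite mulr_ge0 ?expR_ge0 //.
  have s0 := s_gt0 s sP; rewrite -(pmulr_rge0 _ s0) mulrBr mulrA th'E //.
  by have := phi_le s sP; rewrite ler_norml => /andP[]; lra.
rewrite -ler_pdivlMr ?expR_gt0 // => /le_trans; apply.
apply: le_trans (split_th _ (phi_ge0 _ t1P)).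
by rewrite expRD !expRN invrK [leRHS]mulrC [leRHS]mulrA [leRHS]mulrAC.
Qed.

(** * Linear flows on a finite set of states *)

Section Flow.
Variables (R : realType) (I J : finType) (act : J -> I -> I) (kappa : J -> R).
Hypothesis actK : forall j, involutive (act j).
Hypothesis kappa_gt0 : forall j, 0 < kappa j.
Implicit Types (a : I -> R) (h : I -> R -> R) (t : R) (w : I).

Let total : R := \sum_j kappa j.

Let kappa_ge0 j : 0 <= kappa j. Proof. exact: ltW. Qed.

Let total_ge0 : 0 <= total. Proof. exact: sumr_ge0. Qed.

(** In logarithmic time this is the backward equation of a random walk on [I] that
    jumps from [w] to [act j w] at rate [kappa j] and is killed at rate
    [t * a w]; with [h w 0 = 1], [h w t] is the probability of surviving. The
    derivative [h'] is carried along, and the equation is multiplied by [t], so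
    that it makes sense at [0]. *)
Definition is_flow a h (h' : I -> R -> R) : Prop :=
  (forall w t, 0 <= t -> is_derive t 1 (h w) (h' w t)) /\
  (forall w t, 0 <= t -> t * h' w t =
     - (t * a w * h w t) - \sum_j kappa j * (h w t - h (act j w) t)).

Lemma flow_jump_sum (f : I -> R) w :
  \sum_j kappa j * (f w - f (act j w)) =
  total * f w - \sum_j kappa j * f (act j w).
Proof. by rewrite /total mulr_suml -sumrB; apply: eq_bigr => j _; rewrite mulrBr. Qed.

Lemma flow_jump_mass (f : I -> R) :
  \sum_w \sum_j kappa j * (f w - f (act j w)) = 0.
Proof.
rewrite exchange_big big1 // => j _; rewrite -mulr_sumr sumrB.
by rewrite [X in X - _](reindex_inj (can_inj (actK j))) /= subrr mulr0.
Qed.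

Lemma flow_jump_energy (f : I -> R) :
  0 <= \sum_w f w * \sum_j kappa j * (f w - f (act j w)).
Proof.
under eq_bigr do rewrite mulr_sumr.
rewrite exchange_big sumr_ge0 // => j _.
under eq_bigr do rewrite mulrCA.
rewrite -mulr_sumr mulr_ge0 //.
have -> : \sum_w f w * (f w - f (act j w)) =
          2^-1 * \sum_w (f w - f (act j w)) ^+ 2.
  have sq : \sum_w f (act j w) ^+ 2 = \sum_w f w ^+ 2.
    by rewrite [RHS](reindex_inj (can_inj (actK j))).
  have -> : \sum_w (f w - f (act j w)) ^+ 2 =
      \sum_w 2 * (f w * (f w - f (act j w)))
      + (\sum_w f (act j w) ^+ 2 - \sum_w f w ^+ 2).
    by rewrite -sumrB -big_split; apply: eq_bigr => w _ /=; ring.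
  by rewrite sq subrr addr0 -mulr_sumr mulrA mulVf ?mul1r // pnatr_eq0.
by rewrite mulr_ge0 // sumr_ge0 // => w _; exact: sqr_ge0.
Qed.

(** The jumps dissipate the energy [\sum_w h w ^+ 2], which therefore grows at
    most exponentially although the equation is singular at [0]. *)
Lemma flow_eq0 a h h' : is_flow a h h' -> (forall w, h w 0 = 0) ->
  forall w t, 0 <= t -> h w t = 0.
Proof.
move=> [dh hE] h0 w t t_ge0.
pose C := \sum_w `|a w|.
have aC v : - a v <= C.
  rewrite (le_trans (ler_norm _)) // normrN /C (bigD1 v) //= lerDl.
  by rewrite sumr_ge0.
pose V s := \sum_v h v s * h v s.
pose V' s := \sum_v (h' v s * h v s + h v s * h' v s).
have V_le (s : R) : 0 < s -> V' s <= 2 * C * V s.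
  move=> s_gt0; rewrite -(ler_pM2l s_gt0).
  have -> : s * V' s = 2 * \sum_v h v s * (s * h' v s).
    by rewrite /V' !mulr_sumr; apply: eq_bigr => v _; ring.
  rewrite (_ : s * _ = 2 * (s * C * V s)); last by ring.
  rewrite ler_pM2l //.
  under eq_bigr do rewrite (hE _ _ (ltW s_gt0)) mulrBr.
  rewrite sumrB lerBlDr.
  apply: le_trans (_ : s * C * V s <= _); last first.
    by rewrite lerDl flow_jump_energy.
  rewrite /V mulr_sumr ler_sum // => v _.
  rewrite -subr_ge0 (_ : _ - _ = s * (C + a v) * (h v s * h v s)); last by ring.
  apply: mulr_ge0; last by rewrite -expr2 sqr_ge0.
  by apply: mulr_ge0; [exact: ltW|have := aC v; lra].
pose F s := - (V s * expR (- (2 * C) * s)).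
have F_le : F 0 <= F t.
  apply: (@derive_ge0_le _ F
      (fun s => expR (- (2 * C) * s) * (2 * C * V s - V' s))) => //.
    move=> s /andP[s_ge0 _].
    have dV : is_derive s 1 V (V' s).
      by apply: deriv_sum => v _; apply: derivM; exact: dh.
    apply: (deriv_eq (derivN (derivM dV
      (deriv_expR (derivZ (- (2 * C)) (deriv_id s)))))).
    by rewrite /=; ring.
  by move=> s /andP[s_gt0 _]; rewrite mulr_ge0 ?expR_ge0 // subr_ge0 V_le.
have V0 : V 0 = 0 by rewrite /V big1 // => v _; rewrite h0 mul0r.
move: F_le; rewrite /F V0 mul0r oppr0 oppr_ge0 pmulr_lle0 ?expR_gt0 // => V_le0.
have : h w t * h w t <= 0.
  apply: le_trans V_le0; rewrite /V (bigD1 w) //= lerDl sumr_ge0 // => v _.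
  by rewrite -expr2 sqr_ge0.
by rewrite -expr2 => /(conj (sqr_ge0 (h w t)))/andP/le_anti/esym/eqP;
  rewrite sqrf_eq0 => /eqP.
Qed.

(** At a negative global minimum the difference of [h w] with the minimal value
    would vanish, and then be nondecreasing, all the way down from [0]. *)
Lemma flow_ge0 a h h' : is_flow a h h' -> (forall w, 0 <= a w) ->
  (forall w, h w 0 = 1) -> forall w t, 0 <= t -> 0 <= h w t.
Proof.
move=> [dh hE] a_ge0 h0 w0 T T_ge0; rewrite leNgt; apply/negP => hT.
have minP v : exists c : R, 0 <= c <= T /\ forall s : R, 0 <= s <= T -> h v c <= h v s.
  have [|c] := @EVT_min R (h v) 0 T T_ge0.
    apply: derivable_within_continuous => x; rewrite in_itv/= => /andP[x0 _].
    by have [] := dh v x x0.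
  rewrite in_itv/= => cT hc; exists c.
  by split=> // s sT; apply: hc; rewrite in_itv/=.
have [c cP] := choice minP.
pose w := [arg min_(v < w0) h v (c v)]%O.
have wP v (s : R) : 0 <= s <= T -> h w (c w) <= h v s.
  move=> sT; apply: (le_trans _ ((cP v).2 s sT)).
  by rewrite /w; case: arg_minP => // i _; exact.
set b := c w in wP; set m := h w b in wP.
have m_lt0 : m < 0 by apply: le_lt_trans hT; apply: wP; rewrite T_ge0 lexx.
have /andP[b_ge0 bT] : 0 <= b <= T by exact: (cP w).1.
have b_gt0 : 0 < b.
  rewrite lt_neqAle b_ge0 andbT; apply/eqP => b0.
  by move: m_lt0; rewrite /m -b0 h0 ltNge ler01.
pose Y s := h w s - m.
have dY (s : R) : 0 <= s -> is_derive s 1 Y (h' w s).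
  move=> s0; apply: (deriv_eq (derivB (dh w s s0) (deriv_cst m s))).
  by rewrite subr0.
have Y_ge0 v (s : R) : 0 <= s <= T -> 0 <= h v s - m by move=> sT; rewrite subr_ge0 wP.
have YE (s : R) : 0 <= s <= T ->
    s * h' w s >= - (s * a w * Y s) - total * Y s.
  move=> sT; have s0 : 0 <= s by case/andP: sT.
  rewrite hE // (flow_jump_sum (h^~ s)).
  have : 0 <= \sum_j kappa j * (h (act j w) s - m).
    by rewrite sumr_ge0 // => j _; rewrite mulr_ge0 // Y_ge0.
  under eq_bigr do rewrite mulrBr.
  rewrite sumrB -mulr_suml -/total /Y.
  have : 0 <= s * a w * - m by rewrite !mulr_ge0 // oppr_ge0 ltW.
  nra.
have [lam lam0 total_lam] := nat_above total.
have Y_le0 (s : R) : 0 < s <= b -> Y s = 0.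
  move=> /andP[s0 sb].
  have inb (r : R) : 0 <= r <= b -> 0 <= r <= T.
    by move=> /andP[-> rb]; rewrite (le_trans rb).
  have := @integrating_factor_le _ lam (a w) Y (h' w) s b lam0 (ltW s0) sb.
  rewrite {4}/Y subrr mulr0 pmulr_rle0; last first.
    by rewrite mulr_gt0 ?expR_gt0 // exprn_gt0.
  move=> Ys; apply/eqP; rewrite eq_le Y_ge0 ?andbT; last first.
    by rewrite inb // ltW.
  apply: Ys => r rb; first by apply: dY; case/andP: rb.
  have := YE r (inb r rb); have := Y_ge0 w r (inb r rb); rewrite -/(Y r).
  move: total_lam => *; nra.
have : Y 0 <= Y b.
  apply: (@derive_ge0_le _ Y (h' w)) => //.
    by move=> s /andP[s0 _]; exact: dY.
  move=> s /andP[s0 sb].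
  rewrite -(pmulr_rge0 _ s0).
  apply: le_trans (YE s _); last by rewrite (ltW s0) (le_trans (ltW sb)).
  by rewrite Y_le0 ?s0 ?(ltW sb) // !mulr0 oppr0 addr0.
rewrite {2}/Y subrr /Y h0; move: m_lt0; lra.
Qed.

(** * Domination by one state *)

Lemma kappa_lower : exists2 k : R, 0 < k <= 1 & forall j, k <= kappa j.
Proof.
have s_ge0 : 0 <= \sum_j (kappa j)^-1.
  by apply: sumr_ge0 => j _; rewrite invr_ge0.
have s1_gt0 : 0 < 1 + \sum_j (kappa j)^-1 by rewrite ltr_pwDl.
exists (1 + \sum_j (kappa j)^-1)^-1.
  by rewrite invr_gt0 s1_gt0 /= invf_le1 // lerDl.
move=> j; rewrite -[leRHS]invrK lef_pV2 ?posrE ?invr_gt0 //.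
rewrite (bigD1 j) //= [leRHS]addrCA lerDl addr_ge0 //.
by apply: sumr_ge0 => i _; rewrite invr_ge0.
Qed.

Lemma flow_ode_sum a h h' (fl : is_flow a h h') w t : 0 <= t ->
  t * h' w t = - (t * a w * h w t) - total * h w t
               + \sum_j kappa j * h (act j w) t.
Proof.
by move=> t0; rewrite fl.2 // (flow_jump_sum (h^~ t)) opprB addrA addrAC.
Qed.

Lemma flow_mass_derive a h h' (fl : is_flow a h h') t : 0 <= t ->
  t * \sum_w h' w t = - \sum_w t * a w * h w t.
Proof.
move=> t0; rewrite mulr_sumr; under eq_bigr do rewrite fl.2 //.
by rewrite sumrB sumrN (flow_jump_mass (h^~ t)) subr0.
Qed.

(** Damping the neighbour [act j e] by [1 + t * a (act j e)] compensates its
    killing, while what it receives by jumps keeps the same weight. *)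
Lemma damped_neighbour a h h' w t : is_flow a h h' ->
  (forall w, 0 <= a w) -> (forall w, h w 0 = 1) -> 0 <= t ->
  - ((2 + total) * h w t)
    + (1 + t * a w)^-1 * \sum_i kappa i * h (act i w) t <=
  t * (h' w t * (1 + t * a w)^-1 + h w t * - (a w / (1 + t * a w) ^+ 2)).
Proof.
move=> fl a_ge0 h0 t0; have b0 : 0 <= t * a w by rewrite mulr_ge0.
have /andP[r0 r1] := inv1D_bounds b0; have br := mul_inv1D b0.
rewrite -exprVn; set r := (1 + t * a w)^-1 in r0 r1 br *.
have -> : t * (h' w t * r + h w t * - (a w * r ^+ 2)) =
    r * (t * h' w t) - h w t * (t * a w * r) * r by ring.
rewrite (flow_ode_sum fl) // br.
set S := \sum_i _; have x0 : 0 <= h w t := flow_ge0 fl a_ge0 h0 w t0; set x := h w t in x0 *.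
have -> : r * (- (t * a w * x) - total * x + S) =
  - (t * a w * r * x) - total * x * r + r * S by ring.
rewrite br -subr_ge0.
have -> : - ((1 - r) * x) - total * x * r + r * S - x * (1 - r) * r -
    (- ((2 + total) * x) + r * S) = x * (1 + r ^+ 2) + total * (x * (1 - r)).
  by ring.
rewrite addr_ge0 // mulr_ge0 //; first by rewrite addr_ge0 // sqr_ge0.
by rewrite mulr_ge0 // subr_ge0.
Qed.

(** Two comparisons by linear differential inequalities that hold coefficient by
    coefficient: the mass is compared with [h e] plus the damped neighbours of
    [e], which bring in the states two jumps away, and then with [h e] alone. The
    constant does not depend on the rates because a state that is killed slowly
    feeds a neighbour of [e] that is killed slowly as well. *)
Lemma flow_dominated (e : I) (C0 : R) : 0 <= C0 ->
  exists2 C : R, 0 < C & forall a h h', is_flow a h h' ->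
    (forall w, 0 <= a w) -> a e = 0 -> (forall w, h w 0 = 1) ->
    (forall w, w != e -> (forall j, act j w != e) -> exists i j,
      act i (act j w) = e /\ a (act j w) <= C0 * a w) ->
    forall t, 0 <= t -> \sum_w h w t <= C * h e t.
Proof.
move=> C0_ge0.
have [k /andP[k_gt0 k_le1] k_le] := kappa_lower.
have [lam lam_gt0 total_lam] := nat_above (total + 1).
have lam_gt0' : 0 < lam%:R :> R by rewrite ltr0n.
(* The losses [(2 + total) * eps] of the damped neighbours are to be at most half
   of the gain [k] of [e] from these neighbours. *)
pose eps := k / (2 * (2 + total)).
have tot2 : 0 < 2 + total by rewrite ltr_pwDl.
have eps_gt0 : 0 < eps by rewrite divr_gt0 // mulr_gt0.
have epsE : eps * (2 + total) = k / 2.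
  by rewrite /eps invfM mulrA -mulrA mulVf ?mulr1 // gt_eqF.
have eps_le : eps <= 1 / 4.
  rewrite /eps ler_pdivrMr ?mulr_gt0 //; move: total_ge0 k_le1; lra.
(* A state that feeds a neighbour of [e] either is killed at a rate above [lam],
   or that neighbour is damped by at most [1 + C0 * lam]. *)
pose eta := eps * k / (1 + C0 * lam%:R).
have C0lam : 0 <= C0 * lam%:R by rewrite mulr_ge0 // ltW.
have /andP[r0_gt0 r0_le1] := inv1D_bounds C0lam.
have eta_gt0 : 0 < eta by rewrite /eta mulr_gt0 // mulr_gt0.
have eta_le : eta <= k / 2.
  apply: (@le_trans _ _ (eps * k)); first by rewrite /eta ler_piMr // ltW // mulr_gt0.
  by move: eps_le k_gt0; nra.
have N_gt0 : (0 < #|I|)%N by apply/card_gt0P; exists e.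
have N_gt0' : 0 < #|I|%:R :> R by rewrite ltr0n.
pose dl := eta / (lam%:R * #|I|%:R).
have dl_gt0 : 0 < dl by rewrite divr_gt0 // mulr_gt0.
pose d2 := dl * k / lam%:R.
have d2_gt0 : 0 < d2 by rewrite divr_gt0 // mulr_gt0.
exists d2^-1; first by rewrite invr_gt0.
move=> a h h' fl a_ge0 ae h0 reach t t_ge0.
have h_ge0 := flow_ge0 fl a_ge0 h0; have [dh _] := fl.
pose sg s := \sum_w h w s.
pose nb s := \sum_j h (act j e) s.
pose psi s := h e s + eps * \sum_j h (act j e) s * (1 + s * a (act j e))^-1.
pose dmp j s := h' (act j e) s * (1 + s * a (act j e))^-1
  + h (act j e) s * - (a (act j e) / (1 + s * a (act j e)) ^+ 2).
pose flux s := \sum_j (1 + s * a (act j e))^-1 *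
                 \sum_i kappa i * h (act i (act j e)) s.
have nb_ge0 (s : R) : 0 <= s -> 0 <= nb s by move=> s0; apply: sumr_ge0 => j _; exact: h_ge0.
have he_flow (s : R) : 0 <= s -> k * nb s - total * h e s <= s * h' e s.
  move=> s0; rewrite (flow_ode_sum fl) // ae mulr0 mul0r oppr0 add0r addrC lerD2l.
  rewrite mulr_sumr ler_sum // => j _.
  by rewrite ler_wpM2r // h_ge0.
have dsg (s : R) : 0 <= s -> is_derive s 1 sg (\sum_w h' w s).
  by move=> s0; apply: deriv_sum => w _; exact: dh.
have psi_derive (s : R) : 0 <= s -> is_derive s 1 psi (h' e s + eps * \sum_j dmp j s).
  move=> s0; apply: derivD; first exact: dh.
  apply: derivZ; apply: deriv_sum => j _.
  apply: derivM; first exact: dh.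
  apply: deriv_inv (deriv_affine _ _).
  by rewrite gt_eqF // ltr_pwDl // mulr_ge0.
have sg_le_psi (s : R) : 0 <= s -> dl * sg s <= psi s.
  move=> s_ge0; rewrite -subr_ge0.
  pose Y' s := h' e s + eps * \sum_j dmp j s - dl * \sum_w h' w s.
  apply: (@singular_ineq_ge0 _ lam 0 (fun s => psi s - dl * sg s) Y') => //.
    move=> r r0; apply: derivB; first exact: psi_derive.
    by apply: derivZ; exact: dsg.
  move=> {s_ge0 s} s s0.
  pose P := h e s + k / 2 * nb s + eps * flux s.
  have flux_ge j i : (1 + s * a (act j e))^-1 * (kappa i * h (act i (act j e)) s)
      <= flux s.
    rewrite /flux (bigD1 j) //= ler_wpDr //.
      apply: sumr_ge0 => j' _; apply: mulr_ge0; last first.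
        by apply: sumr_ge0 => i' _; rewrite mulr_ge0 // h_ge0.
      by rewrite invr_ge0 addr_ge0 // mulr_ge0.
    rewrite ler_wpM2l ?invr_ge0 ?addr_ge0 ?mulr_ge0 //.
    rewrite (bigD1 i) //= lerDl sumr_ge0 // => i' _.
    by rewrite mulr_ge0 // h_ge0.
  have flux_ge0 : 0 <= flux s.
    apply: sumr_ge0 => j' _; apply: mulr_ge0; last first.
      by apply: sumr_ge0 => i' _; rewrite mulr_ge0 // h_ge0.
    by rewrite invr_ge0 addr_ge0 // mulr_ge0.
  have mass_le w : eta * h w s <= P + eta / lam%:R * (s * a w * h w s).
    have hw := h_ge0 w s s0.
    have nb0 := nb_ge0 s s0; have he0 := h_ge0 e s s0.
    have kill0 : 0 <= eta / lam%:R * (s * a w * h w s).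
      apply: mulr_ge0; last by rewrite !mulr_ge0.
      by rewrite divr_ge0 // ltW.
    have nbk : 0 <= k / 2 * nb s by rewrite mulr_ge0 // divr_ge0 // ltW.
    have ef : 0 <= eps * flux s by rewrite mulr_ge0 // ltW.
    have [->|we] := eqVneq w e.
      have : eta * h e s <= h e s by rewrite ler_piMl //; move: eta_le k_le1; lra.
      by rewrite ae mulr0 mul0r mulr0 addr0 /P; lra.
    have [/existsP[j /eqP jw]|/existsPn nw] := boolP [exists j, act j w == e].
      have hn : h w s <= nb s.
        rewrite /nb (bigD1 j) //= -jw actK lerDl sumr_ge0 // => i _.
        by rewrite h_ge0.
      have : eta * h w s <= k / 2 * nb s.
        apply: ler_pM => //; exact: ltW.
      by rewrite /P; lra.
    have [|i [j [ij aij]]] := reach w we; first by move=> j; exact: nw.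
    have [lam_le|lt_lam] := leP lam%:R (s * a w).
      have : eta * h w s <= eta / lam%:R * (s * a w * h w s).
        rewrite -mulrA ler_wpM2l ?(ltW eta_gt0) // mulrA mulrA ler_peMl //.
        by rewrite -mulrA ler_pdivlMl // mulr1.
      by rewrite /P; lra.
    have wE : act j (act i e) = w by rewrite -ij !actK.
    have aE : act i e = act j w by rewrite -ij actK.
    have : eta * h w s <= eps * flux s.
      apply: le_trans (_ : eps * ((1 + s * a (act i e))^-1 *
          (kappa j * h (act j (act i e)) s)) <= _); last first.
        by rewrite ler_wpM2l ?(ltW eps_gt0).
      rewrite wE aE /eta.
      have -> : eps * k / (1 + C0 * lam%:R) * h w s =
        eps * ((1 + C0 * lam%:R)^-1 * (k * h w s)) by ring.
      rewrite ler_pM2l //; apply: ler_pM; first exact: ltW.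
      - by rewrite mulr_ge0 // ltW.
      - rewrite lef_pV2 ?posrE ?ltr_pwDl ?mulr_ge0 // lerD2l.
        apply: le_trans (_ : s * (C0 * a w) <= _); first by rewrite ler_wpM2l.
        by rewrite mulrCA ler_wpM2l // ltW.
      - by rewrite ler_wpM2r.
    by rewrite /P; lra.
  have sum_le : lam%:R * (dl * sg s) <= P + dl * \sum_w s * a w * h w s.
    have NdlE : lam%:R * dl = eta / #|I|%:R.
      by rewrite /dl; field; rewrite !gt_eqF.
    have dlE : dl = #|I|%:R^-1 * (eta / lam%:R).
      by rewrite /dl; field; rewrite !gt_eqF.
    rewrite mulrA NdlE dlE.
    have -> : P = #|I|%:R^-1 * \sum_(w : I) P.
      by rewrite sumr_const -[P *+ _]mulr_natl mulrA mulVf ?mul1r ?gt_eqF.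
    have -> : eta / #|I|%:R * sg s = #|I|%:R^-1 * \sum_w eta * h w s.
      by rewrite -mulr_sumr /sg; ring.
    rewrite -[X in _ + X]mulrA -mulrDr ler_pM2l ?invr_gt0 //.
    by rewrite mulr_sumr -big_split ler_sum.
  rewrite mul0r addr0 /Y'.
  have -> : s * (h' e s + eps * \sum_j dmp j s - dl * \sum_w h' w s) =
     s * h' e s + eps * \sum_j s * dmp j s - dl * (s * \sum_w h' w s).
    by rewrite -mulr_sumr; ring.
  rewrite (flow_mass_derive fl) //.
  have dmp_le : - ((2 + total) * nb s) + flux s <= \sum_j s * dmp j s.
    rewrite /nb mulr_sumr -sumrN -big_split /= ler_sum // => j _.
    exact: damped_neighbour.
  have := he_flow s s0.
  have psi_he : h e s <= psi s.
    rewrite lerDl mulr_ge0 ?(ltW eps_gt0) // sumr_ge0 // => j _.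
    by rewrite mulr_ge0 ?h_ge0 // invr_ge0 addr_ge0 // mulr_ge0.
  have lam_psi : (total + 1) * h e s <= lam%:R * psi s.
    apply: ler_pM => //; [by rewrite addr_ge0|exact: h_ge0].
  have := ler_wpM2l (ltW eps_gt0) dmp_le.
  have -> : eps * (- ((2 + total) * nb s) + flux s) =
    - (k / 2 * nb s) + eps * flux s by rewrite -epsE; ring.
  rewrite mulrDl mul1r in lam_psi.
  by move: sum_le; rewrite /P mulrBr; lra.
(* Only [e] itself is left once the neighbours are absorbed by the gain
   [k * nb] in the equation of [e]. *)
suff : 0 <= h e t - d2 * sg t.
  by rewrite subr_ge0 -ler_pdivlMl.
pose Z' s := h' e s - d2 * \sum_w h' w s.
apply: (@singular_ineq_ge0 _ lam 0 (fun s => h e s - d2 * sg s) Z') => //.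
  move=> s s0; apply: derivB; first exact: dh.
  by apply: derivZ; exact: dsg.
move=> s s0; rewrite mul0r addr0 /Z' mulrBr mulrCA (flow_mass_derive fl) //.
have kill0 : 0 <= \sum_w s * a w * h w s.
  by apply: sumr_ge0 => w _; rewrite !mulr_ge0 // h_ge0.
have psi_le : psi s <= h e s + nb s.
  rewrite lerD2l mulr_sumr ler_sum // => j _.
  have /andP[r0 r1] := inv1D_bounds (mulr_ge0 s0 (a_ge0 (act j e))).
  have hj := h_ge0 (act j e) s s0.
  rewrite mulrCA ler_piMr // mulr_ile1 //; [exact: ltW|exact: ltW|].
  by move: eps_le; lra.
have : lam%:R * (d2 * sg s) <= k * (h e s + nb s).
  have -> : lam%:R * (d2 * sg s) = k * (dl * sg s).
    rewrite /d2; field; by rewrite gt_eqF.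
  rewrite ler_wpM2l ?(ltW k_gt0) // (le_trans _ psi_le) // sg_le_psi //.
have := he_flow s s0; have he0 := h_ge0 e s s0; have nb0 := nb_ge0 s s0.
have : (total + 1) * h e s <= lam%:R * h e s by rewrite ler_wpM2r.
have : k * h e s <= h e s by rewrite ler_piMl.
have : 0 <= d2 * \sum_w s * a w * h w s by rewrite mulr_ge0 // ltW.
rewrite mulrBr; lra.
Qed.

(** * Sizes relative to the dominating state *)

Section FlowSize.
Variables (e : I) (CA : R).
Hypothesis CA_ge0 : 0 <= CA.

Definition dominated a h h' : Prop :=
  [/\ is_flow a h h', forall w, 0 <= a w, a e = 0, forall w, h w 0 = 1
    & forall t, 0 <= t -> \sum_w h w t <= CA * h e t].

Section Facts.
Variables (a : I -> R) (h h' : I -> R -> R).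
Hypothesis dom : dominated a h h'.

Let fl : is_flow a h h'. Proof. by case: dom. Qed.
Let a_ge0 w : 0 <= a w. Proof. by case: dom. Qed.
Let ae : a e = 0. Proof. by case: dom. Qed.

Lemma dominated_ge0 w t : 0 <= t -> 0 <= h w t.
Proof. by case: dom => _ _ _ h0 _; exact: flow_ge0 fl a_ge0 h0 w t. Qed.

Lemma dominated_sum (P : pred I) t : 0 <= t -> \sum_(w | P w) h w t <= CA * h e t.
Proof.
move=> t0; case: dom => _ _ _ _ /(_ t t0); apply: le_trans.
rewrite [leRHS](bigID P) /= lerDl sumr_ge0 // => w _; exact: dominated_ge0.
Qed.

Lemma dominated_le w t : 0 <= t -> h w t <= CA * h e t.
Proof. by move=> t0; have := dominated_sum (pred1 w) t0; rewrite big_pred1_eq. Qed.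

Lemma jump_le w t : 0 <= t ->
  0 <= \sum_j kappa j * h (act j w) t <= total * CA * h e t.
Proof.
move=> t0; rewrite sumr_ge0 /=; last first.
  by move=> j _; apply: mulr_ge0 => //; exact: dominated_ge0.
rewrite /total !mulr_suml ler_sum // => j _.
by rewrite -mulrA ler_wpM2l // dominated_le.
Qed.

Lemma identity_slow t : 0 <= t ->
  - (total * h e t) <= t * h' e t <= total * CA * h e t.
Proof.
move=> t0; rewrite (flow_ode_sum fl) // ae mulr0 mul0r oppr0 add0r.
have /andP[j0 j1] := jump_le e t0.
have : 0 <= total * h e t by apply: mulr_ge0 => //; exact: dominated_ge0.
by rewrite lerDl j0 /=; lra.
Qed.

End Facts.

(** Every state is fed by an amount of order at most [h e], which varies slowly,
    so that relaxation applies. *)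
Lemma dominated_decay : exists2 C : R, 0 < C & forall a h h',
  dominated a h h' -> forall w t, 0 <= t ->
    h w t <= C * (h e t * (1 + t * a w)^-1).
Proof.
have [lam lam_gt0 total_lam] := nat_above total.
exists (total * CA + (lam%:R + 2) * CA + 1).
  by rewrite ltr_wpDl // addr_ge0 // mulr_ge0 // addr_ge0.
move=> a h h' dom w t t_ge0; have [fl a_ge0 ae h0 _] := dom.
have he0 (s : R) : 0 <= s -> 0 <= h e s by exact: dominated_ge0 dom _ _.
apply: (@le_trans _ _ ((total * CA + (lam%:R + 2) * CA) * (h e t * (1 + t * a w)^-1))).
  apply: (@relaxation_le _ _ (h e) (h' e) (h w) (h' w) lam) => //.
  - exact: fl.1.
  - exact: fl.1.
  - by rewrite mulr_ge0.
  - move=> s s0; have /andP[le1 _] := identity_slow dom s0.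
    apply: le_trans le1; by rewrite lerN2 ler_wpM2r ?he0.
  - move=> s s0; rewrite (flow_ode_sum fl) //.
    have /andP[_ jl] := jump_le dom w s0.
    have : 0 <= total * h w s by rewrite mulr_ge0 // (dominated_ge0 dom).
    move: jl; lra.
  - by move=> s s0; exact: dominated_le dom _ _ _.
rewrite ler_wpM2r ?lerDl // mulr_ge0 ?he0 // invr_ge0 addr_ge0 // mulr_ge0 //.
Qed.

Lemma dominated_neighbour : exists2 C : R, 0 < C & forall a h h',
  dominated a h h' -> forall j t, 0 <= t ->
    h e t * (1 + t * a (act j e))^-1 <= C * h (act j e) t.
Proof.
have [k /andP[k_gt0 k_le1] k_le] := kappa_lower.
have [lam lam_gt0 total_lam] := nat_above (total + total * CA).
have tCA : 0 <= total * CA by rewrite mulr_ge0.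
have lam_gt0' : 0 < lam%:R :> R by rewrite ltr0n.
exists (k / (2 * lam%:R))^-1; first by rewrite invr_gt0 divr_gt0 // mulr_gt0.
move=> a h h' dom j t t_ge0; have [fl a_ge0 ae h0 _] := dom.
rewrite -ler_pdivrMl ?invr_gt0 ?divr_gt0 ?mulr_gt0 // invrK.
have he0 (s : R) : 0 <= s -> 0 <= h e s by exact: dominated_ge0 dom _ _.
apply: (@relaxation_ge _ _ (h e) (h' e) (h (act j e)) (h' (act j e)) lam) => //.
- exact: fl.1.
- exact: fl.1.
- exact: ltW.
- move=> s s0; have /andP[_ le1] := identity_slow dom s0.
  apply: (le_trans le1); rewrite ler_wpM2r ?he0 //; move: total_lam total_ge0; lra.
- move=> s s0; rewrite (flow_ode_sum fl) //.
  have jl : k * h e s <= \sum_i kappa i * h (act i (act j e)) s.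
    rewrite (bigD1 j) //= actK ler_wpDr ?ler_wpM2r ?he0 //.
    by apply: sumr_ge0 => i _; rewrite mulr_ge0 // (dominated_ge0 dom).
  have : total * h (act j e) s <= lam%:R * h (act j e) s.
    rewrite ler_wpM2r ?(dominated_ge0 dom) //; move: total_lam tCA; lra.
  move: jl; lra.
Qed.

(** A state two jumps away from [e] is fed by the neighbours of [e]; if all those
    that feed it are killed at least about as fast as one of [act j0 e] and
    [act j1 e], these two determine its size. *)
Lemma dominated_second (C0 : R) : 0 < C0 -> exists2 C : R, 0 < C & forall a h h',
  dominated a h h' -> forall w j0 j1,
    (exists i, act i w = act j0 e) -> (exists i, act i w = act j1 e) ->
    (forall w', w' = w \/ (exists i, w' = act i w) ->
       a (act j0 e) <= C0 * a w' \/ a (act j1 e) <= C0 * a w') ->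
    forall t, 0 <= t ->
    let v := h e t * ((1 + t * a (act j0 e))^-1 + (1 + t * a (act j1 e))^-1)
               * (1 + t * a w)^-1 in
    h w t <= C * v /\ v <= C * h w t.
Proof.
move=> C0_gt0.
have [k /andP[k_gt0 k_le1] k_le] := kappa_lower.
have [C1 C1_gt0 decay] := dominated_decay.
have [C2 C2_gt0 neighbour] := dominated_neighbour.
have [lam lam_gt0 total_lam] := nat_above (total + total * CA + 1).
have tCA : 0 <= total * CA by rewrite mulr_ge0.
have lam_gt0' : 0 < lam%:R :> R by rewrite ltr0n.
pose D := C1 * (1 + C0).
have D_gt0 : 0 < D by rewrite mulr_gt0 // addr_gt0.
pose U := total * D + (lam%:R + 2) * D.
pose L := (k / C2 / 2 / (2 * lam%:R))^-1.
have L_gt0 : 0 < L by rewrite invr_gt0 !divr_gt0 // mulr_gt0.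
have U_gt0 : 0 < U.
  apply: ltr_wpDl; first by rewrite mulr_ge0 // ltW.
  by rewrite mulr_gt0 // addr_gt0.
exists (U + L); first by rewrite addr_gt0.
move=> a h h' dom w j0 j1 ex0 ex1 feed t t_ge0 /=.
have [fl a_ge0 ae h0 _] := dom.
set b0 := a (act j0 e) in feed *; set b1 := a (act j1 e) in feed *.
have h_ge0 w' (s : R) : 0 <= s -> 0 <= h w' s by exact: dominated_ge0 dom _ _.
pose r b (s : R) := (1 + s * b)^-1.
have rP b (s : R) : 0 <= b -> 0 <= s -> 0 < r b s <= 1.
  by move=> *; apply: inv1D_bounds; rewrite mulr_ge0.
have b0_ge0 : 0 <= b0 by exact: a_ge0.
have b1_ge0 : 0 <= b1 by exact: a_ge0.
pose q s := r b0 s + r b1 s.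
pose q' s := - (b0 / (1 + s * b0) ^+ 2) + - (b1 / (1 + s * b1) ^+ 2).
have dr b (s : R) : 0 <= b -> 0 <= s -> is_derive s 1 (r b) (- (b / (1 + s * b) ^+ 2)).
  move=> b_ge0 s0; apply: deriv_inv (deriv_affine _ _).
  by rewrite gt_eqF // ltr_pwDl // mulr_ge0.
pose v s := h e s * q s.
pose v' s := h' e s * q s + h e s * q' s.
have dv (s : R) : 0 <= s -> is_derive s 1 v (v' s).
  by move=> s0; apply: derivM; [exact: fl.1|apply: derivD; exact: dr].
have q_ge0 (s : R) : 0 <= s -> 0 <= q s.
  move=> s0; have /andP[p0 _] := rP b0 s b0_ge0 s0.
  by have /andP[p1 _] := rP b1 s b1_ge0 s0; rewrite addr_ge0 // ltW.
have v_ge0 (s : R) : 0 <= s -> 0 <= v s by move=> s0; rewrite mulr_ge0 ?h_ge0 ?q_ge0.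
have q'_le (s : R) : 0 <= s -> - q s <= s * q' s <= 0.
  move=> s0.
  have one b : 0 <= b -> 0 <= s * (b / (1 + s * b) ^+ 2) <= r b s.
    move=> b_ge0; have sb0 : 0 <= s * b by rewrite mulr_ge0.
    have /andP[r0 r1] := rP b s b_ge0 s0.
    have -> : s * (b / (1 + s * b) ^+ 2) = s * b * r b s * r b s.
      by rewrite -exprVn -/(r b s); ring.
    rewrite [s * b * r b s](mul_inv1D sb0) -/(r b s).
    by rewrite mulr_ge0 ?subr_ge0 ?(ltW r0) //= ler_piMl ?(ltW r0) // gerBl ltW.
  have := one b0 b0_ge0; have := one b1 b1_ge0.
  by rewrite /q' /q mulrDr !mulrN => /andP[? ?] /andP[? ?]; apply/andP; split; lra.
have v_slow (s : R) : 0 <= s -> - (lam%:R * v s) <= s * v' s <= lam%:R * v s.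
  move=> s0; have /andP[l1 l2] := identity_slow dom s0.
  have /andP[m1 m2] := q'_le s s0.
  have -> : s * v' s = s * h' e s * q s + h e s * (s * q' s) by rewrite /v'; ring.
  have {l1} l1 := ler_wpM2r (q_ge0 s s0) l1.
  have {l2} l2 := ler_wpM2r (q_ge0 s s0) l2.
  have {m1} m1 := ler_wpM2l (h_ge0 e s s0) m1.
  have {m2} m2 := ler_wpM2l (h_ge0 e s s0) m2.
  have := ler_wpM2r (v_ge0 s s0) total_lam.
  have : 0 <= total * v s by rewrite mulr_ge0 ?v_ge0.
  have : 0 <= total * CA * v s by rewrite mulr_ge0 ?v_ge0.
  have := v_ge0 s s0.
  rewrite !mulrDl mul1r /v => *; apply/andP; split.
    by move: l1 m1; lra.
  by move: l2 m2; lra.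
have le_v w' (s : R) : 0 <= s -> b0 <= C0 * a w' \/ b1 <= C0 * a w' ->
    h w' s <= D * v s.
  move=> s0 bw; apply: (le_trans (decay _ _ _ dom w' s s0)).
  have cmp b : 0 <= b -> b <= C0 * a w' -> (1 + s * a w')^-1 <= (1 + C0) * r b s.
    move=> b_ge0 bC.
    have sa0 : 0 < 1 + s * a w' by rewrite ltr_pwDl // mulr_ge0.
    have sb0 : 0 < 1 + s * b by rewrite ltr_pwDl // mulr_ge0.
    rewrite /r -[leLHS]mul1r ler_pdivrMr // [leRHS]mulrAC ler_pdivlMr // mul1r.
    have := ler_wpM2l s0 bC; have : 0 <= s * a w' by rewrite mulr_ge0.
    have : 0 <= C0 * (s * a w') by rewrite !mulr_ge0 // ltW.
    by move: C0_gt0; lra.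
  rewrite /D /v -!mulrA ler_pM2l // mulrCA ler_wpM2l ?h_ge0 //.
  have /andP[/ltW p0 _] := rP b0 s b0_ge0 s0.
  have /andP[/ltW p1 _] := rP b1 s b1_ge0 s0.
  have C01 : 0 <= 1 + C0 by rewrite addr_ge0 // ltW.
  have := mulr_ge0 C01 p0; have := mulr_ge0 C01 p1.
  by case: bw => [/(cmp _ b0_ge0)|/(cmp _ b1_ge0)]; rewrite /q mulrDr; lra.
have vr_ge0 : 0 <= v t * (1 + t * a w)^-1.
  by rewrite mulr_ge0 ?v_ge0 // invr_ge0 addr_ge0 // mulr_ge0.
split.
  apply: (@le_trans _ _ (U * (v t * (1 + t * a w)^-1))); last first.
    by rewrite ler_wpM2r // lerDl ltW.
  apply: (@relaxation_le _ _ v v' (h w) (h' w) lam) => //.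
  - exact: fl.1.
  - by rewrite mulr_ge0 // ltW.
  - exact: ltW.
  - by move=> s s0; case/andP: (v_slow s s0).
  - move=> s s0; rewrite (flow_ode_sum fl) //.
    have : 0 <= total * h w s by rewrite mulr_ge0 ?h_ge0.
    have : \sum_j kappa j * h (act j w) s <= total * D * v s.
      rewrite /total !mulr_suml ler_sum // => j _.
      rewrite -mulrA ler_wpM2l // le_v //; apply: feed; right; by exists j.
    lra.
  - by move=> s s0; apply: le_v => //; apply: feed; left.
apply: (@le_trans _ _ (L * h w t)); last first.
  by rewrite ler_wpM2r ?h_ge0 // lerDr ltW.
rewrite -ler_pdivrMl // /L invrK -/(v t).
apply: (@relaxation_ge _ _ v v' (h w) (h' w) lam) => //.
- exact: fl.1.
- by rewrite !divr_ge0 // ltW.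
- by move=> s s0; case/andP: (v_slow s s0).
- move=> s s0; rewrite (flow_ode_sum fl) //.
  have jump_ge i : k * h (act i w) s <= \sum_j kappa j * h (act j w) s.
    rewrite (bigD1 i) //= ler_wpDr ?ler_wpM2r ?h_ge0 //.
    by apply: sumr_ge0 => j _; rewrite mulr_ge0 ?h_ge0.
  have : total * h w s <= (lam%:R - 1) * h w s.
    by rewrite ler_wpM2r ?h_ge0 //; move: total_lam tCA; lra.
  have lam_half : k / C2 * v s <= 2 * \sum_j kappa j * h (act j w) s.
    rewrite /v /q mulrDr mulrDr [leRHS]mulr_natl mulr2n.
    case: ex0 ex1 => i0 e0 [i1 e1]; apply: lerD.
      apply: le_trans (jump_ge i0); rewrite -mulrA ler_wpM2l ?(ltW k_gt0) //.
      by rewrite ler_pdivrMl // e0 (neighbour _ _ _ dom).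
    apply: le_trans (jump_ge i1); rewrite -mulrA ler_wpM2l ?(ltW k_gt0) //.
    by rewrite ler_pdivrMl // e1 (neighbour _ _ _ dom).
  have := h_ge0 w s s0.
  rewrite mulrBl mul1r mulrDl; move: lam_half; lra.
Qed.
End FlowSize.

(** * The decay of the dominating state *)

Section Stages.
Variables (e : I) (CA : R).
Hypothesis CA_ge0 : 0 <= CA.
Implicit Type u : J -> R.

Definition log_product u t : R := \sum_j kappa j * ln (1 + t * u j).

(** The expected size of [h e] is [\prod_j (1 + t * u j) ^ - kappa j], the
    exponential of [- log_product u t]; this is the quotient. *)
Definition normalized u h t : R := h e t * expR (log_product u t).

Lemma log_product_derive u t : (forall j, 0 <= u j) -> 0 <= t ->
  is_derive t 1 (log_product u) (\sum_j kappa j * (u j / (1 + t * u j))).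
Proof.
move=> u0 t0; apply: deriv_sum => j _; apply: derivZ.
by apply: deriv_ln (deriv_affine _ _); rewrite ltr_pwDl // mulr_ge0.
Qed.

Lemma log_product_ge0 u t : (forall j, 0 <= u j) -> 0 <= t -> 0 <= log_product u t.
Proof.
move=> u0 t0; apply: sumr_ge0 => j _.
by rewrite mulr_ge0 // ln_ge0 // lerDl mulr_ge0.
Qed.

(** At time [t] the factors with [u j] far above [1 / t] decay like
    [t ^ - kappa j] and those far below [1 / t] are still constant. *)
Lemma log_product_slope u t m M (S : {set J}) : (forall j, 0 <= u j) -> 0 < t -> 0 < M ->
  0 <= m -> (forall j, j \in S -> M <= u j) -> (forall j, j \notin S -> u j <= m) ->
  `|t * (\sum_j kappa j * (u j / (1 + t * u j))) - \sum_(j in S) kappa j| <=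
    total * (t * m + (t * M)^-1).
Proof.
move=> u0 t0 M0 m0 uS unS.
rewrite [X in _ - X]big_mkcond mulr_sumr -sumrB /total mulr_suml.
apply: le_trans (ler_norm_sum _ _ _) _; apply: ler_sum => j _.
have tu0 : 0 <= t * u j by rewrite mulr_ge0 // ltW.
have /andP[r0 r1] := inv1D_bounds tu0; have br := mul_inv1D tu0.
set r := (1 + t * u j)^-1 in r0 r1 br *.
have -> : t * (kappa j * (u j * r)) = kappa j * (t * u j * r) by ring.
rewrite br; have tM0 : 0 < t * M by rewrite mulr_gt0.
have tMV : 0 <= (t * M)^-1 by rewrite invr_ge0 ltW.
have tm0 : 0 <= t * m by rewrite mulr_ge0 // ltW.
case: ifPn => [/uS Mu|/unS um].
  have -> : kappa j * (1 - r) - kappa j = - (kappa j * r) by ring.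
  rewrite normrN ger0_norm ?mulr_ge0 ?(ltW r0) // ler_pM2l //.
  rewrite ler_wpDl // lef_pV2 ?posrE // ?ltr_pwDl //.
  by apply: le_trans (_ : t * u j <= _); rewrite ?ler_pM2l // lerDr.
rewrite subr0 ger0_norm ?mulr_ge0 ?subr_ge0 // ler_pM2l //.
rewrite ler_wpDr // -br; apply: le_trans (_ : t * u j <= _).
  by rewrite ler_piMr.
by rewrite ler_pM2l.
Qed.

(** Jumps inside [G] cancel in the sum because the jump [act j] and its inverse
    have the same rate; what remains is killing, the outflow, and an inflow
    from the other states. *)
Lemma group_flow (G : {set I}) rho a h h' t : is_flow a h h' ->
  (forall w, w \in G -> \sum_(j | act j w \notin G) kappa j = rho) -> 0 <= t ->
  t * \sum_(w in G) h' w t =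
    - \sum_(w in G) t * a w * h w t - rho * \sum_(w in G) h w t
    + \sum_(w in G) \sum_(j | act j w \notin G) kappa j * h (act j w) t.
Proof.
move=> fl out t0; rewrite mulr_sumr.
under eq_bigr do rewrite fl.2 //.
rewrite sumrB sumrN -addrA; congr (_ + _).
have -> : \sum_(w in G) \sum_j kappa j * (h w t - h (act j w) t) =
    \sum_(w in G) \sum_(j | act j w \in G) kappa j * (h w t - h (act j w) t)
  + \sum_(w in G) \sum_(j | act j w \notin G) kappa j * (h w t - h (act j w) t).
  rewrite -big_split; apply: eq_bigr => w _.
  by rewrite [LHS](bigID (fun j => act j w \in G)).
have -> : \sum_(w in G) \sum_(j | act j w \in G) kappa j * (h w t - h (act j w) t) = 0.
  rewrite (exchange_big_dep predT) //= big1 // => j _.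
  rewrite -mulr_sumr sumrB [X in X - _](reindex_inj (can_inj (actK j))) /=.
  under [X in X - _]eq_bigl do rewrite actK andbC.
  by rewrite subrr mulr0.
rewrite add0r mulr_sumr -sumrN -sumrN -big_split /=; apply: eq_bigr => w wG.
rewrite -(out w wG) mulr_suml -sumrN -sumrN -big_split /=; apply: eq_bigr => j _.
by ring.
Qed.

(** Up to the time [1 / A] nothing has happened yet: no state is killed, and all
    factors [1 + t * u j] are bounded. *)
Lemma normalized_early (D : R) : exists2 C : R, 0 < C & forall a h h' u A t,
  dominated e CA a h h' -> (forall j, 0 <= u j) -> 0 <= A ->
  (forall w, a w <= A) -> (forall j, u j <= A) -> 0 <= t -> t * A <= D ->
  1 <= C * normalized u h t /\ normalized u h t <= C.
Proof.
pose N : R := #|I|%:R.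
have N_gt0 : 1 <= N by rewrite ler1n; apply/card_gt0P; exists e.
pose C1 := CA * expR D; pose C2 := N * expR (total * D).
have C1_ge0 : 0 <= C1 by rewrite mulr_ge0 // expR_ge0.
have C2_gt0 : 0 < C2 by rewrite mulr_gt0 ?expR_gt0 // (lt_le_trans ltr01).
exists (C1 + C2); first by rewrite ltr_wpDl.
move=> a h h' u A t dom u0 A0 aA uA t0 tA; have [fl a_ge0 ae h0 mass] := dom.
have h_ge0 w (s : R) : 0 <= s -> 0 <= h w s by exact: dominated_ge0 dom _ _.
pose g s := \sum_w h w s; pose g' s := \sum_w h' w s.
have g_ge0 (s : R) : 0 <= s -> 0 <= g s.
  by move=> s0; apply: sumr_ge0 => w _; exact: h_ge0.
have dg (s : R) : 0 <= s -> is_derive s 1 g (g' s).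
  by move=> s0; apply: deriv_sum => w _; exact: fl.1.
have g0 : g 0 = N by rewrite /g (eq_bigr (fun=> 1)) ?sumr_const // => w _; rewrite h0.
have g'P (s : R) : 0 < s -> - (A * g s) <= g' s <= 0.
  move=> s0; have sE := flow_mass_derive fl (ltW s0).
  apply/andP; split; last first.
    rewrite -(pmulr_rle0 _ s0) sE oppr_le0.
    by apply: sumr_ge0 => w _; rewrite !mulr_ge0 ?h_ge0 // ltW.
  rewrite -(ler_pM2l s0) sE mulrN lerN2 /g !mulr_sumr; apply: ler_sum => w _.
  by rewrite -mulrA ler_pM2l // ler_wpM2r // h_ge0 // ltW.
have sub (s : R) : 0 <= s <= t -> 0 <= s by case/andP.
have g_le : g t <= N.
  rewrite -g0 -lerN2; apply: (@derive_ge0_le _ (fun s => - g s) (fun s => - g' s) 0 t t0).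
    by move=> s /sub s0; apply: derivN; exact: dg.
  by move=> s /andP[s0 _]; rewrite oppr_ge0; case/andP: (g'P s s0).
have g_ge : N <= g t * expR (A * t).
  have := @derive_ge0_le _ (fun s => g s * expR (A * s))
    (fun s => expR (A * s) * (g' s + A * g s)) 0 t t0.
  rewrite mulr0 expR0 mulr1 g0; apply.
    move=> s /sub s0.
    apply: (deriv_eq (derivM (dg s s0) (deriv_expR (derivZ A (deriv_id s))))).
    by rewrite /=; ring.
  move=> s /andP[s0 _]; rewrite mulr_ge0 ?expR_ge0 //.
  by case/andP: (g'P s s0) => + _; lra.
have L0 := log_product_ge0 u0 t0.
have LD : log_product u t <= total * D.
  rewrite /total mulr_suml ler_sum // => j _; rewrite ler_wpM2l //.
  have tu : 0 <= t * u j by rewrite mulr_ge0.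
  apply: le_trans (le_ln1Dx _) _; first by apply: lt_le_trans tu; rewrite ltrN10.
  by apply: le_trans tA; rewrite ler_wpM2l.
have he : h e t <= g t.
  by rewrite /g (bigD1 e) //= lerDl sumr_ge0 // => w _; exact: h_ge0.
have n0 : 0 <= normalized u h t by rewrite mulr_ge0 ?expR_ge0 ?h_ge0.
split; last first.
  apply: (@le_trans _ _ C2); last by rewrite lerDr.
  apply: ler_pM; rewrite ?h_ge0 ?expR_ge0 //; first exact: le_trans g_le.
  by rewrite ler_expR.
apply: (@le_trans _ _ (C1 * normalized u h t)); last first.
  by rewrite ler_wpM2r // lerDl ltW.
apply: (le_trans N_gt0); apply: (le_trans g_ge).
apply: (@le_trans _ _ (CA * h e t * expR D)).
  apply: ler_pM; rewrite ?g_ge0 ?expR_ge0 ?mass //.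
  by rewrite ler_expR mulrC.
have -> : CA * h e t * expR D = C1 * h e t by rewrite /C1; ring.
rewrite ler_wpM2l // /normalized ler_peMr ?h_ge0 //.
by rewrite -expR0 ler_expR.
Qed.

(** The cascade principle: as long as the states of [G] are not yet killed while
    all others are killed fast, the mass of [G] leaks out at the constant rate
    [\sum_(j in S) kappa j], which is also the rate at which the expected size
    decays. *)
Lemma normalized_stage (D : R) : exists2 C : R, 0 < C &
  forall a h h' u (G : {set I}) (S : {set J}) m M t1 t2,
  dominated e CA a h h' -> (forall j, 0 <= u j) -> 0 <= m -> 0 < M ->
  e \in G ->
  (forall w, w \in G ->
     \sum_(j | act j w \notin G) kappa j = \sum_(j in S) kappa j) ->
  (forall w, w \in G -> a w <= m) -> (forall w, w \notin G -> M <= a w) ->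
  (forall j, j \in S -> M <= u j) -> (forall j, j \notin S -> u j <= m) ->
  0 < t1 -> t1 <= t2 -> 1 <= D * (t1 * M) -> t2 * m <= D ->
  normalized u h t1 <= C * normalized u h t2 /\
  normalized u h t2 <= C * normalized u h t1.
Proof.
have [C1 C1_gt0 decay] := dominated_decay e CA_ge0.
pose N : R := #|I|%:R.
pose B := 1 + N * total * C1 + total.
have N_ge0 : 0 <= N by [].
have NC_ge0 : 0 <= N * total * C1 by rewrite !mulr_ge0 // ltW.
have B_ge0 : 0 <= B by rewrite !addr_ge0.
pose C := CA * expR (2 * B * D).
have C_ge0 : 0 <= C by rewrite mulr_ge0 // expR_ge0.
exists (C + 1); first by rewrite ltr_wpDl.
move=> a h h' u G S m M t1 t2 dom u0 m0 M0 eG out aG anG uS unS t1_gt0 t12 Dt1 Dt2.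
have [fl a_ge0 ae h0 mass] := dom.
have h_ge0 w (s : R) : 0 <= s -> 0 <= h w s by exact: dominated_ge0 dom _ _.
pose g s := \sum_(w in G) h w s; pose g' s := \sum_(w in G) h' w s.
pose L' s := \sum_j kappa j * (u j / (1 + s * u j)).
pose phi s := g s * expR (log_product u s).
pose phi' s := expR (log_product u s) * (g' s + g s * L' s).
have s_gt0 (s : R) : t1 <= s <= t2 -> 0 < s by move=> /andP[/(lt_le_trans t1_gt0)].
have g_ge0 (s : R) : 0 <= s -> 0 <= g s.
  by move=> s0; apply: sumr_ge0 => w _; exact: h_ge0.
have he_g (s : R) : 0 <= s -> h e s <= g s.
  move=> s0; rewrite /g (bigD1 e) //= lerDl sumr_ge0 // => w _; exact: h_ge0.
have g'_le (s : R) : 0 < s ->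
    `|s * g' s + (\sum_(j in S) kappa j) * g s| <=
    (1 + N * total * C1) * (s * m + (s * M)^-1) * g s.
  move=> s0; rewrite /g' (group_flow fl out (ltW s0)).
  set A := \sum_(w in G) s * a w * h w s.
  set Bi := \sum_(w in G) \sum_(j | _) _.
  rewrite (_ : _ + _ = Bi - A); last by rewrite /g; ring.
  have sMV : 0 < (s * M)^-1 by rewrite invr_gt0 mulr_gt0.
  have sm0 : 0 <= s * m by rewrite mulr_ge0 // ltW.
  have g0 := g_ge0 s (ltW s0).
  have A0 : 0 <= A by apply: sumr_ge0 => w _; rewrite !mulr_ge0 ?h_ge0 // ltW.
  have A1 : A <= s * m * g s.
    rewrite /A /g mulr_sumr ler_sum // => w wG.
    by rewrite ler_wpM2r ?h_ge0 ?(ltW s0) // ler_pM2l // aG.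
  have Bi0 : 0 <= Bi.
    by apply: sumr_ge0 => w _; apply: sumr_ge0 => j _; rewrite mulr_ge0 ?h_ge0 // ltW.
  have Bi1 : Bi <= N * total * C1 * (s * M)^-1 * g s.
    have hj j w : act j w \notin G -> h (act j w) s <= C1 * (s * M)^-1 * g s.
      move=> nG; apply: (le_trans (decay _ _ _ dom _ s (ltW s0))).
      rewrite -mulrA ler_pM2l // mulrC; apply: ler_pM; rewrite ?h_ge0 ?he_g ?(ltW s0) //.
        by rewrite invr_ge0 addr_ge0 // mulr_ge0 // ltW.
      rewrite lef_pV2 ?posrE ?mulr_gt0 // ?ltr_pwDl ?mulr_ge0 ?(ltW s0) //.
      by apply: le_trans (_ : s * a (act j w) <= _); rewrite ?lerDr // ler_pM2l // anG.
    have c0 : 0 <= C1 * (s * M)^-1 * g s by rewrite !mulr_ge0 // ltW.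
    have row w : \sum_(j | act j w \notin G) kappa j * h (act j w) s <=
        total * (C1 * (s * M)^-1 * g s).
      apply: (@le_trans _ _ (\sum_(j | act j w \notin G) kappa j * (C1 * (s * M)^-1 * g s))).
        by apply: ler_sum => j nG; rewrite ler_pM2l // hj.
      rewrite -mulr_suml ler_wpM2r // /total [leRHS](bigID (fun j => act j w \notin G)) /=.
      by rewrite lerDl sumr_ge0.
    apply: (@le_trans _ _ (\sum_(w : I) total * (C1 * (s * M)^-1 * g s))).
      rewrite [leRHS](bigID (fun w => w \in G)) /= ler_wpDr //; last exact: ler_sum.
      by apply: sumr_ge0 => w _; rewrite mulr_ge0.
    by rewrite sumr_const -[_ *+ _]mulr_natl /N !mulrA.
  have T1 : 0 <= N * total * C1 * (s * m) * g s by rewrite mulr_ge0 // mulr_ge0.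
  have T2 : 0 <= (s * M)^-1 * g s by rewrite mulr_ge0 // ltW.
  rewrite ler_norml; apply/andP; split; lra.
have dphi (s : R) : t1 <= s <= t2 -> is_derive s 1 phi (phi' s).
  move=> /s_gt0/ltW s0.
  have dg : is_derive s 1 g (g' s) by apply: deriv_sum => w _; exact: fl.1.
  apply: (deriv_eq (derivM dg (deriv_expR (log_product_derive u0 s0)))).
  by rewrite /phi' /L'; ring.
have phi_ge0 (s : R) : t1 <= s <= t2 -> 0 <= phi s.
  by move=> /s_gt0/ltW s0; rewrite mulr_ge0 ?expR_ge0 // g_ge0.
have phi_le (s : R) : t1 <= s <= t2 ->
    `|s * phi' s| <= B * (s * m + (s * M)^-1) * phi s.
  move=> /s_gt0 s0; have gs := g'_le s s0.
  have ls := log_product_slope u0 s0 M0 m0 uS unS.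
  have -> : s * phi' s = expR (log_product u s) *
    ((s * g' s + (\sum_(j in S) kappa j) * g s)
     + (s * L' s - \sum_(j in S) kappa j) * g s) by rewrite /phi'; ring.
  rewrite normrM (ger0_norm (expR_ge0 _)) /phi [g s * _]mulrC mulrCA.
  rewrite ler_wpM2l ?expR_ge0 // (le_trans (ler_normD _ _)) //.
  set X := s * m + _; have -> : B * X * g s =
    (1 + N * total * C1) * X * g s + total * X * g s by rewrite /B; ring.
  rewrite lerD // normrM (ger0_norm (g_ge0 s (ltW s0))).
  by rewrite ler_wpM2r // g_ge0 // ltW.
have [le1 le2] := slow_variation B_ge0 m0 M0 t1_gt0 t12 dphi phi_ge0 phi_le Dt1 Dt2.
have comp (s : R) : t1 <= s <= t2 ->
    normalized u h s <= phi s /\ phi s <= CA * normalized u h s.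
  move=> /s_gt0/ltW s0; split; first by rewrite ler_wpM2r ?expR_ge0 // he_g.
  rewrite mulrA ler_wpM2r ?expR_ge0 // (le_trans _ (mass s s0)) //.
  rewrite /g [leRHS](bigID (fun w => w \in G)) /= lerDl sumr_ge0 // => w _.
  exact: h_ge0.
have t1P : t1 <= t1 <= t2 by rewrite lexx.
have t2P : t1 <= t2 <= t2 by rewrite lexx t12.
have [p1 q1] := comp t1 t1P; have [p2 q2] := comp t2 t2P.
have n_ge0 (s : R) : t1 <= s <= t2 -> 0 <= normalized u h s.
  by move=> /s_gt0/ltW s0; rewrite mulr_ge0 ?expR_ge0 ?h_ge0.
have n1 := n_ge0 t1 t1P; have n2 := n_ge0 t2 t2P.
have transfer x y z n : 0 <= n -> x <= z -> z <= expR (2 * B * D) * y ->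
    y <= CA * n -> x <= (C + 1) * n.
  move=> n0 xz zy yn; apply: (le_trans xz); apply: (le_trans zy).
  rewrite [leRHS]mulrDl mul1r ler_wpDr // /C [leRHS]mulrAC [leLHS]mulrC.
  by rewrite ler_wpM2r ?expR_ge0.
by split; [exact: transfer n2 p1 le1 q2|exact: transfer n1 p2 le2 q1].
Qed.

End Stages.

End Flow.

(** * Comparison up to a constant factor *)

Section NearRatio.
Variable R : realType.
Implicit Types (C D x y : R).

Definition near_ratio (C x y : R) : Prop := x <= C * y /\ y <= C * x.

Lemma near_ratio_trans C D x y z : 0 <= C -> 0 <= D ->
  near_ratio C x y -> near_ratio D y z -> near_ratio (C * D) x z.
Proof.
move=> C0 D0 [xy yx] [yz zy]; split.
  by apply: (le_trans xy); rewrite -mulrA ler_wpM2l.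
by apply: (le_trans zy); rewrite [C * D]mulrC -mulrA ler_wpM2l.
Qed.

Lemma near_ratio_refl C x : 1 <= C -> 0 <= x -> near_ratio C x x.
Proof. by move=> C1 x0; split; rewrite ler_peMl. Qed.

Lemma near_ratio_sym C x y : near_ratio C x y -> near_ratio C y x.
Proof. by case. Qed.

Lemma near_ratioM C D x y x' y' : 0 <= x -> 0 <= y -> 0 <= x' -> 0 <= y' ->
  near_ratio C x y -> near_ratio D x' y' -> near_ratio (C * D) (x * x') (y * y').
Proof.
move=> x0 y0 x'0 y'0 [xy yx] [xy' yx']; split; rewrite mulrACA; exact: ler_pM.
Qed.

Lemma near_ratioD C x y x' y' :
  near_ratio C x y -> near_ratio C x' y' -> near_ratio C (x + x') (y + y').
Proof. by move=> [xy yx] [xy' yx']; split; rewrite mulrDr lerD. Qed.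

Lemma near_ratioV C x y : 0 < x -> 0 < y -> near_ratio C x y ->
  near_ratio C x^-1 y^-1.
Proof.
move=> x0 y0 [xy yx]; split; rewrite -[leLHS]mul1r ler_pdivrMr //.
  by rewrite mulrAC ler_pdivlMr // mul1r.
by rewrite mulrAC ler_pdivlMr // mul1r.
Qed.

Lemma near_ratio_le C D x y : 0 <= x -> 0 <= y -> C <= D ->
  near_ratio C x y -> near_ratio D x y.
Proof.
move=> x0 y0 CD [xy yx]; split.
  by apply: (le_trans xy); rewrite ler_wpM2r.
by apply: (le_trans yx); rewrite ler_wpM2r.
Qed.

Lemma near_ratio1D C x y : 1 <= C -> x <= C * y -> y <= C * x ->
  near_ratio C (1 + x) (1 + y).
Proof. by move=> C1 xy yx; split; rewrite mulrDr mulr1 lerD. Qed.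

End NearRatio.

(** * The dihedral flow *)

Section Dihedral.
Variables (R : realType) (m : nat) (kappa : 'I_m.+3 -> R) (G0 : R).
Hypothesis kappa_gt0 : forall j, 0 < kappa j.
Hypothesis kappa_refl : forall i j, kappa (i + i - j) = kappa j.
Hypothesis G0_ge1 : 1 <= G0.

(** [(false, k)] stands for the rotation by [2 pi k / n] and [(true, k)] for the
    reflection in the root [k]. With this labelling, composing with the
    reflection in the root [j] on the left is [reflect j]. *)
Definition state : finType := (bool * 'I_m.+3)%type.

Definition reflect (j : 'I_m.+3) (w : state) : state := (~~ w.1, j - w.2).

Definition identity_state : state := (false, 0).

Local Notation e := identity_state.

Lemma reflectK j : involutive (reflect j).
Proof. by case=> b k; rewrite /reflect /= negbK subKr. Qed.

(** For two points of the closed chamber with distances [x0], [x1] and [y0], [y1]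
    to its two walls, [p = x0 * y0] and [q = x1 * y1] are the products for the
    same wall, and [z1 = x0 * y1] and [z2 = x1 * y0] the mixed ones. All rates
    are comparable to sums of these four numbers; the indices [0] and [-1] are
    those of the simple roots. *)
Record wall_rates (a : state -> R) (u : 'I_m.+3 -> R) (p q z1 z2 : R) : Prop :=
  WallRates {
    wr_p : 0 <= p;
    wr_q : 0 <= q;
    wr_z1 : 0 <= z1;
    wr_z2 : 0 <= z2;
    wr_z : z1 * z2 = p * q;
    wr_u0 : u 0 = p;
    wr_u1 : u (-1) = q;
    wr_u : forall k, k != 0 -> k != -1 ->
      p + q + z1 + z2 <= u k <= G0 * (p + q + z1 + z2);
    wr_refl : forall k, a (true, k) = 2 * u k;
    wr_id : a (false, 0) = 0;
    wr_rot1 : p + q + z1 <= a (false, 1) <= G0 * (p + q + z1);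
    wr_rotN1 : p + q + z2 <= a (false, -1) <= G0 * (p + q + z2);
    wr_rot : forall k, k != 0 -> k != 1 -> k != -1 ->
      p + q + z1 + z2 <= a (false, k) <= G0 * (p + q + z1 + z2)
  }.

Section Rates.
Variables (a : state -> R) (u : 'I_m.+3 -> R) (p q z1 z2 : R).
Hypothesis wr : wall_rates a u p q z1 z2.
Let N := p + q + z1 + z2.

Let p0 : 0 <= p := wr_p wr.
Let q0 : 0 <= q := wr_q wr.
Let z10 : 0 <= z1 := wr_z1 wr.
Let z20 : 0 <= z2 := wr_z2 wr.

Lemma rates_N_ge0 : 0 <= N. Proof. by rewrite /N !addr_ge0. Qed.

Lemma rates_u k : 0 <= u k <= G0 * N.
Proof.
have GN x : 0 <= x -> x <= N -> x <= G0 * N.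
  by move=> x0 xN; apply: (le_trans xN); rewrite ler_peMl // rates_N_ge0.
have [->|k0] := eqVneq k 0.
  by rewrite (wr_u0 wr) p0 GN // /N; move: p0 q0 z10 z20; lra.
have [->|k1] := eqVneq k (-1).
  by rewrite (wr_u1 wr) q0 GN // /N; move: p0 q0 z10 z20; lra.
by have /andP[kN ->] := wr_u wr k0 k1; rewrite (le_trans rates_N_ge0 kN).
Qed.

Lemma rates_rot k : k != 0 -> p + q <= a (false, k).
Proof.
move=> k0; have [->|k1] := eqVneq k 1.
  by have /andP[+ _] := wr_rot1 wr; move: z10; lra.
have [->|kN1] := eqVneq k (-1).
  by have /andP[+ _] := wr_rotN1 wr; move: z20; lra.
by have /andP[+ _] := wr_rot wr k0 k1 kN1; move: z10 z20; lra.
Qed.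

Lemma rates_refl k : k = 0 \/ k = -1 \/ 2 * N <= a (true, k).
Proof.
have [->|k0] := eqVneq k 0; first by left.
have [->|k1] := eqVneq k (-1); first by right; left.
right; right; rewrite (wr_refl wr) ler_pM2l //.
by have /andP[] := wr_u wr k0 k1.
Qed.

Lemma rates_a w : 0 <= a w <= 2 * G0 * N.
Proof.
have N0 := rates_N_ge0.
have small x : x <= N -> G0 * x <= 2 * G0 * N.
  move=> xN; have : G0 * x <= G0 * N by rewrite ler_wpM2l // (le_trans ler01).
  have : 0 <= G0 * N by rewrite mulr_ge0 // (le_trans ler01).
  lra.
case: w => [[] k].
  have /andP[uk0 ukN] := rates_u k; rewrite (wr_refl wr) mulr_ge0 //=.
  by rewrite -mulrA ler_pM2l.
have [->|k0] := eqVneq k 0.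
  by rewrite (wr_id wr) lexx mulr_ge0 // mulr_ge0 // (le_trans ler01).
rewrite (le_trans _ (rates_rot k0)) ?addr_ge0 //=.
have [->|k1] := eqVneq k 1.
  have /andP[_ le1] := wr_rot1 wr; apply: (le_trans le1); apply: small.
  by rewrite /N; move: z20; lra.
have [->|kN1] := eqVneq k (-1).
  have /andP[_ le1] := wr_rotN1 wr; apply: (le_trans le1); apply: small.
  by rewrite /N; move: z10; lra.
by have /andP[_ le1] := wr_rot wr k0 k1 kN1; apply: (le_trans le1); exact: small.
Qed.

End Rates.

Lemma dihedral_dominated : exists2 CA : R, 0 <= CA &
  forall a h h' u p q z1 z2, wall_rates a u p q z1 z2 ->
    is_flow reflect kappa a h h' -> (forall w, h w 0 = 1) ->
    dominated reflect kappa e CA a h h'.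
Proof.
have [C C_gt0 domP] := flow_dominated reflectK kappa_gt0 e (ler0n R 2).
exists C; first exact: ltW.
move=> a h h' u p q z1 z2 wr fl h0.
have a0 w : 0 <= a w by case/andP: (rates_a wr w).
split=> //; first exact: wr_id wr.
apply: (domP a h h' fl a0 (wr_id wr) h0) => -[[] k].
  move=> _ /(_ k); rewrite /reflect /= subrr eqxx //.
move=> k0 _; have {}k0 : k != 0 by apply: contraNneq k0 => ->.
exists 0, k; rewrite /reflect /= subrr subr0; split=> //.
rewrite (wr_refl wr) (wr_u0 wr) ler_pM2l //.
by have := rates_rot wr k0; have := wr_q wr; lra.
Qed.

Lemma sum_reindexed (f : 'I_m.+3 -> 'I_m.+3) (P Q : pred 'I_m.+3) :
  injective f -> (forall j, kappa (f j) = kappa j) -> (forall j, P (f j) = Q j) ->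
  \sum_(j | P j) kappa j = \sum_(j | Q j) kappa j.
Proof.
by move=> f_inj kf PQ; rewrite (reindex_inj f_inj); apply: eq_big.
Qed.

Lemma eq_pm (x y j c : 'I_m.+3) :
  x - y = j - c \/ x - y = c - j -> (x == y) = (j == c).
Proof. by rewrite -subr_eq0 -[j == c]subr_eq0 => -[->|->] //; rewrite -opprB oppr_eq0. Qed.

(** From each of these four states exactly two jumps stay among the four. Their
    indices are [0] and [-1], up to a substitution [j -> 2 i - j], under which
    [kappa] is invariant. *)
Lemma four_group_rate (r : 'I_m.+3) w :
  let G := [set e; (true, 0); (true, -1); (false, r)]%SET : {set state} in
  r = 1 \/ r = -1 -> w \in G ->
  \sum_(j | reflect j w \notin G) kappa j = \sum_(j in ~: [set 0; -1]) kappa j.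
Proof.
move=> G r1 wG.
have kN j : kappa (- j) = kappa j by rewrite -(kappa_refl 0 j) !add0r.
have kN2 j : kappa (-1 - 1 - j) = kappa j by exact: kappa_refl.
have idI : injective (fun j : 'I_m.+3 => j) by [].
have N2I : injective (fun j : 'I_m.+3 => - 1 - 1 - j).
  exact: can_inj (fun j => subKr (-1 - 1) j).
have inG b k : ((b, k) \in G) = if b then (k == 0) || (k == -1) else (k == 0) || (k == r).
  by rewrite !inE !xpair_eqE; case: b; rewrite /= ?orbF.
have inS j : (j \in (~: [set 0; -1])%SET) = ~~ ((j == 0) || (j == -1)) by rewrite !inE.
move: wG; rewrite !inE -!orbA => /or4P[] /eqP -> {w}.
- by apply: (sum_reindexed idI) => // j; rewrite inS /reflect /= inG subr0.
- case: r1 => r1.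
    apply: (sum_reindexed (@oppr_inj _)) => // j; rewrite inS /reflect /= inG subr0 r1.
    by rewrite oppr_eq0 eqr_oppLR.
  by apply: (sum_reindexed idI) => // j; rewrite inS /reflect /= inG subr0 r1.
- case: r1 => r1.
    apply: (sum_reindexed idI) => // j; rewrite inS /reflect /= inG r1 orbC.
    by congr (~~ (_ || _)); apply: eq_pm; [left; ring|left; ring].
  apply: (sum_reindexed N2I) => // j; rewrite inS /reflect /= inG r1 orbC.
  by congr (~~ (_ || _)); apply: eq_pm; right; ring.
- case: r1 => ->.
    apply: (sum_reindexed (@oppr_inj _)) => // j; rewrite inS /reflect /= inG orbC.
    by congr (~~ (_ || _)); apply: eq_pm; right; ring.
  apply: (sum_reindexed N2I) => // j; rewrite inS /reflect /= inG orbC.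
  by congr (~~ (_ || _)); apply: eq_pm; right; ring.
Qed.

Lemma pair_group_rate (s : 'I_m.+3) w :
  let G := [set e; (true, s)]%SET : {set state} in w \in G ->
  \sum_(j | reflect j w \notin G) kappa j = \sum_(j in ~: [set s]) kappa j.
Proof.
move=> G; rewrite !inE => /orP[] /eqP ->; apply: eq_bigl => j.
  by rewrite !inE !xpair_eqE /= subr0.
by rewrite !inE !xpair_eqE /= orbF subr_eq0.
Qed.

Section Regimes.
Variables (C : R) (a : state -> R) (h : state -> R -> R) (u : 'I_m.+3 -> R).
Variables (p q z1 z2 : R).
Hypothesis wr : wall_rates a u p q z1 z2.
Let D := 3 * G0 + 2.
Let N := p + q + z1 + z2.
Let mu := Num.max p q.
Let nu := Num.min p q.
Let Q := normalized kappa e u h.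

(* The cascade principle of [normalized_stage], for one given flow. *)
Hypothesis stage : forall (G : {set state}) (S : {set 'I_m.+3}) (lo hi s1 s2 : R),
  0 <= lo -> 0 < hi -> e \in G ->
  (forall w, w \in G ->
     \sum_(j | reflect j w \notin G) kappa j = \sum_(j in S) kappa j) ->
  (forall w, w \in G -> a w <= lo) -> (forall w, w \notin G -> hi <= a w) ->
  (forall j, j \in S -> hi <= u j) -> (forall j, j \notin S -> u j <= lo) ->
  0 < s1 -> s1 <= s2 -> 1 <= D * (s1 * hi) -> s2 * lo <= D ->
  near_ratio C (Q s1) (Q s2).

Let p0 : 0 <= p := wr_p wr.
Let q0 : 0 <= q := wr_q wr.
Let z10 : 0 <= z1 := wr_z1 wr.
Let z20 : 0 <= z2 := wr_z2 wr.

Let mu_p : p <= mu. Proof. by rewrite /mu le_max lexx. Qed.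
Let mu_q : q <= mu. Proof. by rewrite /mu le_max lexx orbT. Qed.
Let nu_p : nu <= p. Proof. by rewrite /nu ge_min lexx. Qed.
Let nu_q : nu <= q. Proof. by rewrite /nu ge_min lexx orbT. Qed.
Let nu0 : 0 <= nu. Proof. by rewrite /nu le_min p0. Qed.
Let mu0 : 0 <= mu. Proof. exact: le_trans mu_p. Qed.
Let mu_sum : mu <= p + q. Proof. by rewrite /mu ge_max lerDl lerDr p0 q0. Qed.
Let mu_N : mu <= N.
Proof. by apply: (le_trans mu_sum); rewrite /N -addrA lerDl addr_ge0. Qed.
Let mu_pq : p + q <= 2 * mu.
Proof. by rewrite mulrDl mul1r lerD. Qed.
Let G00 : 0 <= G0. Proof. exact: le_trans G0_ge1. Qed.
Let G0mu3 : 0 <= 3 * G0 * mu. Proof. by rewrite mulr_ge0 // mulr_ge0. Qed.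
Let D_ge2 : 2 <= D. Proof. by rewrite lerDr mulr_ge0. Qed.

Lemma four_states_regime s1 s2 :
  0 < s1 -> s1 <= s2 -> 0 < N -> 1 <= s1 * N -> s2 * mu <= 1 ->
  near_ratio C (Q s1) (Q s2).
Proof.
move=> s1_gt0 s12 N_gt0 s1N s2mu.
have s2_ge0 : 0 <= s2 by rewrite (le_trans (ltW s1_gt0)).
have group (r : 'I_m.+3) : r = 1 \/ r = -1 -> a (false, r) <= 3 * G0 * mu ->
    (forall k, k != 0 -> k != r -> N / 2 <= a (false, k)) ->
    near_ratio C (Q s1) (Q s2).
  move=> r1 slow fast.
  apply: (@stage [set e; (true, 0); (true, -1); (false, r)]%SET
    (~: [set 0; -1])%SET (3 * G0 * mu) (N / 2)) => //.
  - by rewrite divr_gt0.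
  - by rewrite !inE eqxx.
  - by move=> w; exact: four_group_rate.
  - have G0mu : mu <= G0 * mu by rewrite ler_peMl.
    move=> w; rewrite !inE -!orbA => /or4P[] /eqP -> //.
    + by rewrite (wr_id wr).
    + by rewrite (wr_refl wr) (wr_u0 wr); move: mu_p mu0; lra.
    + by rewrite (wr_refl wr) (wr_u1 wr); move: mu_q mu0; lra.
  - move=> [[] k]; rewrite !inE !xpair_eqE /= ?orbF negb_or => /andP[k0 k1].
      have [k_eq|[k_eq|]] := rates_refl wr k.
      + by rewrite k_eq eqxx in k0.
      + by rewrite k_eq eqxx in k1.
      + by rewrite -/N; move: N_gt0; lra.
    exact: fast.
  - move=> j; rewrite !inE negb_or => /andP[j0 j1].
    by have /andP[+ _] := wr_u wr j0 j1; rewrite -/N; move: N_gt0; lra.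
  - have G0mu : mu <= G0 * mu by rewrite ler_peMl.
    move=> j; rewrite !inE negbK => /orP[] /eqP ->.
      by rewrite (wr_u0 wr); move: mu_p mu0; lra.
    by rewrite (wr_u1 wr); move: mu_q mu0; lra.
  - have : 1 * (s1 * N) <= D / 2 * (s1 * N).
      by rewrite ler_pM2r ?mulr_gt0 //; move: D_ge2; lra.
    by lra.
  - have : 3 * G0 * (s2 * mu) <= 3 * G0 * 1.
      by rewrite ler_wpM2l // mulr_ge0 // (le_trans ler01).
    by rewrite /D; move: G0_ge1; lra.
(* Since [z1 * z2 = p * q], the smaller of the two is at most [mu], and so the
   corresponding elementary rotation is killed slowly. *)
have min_le x y : 0 <= x -> x <= y -> x * y = p * q -> x <= mu.
  move=> x0 xy xyE; rewrite leNgt; apply/negP => mux.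
  have : mu * mu < x * y by apply: ltr_pM => //; exact: lt_le_trans mux xy.
  have : p * q <= mu * mu by apply: ler_pM.
  by rewrite xyE; lra.
have rot_le z : z <= mu -> G0 * (p + q + z) <= 3 * G0 * mu.
  move=> zmu; rewrite [3 * G0]mulrC -mulrA ler_pM2l ?(lt_le_trans ltr01) //.
  by move: mu_pq; lra.
have [z12|z21] := leP z1 z2.
  apply: (group 1); first by left.
    have /andP[_ le1] := wr_rot1 wr; apply: (le_trans le1); apply: rot_le.
    exact: min_le z10 z12 (wr_z wr).
  move=> k k0 k1; have [->|kN1] := eqVneq k (-1).
    by have /andP[+ _] := wr_rotN1 wr; rewrite /N; move: z12 p0 q0 z20; lra.
  by have /andP[+ _] := wr_rot wr k0 k1 kN1; rewrite -/N; move: N_gt0; lra.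
apply: (group (-1)); first by right.
  have /andP[_ le1] := wr_rotN1 wr; apply: (le_trans le1); apply: rot_le.
  by apply: (min_le z2 z1); rewrite ?(ltW z21) // mulrC (wr_z wr).
move=> k k0 kN1; have [->|k1] := eqVneq k 1.
  by have /andP[+ _] := wr_rot1 wr; rewrite /N; move: z21 p0 q0 z10; lra.
by have /andP[+ _] := wr_rot wr k0 k1 kN1; rewrite -/N; move: N_gt0; lra.
Qed.

Lemma two_states_regime s1 s2 :
  0 < s1 -> s1 <= s2 -> 0 < mu -> 1 <= s1 * mu -> s2 * nu <= 1 ->
  near_ratio C (Q s1) (Q s2).
Proof.
move=> s1_gt0 s12 mu_gt0 s1mu s2nu.
have s2_ge0 : 0 <= s2 by rewrite (le_trans (ltW s1_gt0)).
have group (s s' : 'I_m.+3) : u s = nu -> u s' = mu ->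
    (forall k, k != s -> k != s' -> N <= u k) ->
    near_ratio C (Q s1) (Q s2).
  move=> us us' other.
  have u_ge k : k != s -> mu <= u k.
    move=> ks; have [->|ks'] := eqVneq k s'; first by rewrite us'.
    exact: le_trans (other k ks ks').
  apply: (@stage [set e; (true, s)]%SET (~: [set s])%SET (2 * nu) mu) => //.
  - by rewrite mulr_ge0.
  - by rewrite !inE eqxx.
  - by move=> w; exact: pair_group_rate.
  - move=> w; rewrite !inE => /orP[] /eqP ->.
      by rewrite (wr_id wr) mulr_ge0.
    by rewrite (wr_refl wr) us.
  - move=> [[] k]; rewrite !inE !xpair_eqE /= ?orbF => k0.
      by rewrite (wr_refl wr); have := u_ge k k0; move: mu0; lra.
    by apply: le_trans (rates_rot wr k0).
  - by move=> j; rewrite !inE; exact: u_ge.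
  - by move=> j; rewrite !inE negbK => /eqP ->; rewrite us; move: nu0; lra.
  - have : 1 * (s1 * mu) <= D * (s1 * mu).
      by rewrite ler_pM2r ?mulr_gt0 //; move: D_ge2; lra.
    by lra.
  - by move: D_ge2; lra.
have other k : k != 0 -> k != -1 -> N <= u k.
  by move=> k0 k1; have /andP[] := wr_u wr k0 k1.
have [pq|qp] := leP p q.
  apply: (group 0 (-1)); last exact: other.
    by rewrite (wr_u0 wr) /nu min_l.
  by rewrite (wr_u1 wr) /mu max_r.
apply: (group (-1) 0); last by move=> k k1 k0; exact: other.
  by rewrite (wr_u1 wr) /nu min_r // ltW.
by rewrite (wr_u0 wr) /mu max_l // ltW.
Qed.

Lemma one_state_regime s1 s2 :
  0 < s1 -> s1 <= s2 -> 0 < nu -> 1 <= s1 * nu ->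
  near_ratio C (Q s1) (Q s2).
Proof.
move=> s1_gt0 s12 nu_gt0 s1nu.
have s2_ge0 : 0 <= s2 by rewrite (le_trans (ltW s1_gt0)).
have u_ge k : nu <= u k.
  have [->|k0] := eqVneq k 0; first by rewrite (wr_u0 wr).
  have [->|k1] := eqVneq k (-1); first by rewrite (wr_u1 wr).
  have /andP[Nu _] := wr_u wr k0 k1; apply: le_trans Nu.
  exact: le_trans nu_p (le_trans mu_p mu_N).
apply: (@stage [set e]%SET [set: _]%SET 0 nu) => //.
- by rewrite inE.
- move=> w; rewrite inE => /eqP ->; apply: eq_bigl => j.
  by rewrite !inE xpair_eqE.
- by move=> w; rewrite inE => /eqP ->; rewrite (wr_id wr).
- move=> [[] k]; rewrite !inE xpair_eqE /= => k0.
    by rewrite (wr_refl wr); have := u_ge k; move: nu0; lra.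
  have := rates_rot wr k0; move: nu_p q0; lra.
- by move=> j; rewrite inE.
- have : 1 * (s1 * nu) <= D * (s1 * nu).
    by rewrite ler_pM2r ?mulr_gt0 //; move: D_ge2; lra.
  by lra.
- by rewrite mulr0; move: D_ge2; lra.
Qed.

End Regimes.

Section Cascade.
Variables (CA : R).
Hypothesis CA_ge0 : 0 <= CA.

(** The four regimes, separated by the times [1 / N], [1 / max p q] and
    [1 / min p q]: all states are alive, then the identity, the two simple
    reflections and the one of the two elementary rotations that is killed
    slowly (one is, because [z1 * z2 = p * q]), then the identity and one simple
    reflection, and finally the identity alone. *)
Lemma normalized_bounded : exists2 C : R, 0 < C &
  forall a h h' u p q z1 z2 t, wall_rates a u p q z1 z2 ->
    dominated reflect kappa e CA a h h' -> 0 <= t ->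
    1 <= C * normalized kappa e u h t /\ normalized kappa e u h t <= C.
Proof.
pose D := 3 * G0 + 2.
have D_ge2 : 2 <= D by rewrite /D; move: G0_ge1; lra.
have [Ce Ce_gt0 early] := normalized_early reflectK kappa_gt0 e CA_ge0 D.
have [Cs0 Cs0_gt0 stage] := normalized_stage reflectK kappa_gt0 e CA_ge0 D.
pose Cs := Cs0 + 1.
have Cs_ge1 : 1 <= Cs by rewrite /Cs lerDr ltW.
have Cs_ge0 : 0 <= Cs by exact: le_trans Cs_ge1.
pose C3 := Cs * Cs * Cs.
have C3_ge0 : 0 <= C3 by rewrite !mulr_ge0.
have C3_gt0 : 0 < C3 by rewrite !mulr_gt0 // (lt_le_trans ltr01).
exists (Ce * C3); first by rewrite mulr_gt0.
move=> a h h' u p q z1 z2 t wr dom t_ge0.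
have p0 := wr_p wr; have q0 := wr_q wr; have z10 := wr_z1 wr; have z20 := wr_z2 wr.
pose N := p + q + z1 + z2.
have N0 : 0 <= N by exact: rates_N_ge0 wr.
pose Q := normalized kappa e u h.
have h_ge0 w (s : R) : 0 <= s -> 0 <= h w s.
  by case: dom => fl a0 _ h0 _; exact: (flow_ge0 kappa_gt0 fl a0 h0 w).
have Q_ge0 (s : R) : 0 <= s -> 0 <= Q s.
  by move=> s0; rewrite mulr_ge0 ?expR_ge0 ?h_ge0.
have u0 j : 0 <= u j by case/andP: (rates_u wr j).
pose mu := Num.max p q; pose nu := Num.min p q.
have mu_N : mu <= N.
  by rewrite /mu ge_max /N -!addrA lerDl (addrCA p) lerDl !addr_ge0.
have nu_mu : nu <= mu by rewrite /nu /mu ge_min !le_max lexx.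
have start (s : R) : 0 <= s -> s * N <= 1 -> 1 <= Ce * Q s /\ Q s <= Ce.
  move=> s0 sN; apply: (early a h h' u (2 * G0 * N)) => //.
  - by rewrite mulr_ge0 // mulr_ge0 // (le_trans ler01).
  - by move=> w; case/andP: (rates_a wr w).
  - move=> j; have /andP[_ uj] := rates_u wr j; apply: (le_trans uj).
    by rewrite -mulrA ler_peMl // ?ler1n // mulr_ge0 // (le_trans ler01).
  - rewrite mulrCA ; have : 2 * G0 * (s * N) <= 2 * G0 * 1.
      by rewrite ler_wpM2l // mulr_ge0 // (le_trans ler01).
    by rewrite /D; move: G0_ge1; lra.
have cascade (G : {set state}) (S : {set 'I_m.+3}) (lo hi s1 s2 : R) :
    0 <= lo -> 0 < hi -> e \in G ->
    (forall w, w \in G ->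
       \sum_(j | reflect j w \notin G) kappa j = \sum_(j in S) kappa j) ->
    (forall w, w \in G -> a w <= lo) -> (forall w, w \notin G -> hi <= a w) ->
    (forall j, j \in S -> hi <= u j) -> (forall j, j \notin S -> u j <= lo) ->
    0 < s1 -> s1 <= s2 -> 1 <= D * (s1 * hi) -> s2 * lo <= D ->
    near_ratio Cs (Q s1) (Q s2).
  move=> lo0 hi0 eG out aG anG uS unS s1_gt0 s12 s1hi s2lo.
  apply: (@near_ratio_le _ Cs0); rewrite ?lerDl ?Q_ge0 ?(ltW s1_gt0) //.
    exact: le_trans (ltW s1_gt0) s12.
  exact: (stage a h h' u G S lo hi).
have four := four_states_regime wr cascade.
have two := two_states_regime wr cascade.
have one := one_state_regime wr cascade.
have finish (s : R) : 0 <= s -> s * N <= 1 -> near_ratio C3 (Q s) (Q t) ->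
    1 <= Ce * C3 * Q t /\ Q t <= Ce * C3.
  move=> s0 sN [Qst Qts]; have [le1 le2] := start s s0 sN; split.
    by apply: (le_trans le1); rewrite -mulrA ler_pM2l.
  by apply: (le_trans Qts); rewrite mulrC ler_wpM2r.
have self (s : R) : 0 <= s -> near_ratio Cs (Q s) (Q s).
  by move=> s0; apply: near_ratio_refl => //; exact: Q_ge0.
have chain (s1 s2 s3 : R) : near_ratio Cs (Q s1) (Q s2) -> near_ratio Cs (Q s2) (Q s3) ->
    near_ratio Cs (Q s3) (Q t) -> near_ratio C3 (Q s1) (Q t).
  move=> n1 n2 n3; apply: near_ratio_trans n3 => //; first by rewrite mulr_ge0.
  exact: near_ratio_trans n1 n2.
have [tN|Nt] := leP (t * N) 1.
  by apply: (finish t) => //; apply: chain; exact: self.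
have t_gt0 : 0 < t.
  by rewrite lt_neqAle t_ge0 andbT; apply: contraTneq Nt => <-; rewrite mul0r -leNgt.
have N_gt0 : 0 < N by rewrite -(pmulr_rgt0 _ t_gt0) (lt_trans ltr01).
have inv_le x : 0 < x -> 1 < t * x -> [/\ 0 < x^-1, x^-1 <= t & x^-1 * x = 1].
  move=> x0 tx; rewrite invr_gt0 x0 mulVf ?gt_eqF //; split=> //.
  by rewrite -[leLHS]mul1r ler_pdivrMr // ltW.
have [sN_gt0 sNt sNE] := inv_le N N_gt0 Nt.
have inv_anti (x y : R) : 0 < x -> x <= y -> y^-1 <= x^-1.
  by move=> x0 xy; rewrite lef_pV2 ?posrE // (lt_le_trans x0).
apply: (finish N^-1); rewrite ?sNE ?(ltW sN_gt0) //.
have [tmu|mut] := leP (t * mu) 1.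
  by apply: (chain _ t t); [apply: four; rewrite ?sNE|exact: self|exact: self].
have mu_gt0 : 0 < mu by rewrite -(pmulr_rgt0 _ t_gt0) (lt_trans ltr01).
have [sm_gt0 smt smE] := inv_le mu mu_gt0 mut.
have n1 : near_ratio Cs (Q N^-1) (Q mu^-1).
  by apply: four; rewrite ?sNE ?smE // inv_anti.
have [tnu|nut] := leP (t * nu) 1.
  by apply: (chain _ _ t n1); [apply: two; rewrite ?smE|exact: self].
have nu_gt0 : 0 < nu by rewrite -(pmulr_rgt0 _ t_gt0) (lt_trans ltr01).
have [sn_gt0 snt snE] := inv_le nu nu_gt0 nut.
apply: (chain _ _ _ n1 (two mu^-1 nu^-1 _ _ _ _ _)); rewrite ?smE ?snE ?inv_anti //.
by apply: one; rewrite ?snE.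
Qed.

End Cascade.

(** The size of the identity passes by relaxation to the reflections, and from
    the two simple reflections to the rotations. *)
Lemma dihedral_flow_estimate : exists2 C : R, 0 < C &
  forall a h h' u p q z1 z2, wall_rates a u p q z1 z2 ->
    is_flow reflect kappa a h h' -> (forall w, h w 0 = 1) ->
    let K := expR (- log_product kappa u 1) in
    [/\ near_ratio C (h e 1) K,
        forall k, near_ratio C (h (true, k) 1) (K / (1 + 2 * u k))
      & forall k, k != 0 -> near_ratio C (h (false, k) 1)
          (K * ((1 + 2 * p)^-1 + (1 + 2 * q)^-1) / (1 + a (false, k)))].
Proof.
have [CA CA_ge0 domP] := dihedral_dominated.
have [C1 C1_gt0 normP] := normalized_bounded CA_ge0.
have [C2 C2_gt0 decay] := dominated_decay reflect kappa_gt0 e CA_ge0.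
have [C3 C3_gt0 neighbour] := dominated_neighbour reflectK kappa_gt0 e CA_ge0.
have [C4 C4_gt0 second] := dominated_second reflectK kappa_gt0 e CA_ge0 (ltr0n R 2).
pose C5 := C2 + C3 + C4.
have C5_gt0 : 0 < C5 by rewrite !addr_gt0.
have C1C5 : 0 < C1 * C5 by rewrite mulr_gt0.
exists (C1 + C5 * C1); first by rewrite addr_gt0 // mulr_gt0.
move=> a h h' u p q z1 z2 wr fl h0 K.
have dom := domP a h h' u p q z1 z2 wr fl h0.
have a0 w : 0 <= a w by case/andP: (rates_a wr w).
have h_ge0 w : 0 <= h w 1 by exact: (flow_ge0 kappa_gt0 fl a0 h0 w ler01).
have K0 : 0 <= K by exact: expR_ge0.
have he : near_ratio C1 (h e 1) K.
  have [le1 le2] := normP a h h' u p q z1 z2 1 wr dom ler01.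
  have hE : h e 1 = normalized kappa e u h 1 * K.
    by rewrite /normalized /K expRN mulfK // gt_eqF ?expR_gt0.
  rewrite hE; split; first by rewrite ler_wpM2r.
  by rewrite mulrA ler_peMl.
have weaken x y : 0 <= x -> 0 <= y -> near_ratio (C5 * C1) x y ->
    near_ratio (C1 + C5 * C1) x y.
  move=> x0 y0 [xy yx]; split.
    by apply: (le_trans xy); rewrite ler_wpM2r // lerDr ltW.
  by apply: (le_trans yx); rewrite ler_wpM2r // lerDr ltW.
have scale c : 0 <= c -> near_ratio C1 (h e 1 * c) (K * c).
  move=> c0; case: he => hK Kh; split.
    by rewrite mulrA ler_wpM2r.
  by rewrite mulrA ler_wpM2r.
split.
- case: he => hK Kh; split.
    by apply: (le_trans hK); rewrite ler_wpM2r // lerDl mulr_ge0 // ltW.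
  by apply: (le_trans Kh); rewrite ler_wpM2r // lerDl mulr_ge0 // ltW.
- move=> k; have u0 : 0 <= u k by case/andP: (rates_u wr k).
  have c0 : 0 <= (1 + 2 * u k)^-1 by rewrite invr_ge0 addr_ge0 // mulr_ge0.
  apply: weaken; [exact: h_ge0|by rewrite mulr_ge0|].
  apply: near_ratio_trans (scale _ c0); rewrite ?(ltW C5_gt0) ?(ltW C1_gt0) //.
  have hc0 : 0 <= h e 1 * (1 + 2 * u k)^-1 by rewrite mulr_ge0.
  have := decay _ _ _ dom (true, k) 1 ler01.
  have := neighbour _ _ _ dom k 1 ler01.
  rewrite /reflect /= subr0 mul1r (wr_refl wr) => le1 le2; split.
    by apply: (le_trans le2); rewrite ler_wpM2r // /C5; move: C3_gt0 C4_gt0; lra.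
  by apply: (le_trans le1); rewrite ler_wpM2r // /C5; move: C2_gt0 C4_gt0; lra.
- move=> k k0.
  have p0 := wr_p wr; have q0 := wr_q wr.
  have c0 : 0 <= ((1 + 2 * p)^-1 + (1 + 2 * q)^-1) / (1 + a (false, k)).
    by rewrite divr_ge0 ?addr_ge0 ?invr_ge0 ?addr_ge0 ?mulr_ge0.
  rewrite -mulrA; apply: weaken; [exact: h_ge0|by rewrite mulr_ge0|].
  apply: near_ratio_trans (scale _ c0); rewrite ?(ltW C5_gt0) ?(ltW C1_gt0) //.
  have hc0 := mulr_ge0 (h_ge0 e) c0.
  have [||w' w'P|] := second _ _ _ dom (false, k) 0 (-1) _ _ _ 1 ler01.
  + by exists k; rewrite /reflect /= subrr subr0.
  + by exists (k - 1); rewrite /reflect /= subr0; congr pair; ring.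
  + rewrite /reflect /= !subr0 !(wr_refl wr) (wr_u0 wr) (wr_u1 wr).
    have w'_ge : forall x, p <= x \/ q <= x -> 2 * p <= 2 * x \/ 2 * q <= 2 * x.
      by move=> x [?|?]; [left|right]; rewrite ler_pM2l.
    apply: w'_ge; case: w'P => [->|[i ->]].
      by left; have := rates_rot wr k0; lra.
    rewrite /reflect /=; have [->|[->|]] := rates_refl wr (i - k).
    * by left; rewrite (wr_refl wr) (wr_u0 wr); lra.
    * by right; rewrite (wr_refl wr) (wr_u1 wr); lra.
    * by left; have := wr_z1 wr; have := wr_z2 wr; lra.
  rewrite /reflect /= !subr0 !mul1r !(wr_refl wr) (wr_u0 wr) (wr_u1 wr) -mulrA => le1 le2.
  split.
    by apply: (le_trans le1); rewrite ler_wpM2r // /C5; move: C2_gt0 C3_gt0; lra.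
  by apply: (le_trans le2); rewrite ler_wpM2r // /C5; move: C2_gt0 C3_gt0; lra.
Qed.

End Dihedral.

(** * The dihedral group in coordinates *)

Section Plane.
Variable R : realType.
Implicit Types (x y z : 'cV[R]_2) (A B : 'M[R]_2).

Lemma dotpE x y : dotp x y = x 0 0 * y 0 0 + x 1 0 * y 1 0.
Proof.
rewrite /dotp !big_ord_recl big_ord0 addr0.
by have -> : lift ord0 ord0 = 1 :> 'I_2 by apply/val_inj.
Qed.

Lemma dotpZr (t : R) x y : dotp x (t *: y) = t * dotp x y.
Proof. by rewrite !dotpE !mxE; ring. Qed.

Lemma vec2_0 (a b : R) : vec2 a b 0 0 = a. Proof. by rewrite mxE. Qed.
Lemma vec2_1 (a b : R) : vec2 a b 1 0 = b. Proof. by rewrite mxE. Qed.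

Lemma cV2P x y : x 0 0 = y 0 0 -> x 1 0 = y 1 0 -> x = y.
Proof.
move=> xy0 xy1; apply/matrixP => i j; rewrite (ord1 j).
have [->|i0] := eqVneq i 0; first exact: xy0.
have -> : i = 1 by apply/val_inj; case: i i0 => [[|[|i]] // i_lt].
exact: xy1.
Qed.

Lemma M2P A B : A 0 0 = B 0 0 -> A 0 1 = B 0 1 -> A 1 0 = B 1 0 ->
  A 1 1 = B 1 1 -> A = B.
Proof.
have two (i : 'I_2) : i = 0 \/ i = 1.
  have [->|i0] := eqVneq i 0; first by left.
  by right; apply/val_inj; case: i i0 => [[|[|i]] // i_lt].
by move=> *; apply/matrixP => i j; case: (two i) => ->; case: (two j) => ->.
Qed.

Lemma mulmx2E (q p : nat) (A : 'M[R]_(q, 2)) (B : 'M[R]_(2, p)) i j :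
  (A *m B) i j = A i 0 * B 0 j + A i 1 * B 1 j.
Proof.
rewrite mxE !big_ord_recl big_ord0 addr0.
by have -> : lift ord0 ord0 = 1 :> 'I_2 by apply/val_inj.
Qed.

Lemma mat2_mul (a b c d a' b' c' d' : R) :
  mat2 a b c d *m mat2 a' b' c' d' =
  mat2 (a * a' + b * c') (a * b' + b * d') (c * a' + d * c') (c * b' + d * d').
Proof. by apply: M2P; rewrite mulmx2E !mxE. Qed.

Lemma mat2_vec (a b c d : R) x :
  mat2 a b c d *m x =
  vec2 (a * x 0 0 + b * x 1 0) (c * x 0 0 + d * x 1 0).
Proof. by apply: cV2P; rewrite mulmx2E !mxE. Qed.

Lemma mat2_1 : mat2 1 0 0 1 = 1%:M :> 'M[R]_2.
Proof. by apply: M2P; rewrite !mxE. Qed.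

Lemma reflectionE (a b : R) : a ^+ 2 + b ^+ 2 = 1 ->
  reflection (vec2 a b) = mat2 (1 - 2 * a ^+ 2) (- (2 * a * b)) (- (2 * a * b)) (1 - 2 * b ^+ 2).
Proof.
move=> ab1; have d1 : dotp (vec2 a b) (vec2 a b) = 1.
  by rewrite dotpE vec2_0 vec2_1 -!expr2.
apply: M2P; rewrite /reflection d1 !mxE big_ord1 !mxE /= ?mulr1n ?mulr0n divr1; ring.
Qed.

Lemma reflectionN (a : 'cV[R]_2) : reflection (- a) = reflection a.
Proof.
rewrite /reflection; have -> : dotp (- a) (- a) = dotp a a by rewrite !dotpE !mxE; ring.
have -> : (- a)^T = - a^T by apply/matrixP => i j; rewrite !mxE.
by rewrite mulmxN mulNmx opprK.
Qed.

Lemma reflection_fix (a x : 'cV[R]_2) : dotp a x = 0 -> reflection a *m x = x.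
Proof.
move=> ax; rewrite /reflection mulmxBl mul1mx -scalemxAl -mulmxA.
suff -> : a^T *m x = 0 by rewrite mulmx0 scaler0 subr0.
by apply/matrixP => i j; rewrite mulmx2E !mxE !(ord1 i) !(ord1 j) -dotpE.
Qed.

Lemma reflection_self (a : 'cV[R]_2) : dotp a a = 1 -> reflection a *m a = - a.
Proof.
move=> aa; rewrite /reflection aa mulmxBl mul1mx -scalemxAl -mulmxA.
have -> : a^T *m a = 1%:M.
  by apply/matrixP => i j; rewrite mulmx2E !mxE !(ord1 i) !(ord1 j) -dotpE aa.
by rewrite mulmx1 divr1 scaler_nat mulr2n opprD addrA subrr add0r.
Qed.

End Plane.

Section DihedralMatrices.
Variables (R : realType) (m : nat).
Local Notation n := m.+3.

Definition angle (k : nat) : R := pi * k%:R / n%:R.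

Let n_neq0 : n%:R != 0 :> R. Proof. by rewrite pnatr_eq0. Qed.

Lemma angleD j k : angle (j + k) = angle j + angle k.
Proof. by rewrite /angle natrD mulrDr mulrDl. Qed.

Lemma angle0 : angle 0 = 0.
Proof. by rewrite /angle mulr0 mul0r. Qed.

Lemma angle_n : angle n = pi.
Proof. by rewrite /angle mulfK. Qed.

Lemma angle2 k : 2 * pi * k%:R / n%:R = angle k + angle k.
Proof. by rewrite /angle; ring. Qed.

Lemma proot_addn k : proot R n (k + n) = - proot R n k.
Proof.
rewrite /proot -/(angle _) -/(angle _) angleD angle_n cosDpi sinDpi.
by apply: cV2P; rewrite !mxE.
Qed.

Lemma proot_modn k : proot R n (k %% n) = proot R n k \/
                     proot R n (k %% n) = - proot R n k.
Proof.
rewrite {2 4}(divn_eq k n).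
elim: (k %/ n)%N => [|q IH]; first by left; rewrite mul0n add0n.
rewrite mulSn -addnA [(n + _)%N]addnC proot_addn.
by case: IH => ->; [right|left]; rewrite ?opprK.
Qed.

Lemma cos2_modn k : cos (angle (k %% n) + angle (k %% n)) = cos (angle k + angle k).
Proof.
rewrite {3 4}(divn_eq k n).
elim: (k %/ n)%N => [|q IH]; first by rewrite mul0n add0n.
by rewrite IH mulSn -addnA [angle (n + _)]angleD angle_n addrACA -mulr2n addrC cosD2pi.
Qed.

Lemma sin2_modn k : sin (angle (k %% n) + angle (k %% n)) = sin (angle k + angle k).
Proof.
rewrite {3 4}(divn_eq k n).
elim: (k %/ n)%N => [|q IH]; first by rewrite mul0n add0n.
by rewrite IH mulSn -addnA [angle (n + _)]angleD angle_n addrACA -mulr2n addrC sinD2pi.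
Qed.

Local Notation cos2 k := (cos (angle k + angle k)).
Local Notation sin2 k := (sin (angle k + angle k)).

Lemma val_subK (j k : 'I_n) : ((((j - k)%R : 'I_n) + k) %% n)%N = j.
Proof. by rewrite -[RHS]/(val j) -{2}(subrK k j). Qed.

Lemma sincos2_sub (j k : 'I_n) :
  cos2 ((j - k)%R : 'I_n) = cos2 j * cos2 k + sin2 j * sin2 k /\
  sin2 ((j - k)%R : 'I_n) = sin2 j * cos2 k - cos2 j * sin2 k.
Proof.
have -> : cos2 j = cos2 (((j - k)%R : 'I_n) + k) by rewrite -[RHS]cos2_modn val_subK.
have -> : sin2 j = sin2 (((j - k)%R : 'I_n) + k) by rewrite -[RHS]sin2_modn val_subK.
rewrite [angle (_ + k)]angleD.
move: (angle ((j - k)%R : 'I_n)) (angle k) => a b.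
rewrite addrACA; move: (a + a) (b + b) => {}a {}b.
have bb : cos b * cos b + sin b * sin b = 1 by rewrite -!expr2 cos2Dsin2.
rewrite cosD sinD; split.
  by rewrite -[LHS]mulr1 -bb; ring.
by rewrite -[LHS]mulr1 -bb; ring.
Qed.

Definition state_mx (w : state m) : 'M[R]_2 :=
  if w.1 then reflection (proot R n w.2) else rot_mx R n w.2.

Lemma rot_mxE k : rot_mx R n k = mat2 (cos2 k) (- sin2 k) (sin2 k) (cos2 k).
Proof. by rewrite /rot_mx angle2. Qed.

Lemma reflection_prootE k :
  reflection (proot R n k) = mat2 (- cos2 k) (- sin2 k) (- sin2 k) (cos2 k).
Proof.
have cs : cos (angle k) ^+ 2 + sin (angle k) ^+ 2 = 1 by exact: cos2Dsin2.
rewrite /proot -!/(angle k) reflectionE // cosD sinD.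
set c := cos _ in cs *; set s := sin _ in cs *.
by congr mat2; lra.
Qed.

Lemma refl_mxE k : refl_mx R n k = mat2 (- cos2 k) (sin2 k) (sin2 k) (cos2 k).
Proof. by rewrite /refl_mx angle2. Qed.

Lemma state_mx_reflect (j : 'I_n) (w : state m) :
  reflection (proot R n j) *m state_mx w = state_mx (reflect j w).
Proof.
case: w => b k; rewrite /state_mx /=; have [cE sE] := sincos2_sub j k.
case: b => /=.
  by rewrite rot_mxE !reflection_prootE mat2_mul cE sE; congr mat2; ring.
by rewrite rot_mxE !reflection_prootE mat2_mul cE sE; congr mat2; ring.
Qed.

Lemma state_mx_id : state_mx (identity_state m) = 1%:M.
Proof. by rewrite /state_mx /= rot_mxE angle0 addr0 cos0 sin0 oppr0 mat2_1. Qed.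

Lemma reflection_prootK (k : nat) :
  reflection (proot R n k) *m reflection (proot R n k) = 1%:M.
Proof.
rewrite reflection_prootE mat2_mul -mat2_1.
have : cos2 k * cos2 k + sin2 k * sin2 k = 1 by rewrite -!expr2 cos2Dsin2.
move: (cos2 k) (sin2 k) => c s cs.
by congr mat2; lra.
Qed.

Lemma refl_mx_state (k : 'I_n) : refl_mx R n k = state_mx (true, - k).
Proof.
have [cE sE] := sincos2_sub 0 k; rewrite sub0r in cE sE.
rewrite /state_mx refl_mxE reflection_prootE cE sE /= angle0 addr0 cos0 sin0.
by congr mat2; ring.
Qed.

Lemma proot_norm k : dotp (proot R n k) (proot R n k) = 1.
Proof. by rewrite dotpE vec2_0 vec2_1 -!expr2 cos2Dsin2. Qed.

(** The image has the angle [2 * angle i - angle j + pi]; reducing its index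
    modulo [n] may change the sign. *)
Lemma reflection_proot (i j : 'I_n) :
  reflection (proot R n i) *m proot R n j = proot R n ((i + i - j)%R : 'I_n) \/
  reflection (proot R n i) *m proot R n j = - proot R n ((i + i - j)%R : 'I_n).
Proof.
have ijE : ((i + i - j)%R : 'I_n) = ((i + i + (n - j)) %% n)%N :> nat by rewrite /= modnDm.
have jn : (j <= n)%N by exact: ltnW.
have -> : reflection (proot R n i) *m proot R n j = proot R n (i + i + (n - j)).
  rewrite reflection_prootE mat2_vec /proot !vec2_0 !vec2_1.
  rewrite -!/(angle _) !angleD.
  have -> : angle (n - j) = pi - angle j.
    by apply/(addIr (angle j)); rewrite -angleD subnK // angle_n subrK.
  have -> : angle i + angle i + (pi - angle j) = angle i + angle i - angle j + pi.
    by ring.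
  rewrite cosDpi sinDpi cosB sinB.
  by congr vec2; ring.
rewrite ijE; case: (proot_modn (i + i + (n - j))) => ->; first by left.
by right; rewrite opprK.
Qed.

Lemma reflection_group_state (w : 'M[R]_2) :
  reflection_group n w -> exists v, w = state_mx v.
Proof.
elim=> [|a {}w [j aE] _ [v ->]]; first by exists (identity_state m); rewrite state_mx_id.
exists (reflect j v); rewrite -state_mx_reflect.
by case: aE => ->; rewrite ?reflectionN.
Qed.

End DihedralMatrices.

(** * The Dunkl kernel along rays *)

Section Radial.
Variable R : realType.

Lemma linear_form_cV2 (L : {linear 'cV[R]_2 -> R^o}) (x : 'cV[R]_2) :
  L x = x 0 0 * L (delta_mx 0 0) + x 1 0 * L (delta_mx 1 0).
Proof.
have -> : x = x 0 0 *: delta_mx 0 0 + x 1 0 *: delta_mx 1 0.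
  by apply: cV2P; rewrite !mxE /= ?mulr1 ?mulr0 ?addr0 ?add0r.
rewrite linearD linearZ_LR linearZ_LR.
by rewrite !mxE /= ?mulr1 ?mulr0 ?addr0 ?add0r.
Qed.

Lemma differentiable_ray (f : 'cV[R]_2 -> R) (x : 'cV[R]_2) (t : R) :
  differentiable f (t *: x) ->
  is_derive t 1 (fun s => f (s *: x)) (dotp x (gradient f (t *: x))).
Proof.
move=> df.
have rayE : (fun h : R => h^-1 *: (f ((h *: x) + t *: x) - f (t *: x))) =
            (fun h : R => h^-1 *: (f ((h *: 1 + t) *: x) - f (t *: x))).
  by apply/funext => h; rewrite scalerDl [h *: 1]mulr1.
have dv : 'D_x f (t *: x) = dotp x (gradient f (t *: x)).
  rewrite deriveE // dotpE !mxE /partial !deriveE //.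
  exact: (linear_form_cV2 ('d f (t *: x))).
have dfx : derivable f (t *: x) x by exact: diff_derivable.
split; last by rewrite -dv /derive /= rayE.
by move: dfx; rewrite /derivable /= rayE.
Qed.

End Radial.

Section Kernel.
Variables (R : realType) (m : nat) (kappa : 'cV[R]_2 -> R).
Local Notation n := m.+3.
Hypothesis kappaP : multiplicity n kappa.
Variable E : 'cV[R]_2 -> 'cV[R]_2 -> R.
Hypothesis EP : is_dunkl_kernel n kappa E.
Implicit Types x y : 'cV[R]_2.

Local Notation root := (proot R n).

Definition root_multiplicity (j : 'I_n) : R := kappa (root j).
Local Notation kap := root_multiplicity.

Lemma root_multiplicity_gt0 j : 0 < kap j.
Proof. by apply: kappaP.1; exists j; left. Qed.

Lemma root_multiplicity_refl (i j : 'I_n) : kap (i + i - j) = kap j.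
Proof.
have rootP (k : 'I_n) : Defs.roots n (root k) by exists k; left.
have gP (k : 'I_n) : reflection_group n (reflection (root k)).
  rewrite -[reflection _]mulmx1; apply: reflection_groupM => //.
  exact: reflection_group1.
have kN (k : 'I_n) : kappa (- root k) = kappa (root k).
  by rewrite -(kappaP.2 _ _ (gP k) (rootP k)) reflection_self // proot_norm.
rewrite /kap -(kappaP.2 _ _ (gP i) (rootP j)).
by case: (reflection_proot R i j) => ->; rewrite ?kN.
Qed.

Lemma kernel_ray x y (t : R) :
  is_derive t 1 (fun s => E (s *: x) y) (dotp x (gradient (E^~ y) (t *: x))).
Proof.
have [sm _ _] := EP y.
by apply: (@differentiable_ray _ (E^~ y)); have [] := sm 1%N.
Qed.

(** This is the eigenvalue equation for [xi = x] at the point [t x]: there the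
    factor [t * <a, x>] cancels the denominator of the difference quotient; where
    it vanishes, the reflection fixes [t x] and both sides are zero. *)
Lemma kernel_ray_ode x y (t : R) :
  t * dotp x (gradient (E^~ y) (t *: x)) =
  t * dotp x y * E (t *: x) y
  - \sum_j kap j * (E (t *: x) y - E (t *: (reflection (root j) *m x)) y).
Proof.
have [_ eig _] := EP y.
have := eig x (t *: x); rewrite /dunkl_op => /(congr1 ( *%R t)).
rewrite mulrDr mulrA => <-; rewrite -addrA -[LHS]addr0; congr (_ + _).
rewrite mulr_sumr -sumrB big1 // => j _; apply/eqP; rewrite subr_eq0; apply/eqP.
rewrite /dunkl_quotient.
have [ax|ax] := eqVneq (dotp (root j) (t *: x)) 0; last first.
  rewrite /= dotpZr in ax *; rewrite -scalemxAr /kap; set D := _ - _.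
  by move: ax; rewrite mulf_eq0 negb_or => /andP[t0 a0]; field; rewrite t0 a0.
rewrite /= scalemxAr reflection_fix // subrr mulr0.
move: ax; rewrite dotpZr => ax.
set l := lim _; rewrite (_ : t * _ = kappa (root j) * (t * dotp (root j) x) * l); last by ring.
by rewrite ax mulr0 mul0r.
Qed.

Lemma kernel_at0 y : E 0 y = 1. Proof. by have [] := EP y. Qed.

Lemma dotp_reflection (j : 'I_n) x y :
  dotp (reflection (root j) *m x) (reflection (root j) *m y) = dotp x y.
Proof.
rewrite reflection_prootE !mat2_vec !dotpE !vec2_0 !vec2_1.
have := cos2Dsin2 (angle R m j + angle R m j); rewrite !expr2.
move: (cos _) (sin _) => c s cs.
by rewrite -[RHS]mulr1 -cs; ring.
Qed.

Lemma reflection_swap (i j : 'I_n) :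
  reflection (root j) *m reflection (root i) =
  reflection (root i) *m reflection (root ((i + i - j)%R : 'I_n)).
Proof.
have rE (k l : 'I_n) : reflection (root k) *m reflection (root l) = state_mx R (false, k - l).
  by rewrite -(state_mx_reflect _ k (true, l)).
by rewrite !rE; congr (state_mx R (_, _)); ring.
Qed.

(** The family [E (t v x) y], for [v] in the group, and its transform by a
    reflection solve the same flow, because the reflection permutes the roots
    and preserves their multiplicities. *)
Lemma kernel_reflection (i : 'I_n) x y :
  E (reflection (root i) *m x) (reflection (root i) *m y) = E x y.
Proof.
pose s := reflection (root i).
pose X (v : state m) := state_mx R v *m x.
pose h (v : state m) t := E (t *: X v) y - E (t *: (s *m X v)) (s *m y).
pose h' (v : state m) t := dotp (X v) (gradient (E^~ y) (t *: X v))
   - dotp (s *m X v) (gradient (E^~ (s *m y)) (t *: (s *m X v))).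
have fl : is_flow (@reflect m) kap (fun v => - dotp (X v) y) h h'.
  split=> v t _.
    by apply: derivB; exact: kernel_ray.
  rewrite /h' mulrBr !kernel_ray_ode dotp_reflection.
  have -> : \sum_j kap j * (E (t *: (s *m X v)) (s *m y) -
        E (t *: (reflection (root j) *m (s *m X v))) (s *m y)) =
      \sum_j kap j * (E (t *: (s *m X v)) (s *m y) -
        E (t *: (s *m X (reflect j v))) (s *m y)).
    rewrite (reindex_inj (can_inj (fun j => subKr (i + i) j))) /=.
    apply: eq_bigr => j _; rewrite root_multiplicity_refl; congr (_ * (_ - E (_ *: _) _)).
    rewrite /X -(state_mx_reflect R j v) !mulmxA /s.
    by rewrite (reflection_swap i (i + i - j)) subKr.
  have -> : \sum_j kap j * (E (t *: X v) y - E (t *: (reflection (root j) *m X v)) y) =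
      \sum_j kap j * (E (t *: X v) y - E (t *: X (reflect j v)) y).
    by apply: eq_bigr => j _; rewrite /X mulmxA (state_mx_reflect R j v).
  have -> : \sum_j kap j * (h v t - h (reflect j v) t) =
      \sum_j kap j * (E (t *: X v) y - E (t *: X (reflect j v)) y)
    - \sum_j kap j * (E (t *: (s *m X v)) (s *m y) - E (t *: (s *m X (reflect j v))) (s *m y)).
    by rewrite -sumrB; apply: eq_bigr => j _; rewrite /h; ring.
  by rewrite /h; ring.
have := flow_eq0 (@reflectK m) root_multiplicity_gt0 fl _ (identity_state m) ler01.
rewrite /h /X state_mx_id mul1mx !scale1r => h1.
apply/eqP; rewrite eq_sym -subr_eq0; apply/eqP; apply: h1 => v.
by rewrite !scale0r !kernel_at0 subrr.
Qed.

(** The exponential factor shifts all eigenvalues [<x, w y>] by [<x, y>], which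
    makes them nonpositive for [x] and [y] in the chamber. *)
Definition killing x y (v : state m) : R := dotp x y - dotp x (state_mx R v *m y).

Definition kernel_flow x y (v : state m) (t : R) : R :=
  expR (- (t * dotp x y)) * E (t *: x) (state_mx R v *m y).

Lemma kernel_flowP x y : exists h',
  is_flow (@reflect m) kap (killing x y) (kernel_flow x y) h'.
Proof.
pose Y (v : state m) := state_mx R v *m y.
pose h' (v : state m) t := expR (- (t * dotp x y)) *
  (dotp x (gradient (E^~ (Y v)) (t *: x)) - dotp x y * E (t *: x) (Y v)).
exists h'; split=> v t _.
  have dexp : is_derive t 1 (fun s => expR (- (s * dotp x y)))
      (expR (- (t * dotp x y)) * - dotp x y).
    apply: deriv_expR; apply: derivN.
    apply: (deriv_eq (derivM (deriv_id t) (deriv_cst (dotp x y) t))).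
    by rewrite mul1r mulr0 addr0.
  apply: (deriv_eq (derivM dexp (kernel_ray x (Y v) t))).
  by rewrite /h'; ring.
rewrite /h' mulrCA mulrBr kernel_ray_ode /killing /kernel_flow -/(Y v).
have -> : \sum_j kap j * (E (t *: x) (Y v) - E (t *: (reflection (root j) *m x)) (Y v)) =
    \sum_j kap j * (E (t *: x) (Y v) - E (t *: x) (Y (reflect j v))).
  apply: eq_bigr => j _; congr (_ * (_ - _)).
  rewrite -(kernel_reflection j) scalemxAr mulmxA reflection_prootK mul1mx.
  by rewrite /Y -(state_mx_reflect R j v) mulmxA.
have -> : \sum_j kap j * (expR (- (t * dotp x y)) * E (t *: x) (Y v) -
     expR (- (t * dotp x y)) * E (t *: x) (state_mx R (reflect j v) *m y)) =
   expR (- (t * dotp x y)) * \sum_j kap j * (E (t *: x) (Y v) - E (t *: x) (Y (reflect j v))).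
  by rewrite mulr_sumr; apply: eq_bigr => j _; rewrite /Y; ring.
by ring.
Qed.

Lemma kernel_flow0 x y v : kernel_flow x y v 0 = 1.
Proof. by rewrite /kernel_flow mul0r oppr0 expR0 mul1r scale0r kernel_at0. Qed.

Lemma kernel_flow1 x y v :
  E x (state_mx R v *m y) = expR (dotp x y) * kernel_flow x y v 1.
Proof.
rewrite /kernel_flow mul1r scale1r mulrA -expRD subrr expR0 mul1r //.
Qed.

End Kernel.

(** * Trigonometry of the chamber *)

Section Chamber.
Variables (R : realType) (m : nat).
Local Notation n := m.+3.
Local Notation ang := (angle R m).

Let s : R := sin (ang 1).

Lemma angle_itv k : (k <= n)%N -> 0 <= ang k <= pi.
Proof.
move=> kn; have n0 : 0 < n%:R :> R by rewrite ltr0n.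
rewrite /angle divr_ge0 ?mulr_ge0 ?pi_ge0 //= ler_pdivrMr //.
by rewrite ler_wpM2l ?pi_ge0 // ler_nat.
Qed.

Lemma sin_angle1_gt0 : 0 < s.
Proof.
apply: sin_gt0_pi; rewrite /angle mulr1; have n0 : 0 < n%:R :> R by rewrite ltr0n.
rewrite divr_gt0 ?pi_gt0 //= ltr_pdivrMr // ltr_pMr ?pi_gt0 //.
by rewrite ltr1n.
Qed.

(** The difference is [2 * cos u * sin v] for [u = ang (k + 1) / 2] and
    [v = ang (k - 1) / 2], and both factors are nonnegative. *)
Lemma sin_angle_ge k : (0 < k < n)%N -> s <= sin (ang k).
Proof.
case: k => // k /=; rewrite ltnS => kn.
pose u := ang k.+2 / 2; pose v := ang k / 2.
have kE : ang k.+1 = u + v.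
  by rewrite /u /v -addn2 -addn1 !angleD -[2%N]/(1 + 1)%N angleD; field.
have oneE : ang 1 = u - v.
  by rewrite /u /v -addn2 !angleD -[2%N]/(1 + 1)%N angleD; field.
rewrite /s kE oneE sinB sinD -subr_ge0.
have -> : sin u * cos v + cos u * sin v - (sin u * cos v - cos u * sin v) =
   2 * (cos u * sin v) by ring.
have /andP[u0 upi] := angle_itv (kn : (k.+2 <= n)%N).
have /andP[v0 vpi] := angle_itv (leq_trans (ltnW kn) (leqnSn _) : (k <= n)%N).
have pi0 := pi_gt0 R.
rewrite mulr_ge0 // mulr_ge0 //.
  by apply: cos_ge0_pihalf; rewrite /u; apply/andP; split; lra.
by apply: sin_ge0_pi; rewrite /v; apply/andP; split; lra.
Qed.

(** The coordinates of the root [k] in the basis of the two simple roots are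
    [sin_ratio k.+1] and [sin_ratio k]. *)
Definition sin_ratio k : R := sin (ang k) / s.

Definition max_ratio : R := s^-1.

Lemma max_ratio_ge1 : 1 <= max_ratio.
Proof. by rewrite /max_ratio invf_ge1 ?sin_angle1_gt0 // sin_le1. Qed.

Lemma sin_ratio_itv k : (0 < k < n)%N -> 1 <= sin_ratio k <= max_ratio.
Proof.
move=> kn; have s0 := sin_angle1_gt0.
rewrite /sin_ratio ler_pdivlMr // mul1r sin_angle_ge //=.
by rewrite ler_pdivrMr // mulVf ?gt_eqF // sin_le1.
Qed.

Lemma sin_ratio0 : sin_ratio 0 = 0.
Proof. by rewrite /sin_ratio angle0 sin0 mul0r. Qed.

Lemma sin_ratio1 : sin_ratio 1 = 1.
Proof. by rewrite /sin_ratio divff // gt_eqF // sin_angle1_gt0. Qed.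

Lemma sin_ratio_n : sin_ratio n = 0.
Proof. by rewrite /sin_ratio angle_n sinpi mul0r. Qed.

Lemma sin_ratio_sym k : (k <= n)%N -> sin_ratio (n - k) = sin_ratio k.
Proof.
move=> kn; rewrite /sin_ratio; congr (_ / _).
have -> : ang (n - k) = pi - ang k.
  by apply: (addIr (ang k)); rewrite -angleD subnK // angle_n subrK.
by rewrite sinB sinpi cospi mul0r sub0r mulN1r opprK.
Qed.

Lemma sin_ratio_pred : sin_ratio n.-1 = 1.
Proof. by rewrite -subn1 sin_ratio_sym // sin_ratio1. Qed.

Let sR : s != 0. Proof. by rewrite gt_eqF // sin_angle1_gt0. Qed.

Let c : R := cos (ang 1).

(** Since [n >= 3], this ratio is at least [1], that is, [cos (pi / n) >= 1 / 2]. *)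
Lemma sin_ratio2 : sin_ratio 2 = 2 * c.
Proof. by rewrite /sin_ratio -[2%N]/(1 + 1)%N angleD sinD -/s -/c; field. Qed.

Section Coordinates.
Variables x y : 'cV[R]_2.

Let x0 := dotp (proot R n 0) x.
Let x1 := dotp (proot R n n.-1) x.
Let y0 := dotp (proot R n 0) y.
Let y1 := dotp (proot R n n.-1) y.

Lemma coord0 (z : 'cV[R]_2) : z 0 0 = dotp (proot R n 0) z.
Proof.
by rewrite dotpE vec2_0 vec2_1 -/(angle R m 0) angle0 cos0 sin0; ring.
Qed.

Lemma coord1 (z : 'cV[R]_2) : z 1 0 =
  (dotp (proot R n n.-1) z + c * dotp (proot R n 0) z) / s.
Proof.
rewrite -coord0 dotpE vec2_0 vec2_1 -/(angle R m _).
have -> : ang n.-1 = pi - ang 1.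
  by apply: (addIr (ang 1)); rewrite -angleD subrK addn1 angle_n.
rewrite cosB sinB sinpi cospi -/s -/c; field; exact: sR.
Qed.

Lemma dotp_root k (z : 'cV[R]_2) : dotp (proot R n k) z =
  sin_ratio k.+1 * dotp (proot R n 0) z + sin_ratio k * dotp (proot R n n.-1) z.
Proof.
rewrite [LHS]dotpE (coord1 z) (coord0 z) vec2_0 vec2_1 -/(angle R m k) /sin_ratio.
by rewrite -[k.+1]addn1 angleD sinD -/s -/c; field; exact: sR.
Qed.

Lemma dotp_coord : dotp x y =
  max_ratio ^+ 2 * (x0 * y0 + x1 * y1 + c * (x0 * y1 + x1 * y0)).
Proof.
rewrite dotpE !coord1 !coord0 -/x0 -/x1 -/y0 -/y1 /max_ratio.
have c2 : c ^+ 2 = 1 - s ^+ 2 by exact: cos2sin2.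
by field: c2; exact: sR.
Qed.

Lemma killing_refl (k : 'I_n) : killing x y (true, k) =
  2 * (dotp (proot R n k) x * dotp (proot R n k) y).
Proof.
rewrite /killing /state_mx /= reflectionE ?cos2Dsin2 // mat2_vec !dotpE !vec2_0 !vec2_1.
by ring.
Qed.

Lemma killing_rot (k : nat) (kn : (k.+1 < n)%N) : killing x y (false, Ordinal kn) =
  2 * sin_ratio k.+1 * (sin_ratio k.+1 * (x0 * y0 + x1 * y1)
    + sin_ratio k.+2 * (x0 * y1) + sin_ratio k * (x1 * y0)).
Proof.
rewrite /killing /state_mx /= rot_mxE mat2_vec !dotpE !vec2_0 !vec2_1.
rewrite cosD sinD !coord1 !coord0 -/x0 -/x1 -/y0 -/y1 /sin_ratio.
have -> : ang k.+2 = ang k.+1 + ang 1 by rewrite -angleD addn1.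
have -> : ang k = ang k.+1 - ang 1 by rewrite -[k.+1]addn1 angleD addrK.
rewrite sinD sinB -/s -/c.
have C2 : cos (ang k.+1) ^+ 2 = 1 - sin (ang k.+1) ^+ 2 by exact: cos2sin2.
have c2 : c ^+ 2 = 1 - s ^+ 2 by exact: cos2sin2.
move: C2 c2 sR; move: (cos (ang k.+1)) (sin (ang k.+1)) c s => C S c' s' C2 c2 s'0.
field: C2 c2; exact: s'0.
Qed.

Lemma dotp_rtilde_l : dotp (rtilde R n *m x) y =
  max_ratio * (x0 * y0 + x1 * y1 + 2 * c * (x0 * y1)).
Proof.
rewrite /rtilde mat2_vec !dotpE !vec2_0 !vec2_1.
have -> : pi / n%:R = ang 1 by rewrite /angle mulr1.
rewrite !coord1 !coord0 -/x0 -/x1 -/y0 -/y1 -/s -/c /max_ratio.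
have c2 : c ^+ 2 = 1 - s ^+ 2 by exact: cos2sin2.
field: c2; exact: sR.
Qed.

Lemma dotp_rtilde_r : dotp x (rtilde R n *m y) =
  max_ratio * (x0 * y0 + x1 * y1 + 2 * c * (x1 * y0)).
Proof.
rewrite /rtilde mat2_vec !dotpE !vec2_0 !vec2_1.
have -> : pi / n%:R = ang 1 by rewrite /angle mulr1.
rewrite !coord1 !coord0 -/x0 -/x1 -/y0 -/y1 -/s -/c /max_ratio.
have c2 : c ^+ 2 = 1 - s ^+ 2 by exact: cos2sin2.
field: c2; exact: sR.
Qed.
End Coordinates.
End Chamber.

(** * Killing rates in the closed chamber *)

Section Estimate.
Variables (R : realType) (m : nat).
Local Notation n := m.+3.

Let g : R := max_ratio R m.

Definition rate_ratio : R := 2 * g ^+ 2.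

Lemma rate_ratio_ge2 : 2 <= rate_ratio.
Proof.
rewrite /rate_ratio ler_peMr //; have := max_ratio_ge1 R m; rewrite -/g => g1.
by rewrite exprn_ege1.
Qed.

Let g1 : 1 <= g. Proof. exact: max_ratio_ge1. Qed.
Let g0 : 0 <= g. Proof. exact: le_trans g1. Qed.

Lemma val_opp1 : (- 1 : 'I_n) = n.-1 :> nat.
Proof. by rewrite /= modn_small // subn1 /= modn_small. Qed.

Section Point.
Variables x y : 'cV[R]_2.
Let x0 := dotp (proot R n 0) x.
Let x1 := dotp (proot R n n.-1) x.
Let y0 := dotp (proot R n 0) y.
Let y1 := dotp (proot R n n.-1) y.
Hypotheses (x0_ge0 : 0 <= x0) (x1_ge0 : 0 <= x1).
Hypotheses (y0_ge0 : 0 <= y0) (y1_ge0 : 0 <= y1).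

Definition root_product (k : 'I_n) : R := dotp (proot R n k) x * dotp (proot R n k) y.

Let p := x0 * y0.
Let q := x1 * y1.
Let z1 := x0 * y1.
Let z2 := x1 * y0.
Let p0 : 0 <= p. Proof. exact: mulr_ge0. Qed.
Let q0 : 0 <= q. Proof. exact: mulr_ge0. Qed.
Let z10 : 0 <= z1. Proof. exact: mulr_ge0. Qed.
Let z20 : 0 <= z2. Proof. exact: mulr_ge0. Qed.

Lemma inner_index (k : 'I_n) : k != 0 -> k != -1 -> (0 < k)%N /\ (k.+1 < n)%N.
Proof.
move=> k0 k1; have k_gt0 : (0 < k)%N.
  by rewrite lt0n; apply: contraNneq k0 => kE; apply/eqP/val_inj.
split=> //; rewrite ltn_neqAle ltn_ord andbT; apply: contraNneq k1 => kE.
by apply/eqP/ord_inj; rewrite val_opp1; case: kE.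
Qed.

(** By [dotp_root] and [killing_rot] all rates are linear in [p], [q], [z1], [z2]
    with coefficients between positive constants, except that the coefficient
    of [z2] vanishes for the rotation [1] and that of [z1] for the rotation
    [-1]. *)
Lemma chamber_rates : wall_rates rate_ratio (killing x y) root_product p q z1 z2.
Proof.
have r_itv (k : nat) : (0 < k < n)%N -> 1 <= sin_ratio R m k <= g by exact: sin_ratio_itv.
have gg : g <= g ^+ 2 by rewrite expr2 ler_peMl.
have rotE (k : 'I_n) : k != 0 -> killing x y (false, k) =
    2 * sin_ratio R m k * (sin_ratio R m k * (p + q) + sin_ratio R m k.+1 * z1
      + sin_ratio R m k.-1 * z2).
  case: k => [[|k] kn] k0; first by case/eqP: k0; apply/val_inj.
  exact: killing_rot.
have mono (r r1 r2 : R) : 1 <= r <= g -> 0 <= r1 <= g -> 0 <= r2 <= g ->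
    2 * r * (r * (p + q) + r1 * z1 + r2 * z2) <= rate_ratio * (p + q + z1 + z2) /\
    p + q + r1 * z1 + r2 * z2 <= 2 * r * (r * (p + q) + r1 * z1 + r2 * z2).
  move=> /andP[r_ge1 rg] /andP[r10 r1g] /andP[r20 r2g].
  have r0 : 0 <= r by exact: le_trans r_ge1.
  have B0 : 0 <= r1 * z1 by rewrite mulr_ge0.
  have D0 : 0 <= r2 * z2 by rewrite mulr_ge0.
  have pq0 : 0 <= p + q by rewrite addr_ge0.
  split.
    have -> : rate_ratio * (p + q + z1 + z2) = 2 * g * (g * (p + q) + g * z1 + g * z2).
      by rewrite /rate_ratio; ring.
    apply: ler_pM; rewrite ?mulr_ge0 ?addr_ge0 ?mulr_ge0 //.
      by rewrite ler_pM2l.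
    by rewrite !lerD // ler_wpM2r.
  have -> : p + q + r1 * z1 + r2 * z2 = 1 * (p + q + r1 * z1 + r2 * z2) by rewrite mul1r.
  apply: ler_pM; rewrite ?addr_ge0 //; first by lra.
  by rewrite !lerD // ler_peMl.
have elementary z : 0 <= z ->
    p + q + z <= 2 * 1 * (1 * (p + q) + sin_ratio R m 2 * z)
              <= rate_ratio * (p + q + z).
  move=> z_ge0; have /andP[r21 r2g] : 1 <= sin_ratio R m 2 <= g by exact: r_itv.
  have pq0 : 0 <= p + q by rewrite addr_ge0.
  have zr : z <= sin_ratio R m 2 * z by rewrite ler_peMl.
  have rz : sin_ratio R m 2 * z <= g * z by rewrite ler_wpM2r.
  have -> : rate_ratio * (p + q + z) = 2 * g * (g * (p + q) + g * z).
    by rewrite /rate_ratio; ring.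
  rewrite mulr1 mul1r; apply/andP; split; first by lra.
  apply: ler_pM; [by []|by rewrite addr_ge0 // (le_trans z_ge0)|by rewrite ler_peMr|].
  by rewrite lerD ?ler_peMl.
split=> //.
- by rewrite /z1 /z2 /p /q; ring.
- by rewrite /root_product val_opp1.
- move=> k k0 k1; have [k_gt0 kn] := inner_index k0 k1.
  have /andP[a1 ag] := r_itv k.+1 kn; have /andP[b1 bg] : 1 <= sin_ratio R m k <= g.
    by apply: r_itv; rewrite k_gt0 ltn_ord.
  have lo (w0 w1 : R) : 0 <= w0 -> 0 <= w1 ->
      w0 + w1 <= sin_ratio R m k.+1 * w0 + sin_ratio R m k * w1 <= g * (w0 + w1).
    by move=> *; rewrite mulrDr !lerD ?ler_peMl ?ler_wpM2r.
  rewrite /root_product [dotp (proot R n k) x]dotp_root [dotp (proot R n k) y]dotp_root.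
  rewrite -/x0 -/x1 -/y0 -/y1.
  have /andP[xl xu] := lo x0 x1 x0_ge0 x1_ge0.
  have /andP[yl yu] := lo y0 y1 y0_ge0 y1_ge0.
  have xx : 0 <= x0 + x1 by rewrite addr_ge0.
  have yy : 0 <= y0 + y1 by rewrite addr_ge0.
  have NE : p + q + z1 + z2 = (x0 + x1) * (y0 + y1) by rewrite /p /q /z1 /z2; ring.
  rewrite NE; apply/andP; split; first exact: ler_pM.
  apply: (@le_trans _ _ ((g * (x0 + x1)) * (g * (y0 + y1)))).
    by apply: ler_pM => //; [exact: le_trans xl|exact: le_trans yl].
  have -> : g * (x0 + x1) * (g * (y0 + y1)) = g ^+ 2 * ((x0 + x1) * (y0 + y1)) by ring.
  rewrite ler_wpM2r ?mulr_ge0 // /rate_ratio ler_peMl ?exprn_ge0 //.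
  by rewrite ler1n.
- by move=> k; rewrite killing_refl.
- by rewrite /killing (state_mx_id R m) mul1mx subrr.
- by rewrite rotE // sin_ratio1 sin_ratio0 mul0r addr0; exact: elementary.
- have N1 : -1 != 0 :> 'I_n by rewrite oppr_eq0.
  rewrite rotE // val_opp1 /= -[m.+2]/(n.-1) sin_ratio_pred (sin_ratio_n R m).
  rewrite -[m.+1]/(n - 2)%N sin_ratio_sym // mul0r addr0; exact: elementary.
- move=> k k0 k1 kN1; have [k_gt0 kn] := inner_index k0 kN1.
  have k_gt1 : (1 < k)%N.
    by rewrite ltn_neqAle k_gt0 andbT; apply: contraNneq k1 => kE; apply/eqP/val_inj.
  have rk : 1 <= sin_ratio R m k <= g by apply: r_itv; rewrite k_gt0 ltn_ord.
  have /andP[a1 ag] : 1 <= sin_ratio R m k.+1 <= g by apply: r_itv; rewrite kn.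
  have /andP[b1 bg] : 1 <= sin_ratio R m k.-1 <= g.
    apply: r_itv; rewrite -ltnS prednK // k_gt1 /=.
    exact: ltnW.
  rewrite rotE //; have [||le1 le2] := mono _ (sin_ratio R m k.+1) (sin_ratio R m k.-1) rk.
  + by rewrite ag andbT; lra.
  + by rewrite bg andbT; lra.
  rewrite le1 andbT; apply: le_trans le2.
  by rewrite !lerD // ler_peMl.
Qed.

End Point.
End Estimate.

(** * The estimate *)

(** With [S = 1 + p + q + z1 + z2], the left product is
    [(1 + p + q) * S + z1 * z2], and [z1 * z2 = p * q] is at most [(p + q) * S].
    This is how the uniform size [(1 / P + 1 / Q) / (1 + a)] of the rotations
    turns into the three formulas of [F_factor]. *)
Lemma mixed_product_near (R : realType) (p q z1 z2 : R) : 0 <= p -> 0 <= q -> 0 <= z1 -> 0 <= z2 ->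
  z1 * z2 = p * q ->
  near_ratio 2 ((1 + (p + q + z1)) * (1 + (p + q + z2)))
    ((1 + (p + q + z1 + z2)) * ((1 + p) + (1 + q))).
Proof.
move=> p0 q0 z10 z20 zE.
have -> : (1 + (p + q + z1)) * (1 + (p + q + z2)) =
    (1 + p + q) * (1 + (p + q + z1 + z2)) + z1 * z2 by ring.
rewrite zE; have pq : 0 <= p * q by rewrite mulr_ge0.
have pp : 0 <= p * p by rewrite mulr_ge0.
have qq : 0 <= q * q by rewrite mulr_ge0.
have pz1 : 0 <= p * z1 by rewrite mulr_ge0.
have pz2 : 0 <= p * z2 by rewrite mulr_ge0.
have qz1 : 0 <= q * z1 by rewrite mulr_ge0.
have qz2 : 0 <= q * z2 by rewrite mulr_ge0.
by split; lra.
Qed.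

Definition factor_ratio (R : realType) (m : nat) : R := 2 * rate_ratio R m.

Section Factors.
Variables (R : realType) (m : nat) (x y : 'cV[R]_2).
Local Notation n := m.+3.

Let x0 := dotp (proot R n 0) x.
Let x1 := dotp (proot R n n.-1) x.
Let y0 := dotp (proot R n 0) y.
Let y1 := dotp (proot R n n.-1) y.
Let a0 := 1 + x0 * y0.
Let a1 := 1 + x1 * y1.
Let xy := 1 + dotp x y.
Let x_ry := 1 + dotp x (rtilde R n *m y).
Let rx_y := 1 + dotp (rtilde R n *m x) y.

(** [F_factor], with the elements of the group replaced by their labels. *)
Definition state_factor (v : state m) : R :=
  if v.1 then
    if v.2 == 0 then 1 / a0 else if v.2 == -1 then 1 / a1 else 1 / xy
  else
    if v.2 == 0 then 1
    else if v.2 == 1 then x_ry / (a0 * a1 * xy)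
    else if v.2 == -1 then rx_y / (a0 * a1 * xy)
    else rx_y * x_ry / (a0 * a1 * xy ^+ 2).

(** Following the tests of [F_factor] avoids having to know that different labels
    denote different matrices: the label [v'] is the one found by the tests. *)
Lemma F_factor_state (v : state m) : exists v',
  state_mx R v' = state_mx R v /\ F_factor n (state_mx R v) x y = state_factor v'.
Proof.
have refl_state (k : 'I_n) (j : nat) : j = (- k)%R :> nat -> refl_mx R n j = state_mx R (true, k).
  by move=> ->; rewrite refl_mx_state opprK.
have rot_state (k : 'I_n) : rot_mx R n k = state_mx R (false, k) by [].
have one_state : 1%:M = state_mx R (false, 0 : 'I_n) by rewrite state_mx_id.
set w := state_mx R v; rewrite /F_factor -/x0 -/x1 -/y0 -/y1 -/a0 -/a1 -/xy -/x_ry -/rx_y.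
have [w1|nw1] := eqVneq w 1%:M.
  by exists (false, 0); rewrite /state_factor /= -one_state w1.
have r0 : refl_mx R n 0 = state_mx R (true, 0 : 'I_n).
  by apply: refl_state; rewrite oppr0.
have r1 : refl_mx R n 1 = state_mx R (true, -1 : 'I_n).
  by apply: refl_state; rewrite opprK.
have [ws0|nws0] := eqVneq w (refl_mx R n 0).
  by exists (true, 0); rewrite /state_factor /= -r0 ws0.
have [ws1|nws1] := eqVneq w (refl_mx R n 1).
  exists (true, -1); rewrite /state_factor /= -r1 ws1; split=> //.
  by rewrite oppr_eq0 eqxx.
case: existsP => [[j /andP[j1 /eqP wj]]|nsj].
  exists (true, - j); rewrite /state_factor /= -refl_mx_state; split=> //.
  rewrite oppr_eq0 eqr_opp.
  have -> : (j == 0) = false by apply/eqP => j0; rewrite j0 in j1.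
  by have -> : (j == 1) = false by apply/eqP => j0; rewrite j0 in j1.
have t1 : rot_mx R n 1 = state_mx R (false, 1 : 'I_n) by [].
have tN1 : rot_mx R n n.-1 = state_mx R (false, -1 : 'I_n).
  by rewrite -rot_state val_opp1.
have [wr1|nwr1] := eqVneq w (rot_mx R n 1).
  by exists (false, 1); rewrite /state_factor /= -t1 wr1.
have [wrN|nwrN] := eqVneq w (rot_mx R n n.-1).
  exists (false, -1); rewrite /state_factor /= -tN1 wrN; split=> //.
  rewrite oppr_eq0 eqxx /=; case: eqP => // /(congr1 (@nat_of_ord _)).
  by rewrite val_opp1.
case: existsP => [[j /andP[/andP[j1 jn] /eqP wj]]|nrj].
  exists (false, j); rewrite /state_factor /= -rot_state; split=> //.
  have -> : (j == 0) = false by apply/eqP => j0; rewrite j0 in j1.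
  have -> : (j == 1) = false by apply/eqP => j0; rewrite j0 in j1.
  have -> // : (j == -1) = false.
  by apply/eqP => j0; rewrite j0 val_opp1 ltnn in jn.
exfalso; case: v @w nw1 nws0 nws1 nsj nwr1 nwrN nrj => [[] k] /= .
  move=> _ /eqP nw0 /eqP nw1 nsj _ _ _.
  have kE : state_mx R (true, k) = refl_mx R n (- k) by rewrite refl_mx_state opprK.
  have : ~ exists j : 'I_n, (1 < j)%N && (state_mx R (true, k) == refl_mx R n j) by [].
  apply; exists (- k); rewrite kE eqxx andbT ltnNge.
  apply/negP; case E : (nat_of_ord (- k)) => [|[|l]] // _.
    by apply: nw0; rewrite kE E.
  by apply: nw1; rewrite kE E.
move=> /eqP nw1 _ _ _ /eqP nr1 /eqP nrN nrj; apply: nrj; exists k.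
rewrite rot_state eqxx andbT; apply/andP; split.
  rewrite ltnNge; apply/negP; case E : (nat_of_ord k) => [|[|l]] // _.
    by apply: nw1; rewrite one_state; congr (state_mx R (_, _)); exact/ord_inj.
  by apply: nr1; rewrite t1; congr (state_mx R (_, _)); exact/ord_inj.
rewrite ltn_neqAle -ltnS ltn_ord andbT; apply/eqP => kE; apply: nrN.
by rewrite tN1; congr (state_mx R (_, _)); apply/ord_inj; rewrite val_opp1.
Qed.

Section Near.
Hypotheses (x0_ge0 : 0 <= x0) (x1_ge0 : 0 <= x1).
Hypotheses (y0_ge0 : 0 <= y0) (y1_ge0 : 0 <= y1).

Let p := x0 * y0.
Let q := x1 * y1.
Let z1 := x0 * y1.
Let z2 := x1 * y0.
Let p0 : 0 <= p. Proof. exact: mulr_ge0. Qed.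
Let q0 : 0 <= q. Proof. exact: mulr_ge0. Qed.
Let z10 : 0 <= z1. Proof. exact: mulr_ge0. Qed.
Let z20 : 0 <= z2. Proof. exact: mulr_ge0. Qed.
Let N := p + q + z1 + z2.
Let N0 : 0 <= N. Proof. by rewrite /N !addr_ge0. Qed.

Let g : R := max_ratio R m.
Let g1 : 1 <= g. Proof. exact: max_ratio_ge1. Qed.
Let g0 : 0 <= g. Proof. exact: le_trans g1. Qed.
Let c : R := cos (angle R m 1).
Let c_itv : 1 / 2 <= c <= 1.
Proof.
rewrite cos_le1 andbT; have /andP[+ _] := @sin_ratio_itv R m 2 isT.
by rewrite sin_ratio2 -/c; lra.
Qed.
Let c2g : 2 * c <= g.
Proof. by have /andP[_ +] := @sin_ratio_itv R m 2 isT; rewrite sin_ratio2. Qed.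

Local Notation G := (factor_ratio R m).

Lemma factor_ratio_ge : 1 <= G /\ 2 <= G /\ g <= G /\ rate_ratio R m <= G
  /\ 2 * rate_ratio R m <= G /\ g * g <= G.
Proof.
have r2 := rate_ratio_ge2 R m.
have gg : g <= g * g by rewrite ler_peMl.
have rE : rate_ratio R m = 2 * (g * g) by rewrite /rate_ratio -/g expr2.
by rewrite /factor_ratio; do !split; lra.
Qed.

Lemma near_dotp : near_ratio G (1 + N) xy.
Proof.
have [G1 [G2 [gG [_ [_ ggG]]]]] := factor_ratio_ge.
have /andP[c_ge c_le] := c_itv.
have dE : dotp x y = g * g * (p + q + c * (z1 + z2)).
  by rewrite (@dotp_coord R m) -/g -/c -/x0 -/x1 -/y0 -/y1 expr2.
have gg1 : 1 <= g * g by rewrite mulr_ege1.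
have B0 : 0 <= p + q + c * (z1 + z2) by rewrite !addr_ge0 // mulr_ge0 ?addr_ge0 //; lra.
have BN : p + q + c * (z1 + z2) <= N.
  have : c * (z1 + z2) <= 1 * (z1 + z2) by rewrite ler_wpM2r ?addr_ge0.
  by rewrite /N; lra.
have NB : N <= 2 * (p + q + c * (z1 + z2)).
  have : 1 / 2 * (z1 + z2) <= c * (z1 + z2) by rewrite ler_wpM2r ?addr_ge0.
  by rewrite /N; move: p0 q0; lra.
apply: near_ratio1D => //; rewrite dE.
  apply: (le_trans NB); apply: ler_pM => //.
  by rewrite ler_peMl.
by apply: ler_pM => //; rewrite mulr_ge0.
Qed.

(** [c >= 1 / 2] makes the coefficient of [z] at least [1]. *)
Lemma near_rtilde z : 0 <= z ->
  near_ratio G (1 + (p + q + z)) (1 + g * (p + q + 2 * c * z)).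
Proof.
move=> z_ge0; have [G1 [G2 [gG [_ [_ ggG]]]]] := factor_ratio_ge.
have /andP[c_ge c_le] := c_itv.
have B : z <= 2 * c * z by rewrite ler_peMl //; lra.
have B' : 2 * c * z <= g * z by rewrite ler_wpM2r.
have gz : 0 <= 2 * c * z by exact: le_trans B.
have pq : p + q <= g * (p + q) by rewrite ler_peMl ?addr_ge0.
apply: near_ratio1D => //.
  apply: (@le_trans _ _ (1 * (g * (p + q + 2 * c * z)))); last first.
    by rewrite ler_wpM2r // mulr_ge0 // !addr_ge0.
  rewrite mul1r; apply: (@le_trans _ _ (p + q + 2 * c * z)); first by rewrite lerD2l.
  by rewrite ler_peMl // !addr_ge0.
apply: (@le_trans _ _ (g * g * (p + q + z))); last first.
  by rewrite ler_wpM2r // !addr_ge0.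
by rewrite -[leRHS]mulrA ler_wpM2l // mulrDr lerD.
Qed.

Lemma near_rtilde_l : near_ratio G (1 + (p + q + z1)) rx_y.
Proof. by rewrite /rx_y dotp_rtilde_l; exact: near_rtilde. Qed.

Lemma near_rtilde_r : near_ratio G (1 + (p + q + z2)) x_ry.
Proof. by rewrite /x_ry dotp_rtilde_r; exact: near_rtilde. Qed.

Let wr := @chamber_rates R m x y x0_ge0 x1_ge0 y0_ge0 y1_ge0.

Definition state_size (v : state m) : R :=
  if v.1 then (1 + 2 * root_product x y v.2)^-1
  else if v.2 == 0 then 1
  else ((1 + 2 * p)^-1 + (1 + 2 * q)^-1) / (1 + killing x y v).

Lemma state_size_near v : 0 <= state_size v /\ 0 <= state_factor v /\
  near_ratio (G ^+ 8) (state_size v) (state_factor v).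
Proof.
have [G1 [G2 [gG [rG [r2G ggG]]]]] := factor_ratio_ge.
have G0 : 0 <= G by exact: le_trans G1.
have pos (t : R) : 0 <= t -> 0 < 1 + t by move=> t0; rewrite ltr_pwDl.
have xy_gt0 : 0 < xy.
  have [le1 _] := near_dotp; have := lt_le_trans (pos N N0) le1.
  by rewrite pmulr_rgt0 // (lt_le_trans ltr01).
have rx_gt0 : 0 < rx_y.
  have [le1 _] := near_rtilde_l.
  have := lt_le_trans (pos _ (addr_ge0 (addr_ge0 p0 q0) z10)) le1.
  by rewrite pmulr_rgt0 // (lt_le_trans ltr01).
have xr_gt0 : 0 < x_ry.
  have [le1 _] := near_rtilde_r.
  have := lt_le_trans (pos _ (addr_ge0 (addr_ge0 p0 q0) z20)) le1.
  by rewrite pmulr_rgt0 // (lt_le_trans ltr01).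
have a0_gt0 : 0 < a0 by exact: pos.
have a1_gt0 : 0 < a1 by exact: pos.
have up (i j : nat) (s t : R) : (i <= j)%N -> 0 <= s -> 0 <= t ->
    near_ratio (G ^+ i) s t -> near_ratio (G ^+ j) s t.
  by move=> ij s0 t0; apply: near_ratio_le => //; exact: ler_weXn2l.
have doubled (t : R) : 0 <= t -> near_ratio G (1 + 2 * t) (1 + t).
  move=> t0; apply: near_ratio1D => //; first by rewrite ler_wpM2r.
  by rewrite mulrA ler_peMl // mulr_ege1 // ler1n.
have nP := doubled p p0; have nQ := doubled q q0.
have rate1 : 1 <= rate_ratio R m by have := rate_ratio_ge2 R m; lra.
have k_ge0 (v' : state m) : 0 <= killing x y v' by case/andP: (rates_a rate1 wr v').
have u_ge0 (k : 'I_n) : 0 <= root_product x y k by case/andP: (rates_u rate1 wr k).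
have scale (C s t r : R) : 0 <= r -> near_ratio C s t -> near_ratio C (s * r) (t * r).
  by move=> r0 [st ts]; split; rewrite mulrA ler_wpM2r.
pose al := 1 + (p + q + z1); pose be := 1 + (p + q + z2); pose si := 1 + N.
have al_gt0 : 0 < al by apply: pos; rewrite !addr_ge0.
have be_gt0 : 0 < be by apply: pos; rewrite !addr_ge0.
have si_gt0 : 0 < si by exact: pos.
pose W := (a0 * a1)^-1.
have W_gt0 : 0 < W by rewrite invr_gt0 mulr_gt0.
have inv_ge0 (r : R) : 0 < r -> 0 <= r^-1 by move=> r0; rewrite invr_ge0 ltW.
have alV := inv_ge0 _ al_gt0; have beV := inv_ge0 _ be_gt0.
have siV := inv_ge0 _ si_gt0; have xyV := inv_ge0 _ xy_gt0.
have al0 := ltW al_gt0; have be0 := ltW be_gt0; have W0 := ltW W_gt0.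
have rx0 := ltW rx_gt0; have xr0 := ltW xr_gt0.
have mixed : near_ratio G (al * be) (si * (a0 + a1)).
  have [m1 m2] := mixed_product_near p0 q0 z10 z20 (wr_z wr).
  apply: (near_ratio_le _ _ G2) => //; first exact: mulr_ge0 (ltW al_gt0) (ltW be_gt0).
  exact: mulr_ge0 (ltW si_gt0) (addr_ge0 (ltW a0_gt0) (ltW a1_gt0)).
have P2_gt0 : 0 < 1 + 2 * p by apply: pos; exact: mulr_ge0.
have Q2_gt0 : 0 < 1 + 2 * q by apply: pos; exact: mulr_ge0.
have u2_gt0 (k : 'I_n) : 0 < 1 + 2 * root_product x y k by apply: pos; exact: mulr_ge0.
have k1_gt0 (w : state m) : 0 < 1 + killing x y w by exact: pos.
have size_rot (k : 'I_n) b : k != 0 -> 0 < b -> near_ratio G (1 + killing x y (false, k)) b ->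
    near_ratio (G * G) (state_size (false, k)) ((a0 + a1) * W * b^-1).
  move=> k0 b0 kb; rewrite /state_size /= (negbTE k0).
  have -> : (a0 + a1) * W = a0^-1 + a1^-1.
    by rewrite /W; field; rewrite !gt_eqF.
  apply: near_ratioM.
  - by apply: addr_ge0; rewrite invr_ge0 ltW.
  - by apply: addr_ge0; rewrite invr_ge0 ltW.
  - by rewrite invr_ge0 ltW.
  - by rewrite invr_ge0 ltW.
  - by apply: near_ratioD; exact: near_ratioV.
  - exact: near_ratioV.
have size_ge0 (w : state m) : 0 <= state_size w.
  rewrite /state_size; case: ifP => _; last case: ifP => _ //.
    by rewrite invr_ge0 ltW.
  by apply: divr_ge0; [apply: addr_ge0; rewrite invr_ge0 ltW|rewrite ltW].
have den_gt0 : 0 < a0 * a1 * xy by rewrite !mulr_gt0.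
have factor_ge0 (w : state m) : 0 <= state_factor w.
  rewrite /state_factor; case: ifP => _.
    by case: ifP => _; [|case: ifP => _]; rewrite div1r invr_ge0 ltW.
  case: ifP => _ //; case: ifP => _; first by rewrite divr_ge0 // ltW.
  case: ifP => _; first by rewrite divr_ge0 // ltW.
  by rewrite divr_ge0 ?mulr_ge0 ?exprn_ge0 ?mulr_ge0 // ltW.
split; first exact: size_ge0.
split; first exact: factor_ge0.
have chain (C D s t r : R) : 0 <= C -> 0 <= D -> near_ratio C s t -> near_ratio D t r ->
    near_ratio (C * D) s r by exact: near_ratio_trans.
case: v => [[] k].
  have [->|k0] := eqVneq k 0.
    apply: (up 1%N) => //; rewrite expr1 /state_size /state_factor /= div1r.
    exact: near_ratioV.
  have [->|k1] := eqVneq k (-1).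
    apply: (up 1%N) => //; rewrite expr1 /state_size /state_factor /= oppr_eq0 /= eqxx div1r.
    rewrite (wr_u1 wr).
    exact: near_ratioV.
  apply: (up 2%N) => //; rewrite expr2 /state_size /state_factor /=.
  rewrite (negbTE k0) (negbTE k1) div1r.
  apply: near_ratioV => //.
  apply: chain near_dotp => //.
  have /andP[Nu uN] := wr_u wr k0 k1; rewrite -/N in Nu uN.
  apply: near_ratio1D => //.
    apply: (@le_trans _ _ (2 * rate_ratio R m * N)); last by rewrite ler_wpM2r.
    by rewrite -mulrA ler_pM2l.
  apply: (le_trans Nu); rewrite mulrA ler_peMl //.
  by rewrite mulr_ege1 // ler1n.
have [->|k0] := eqVneq k 0.
  rewrite /state_size /state_factor /=; apply: near_ratio_refl => //.
  exact: exprn_ege1.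
have nxy := near_ratioV si_gt0 xy_gt0 near_dotp.
have elementary (l : 'I_n) b b' f : l != 0 -> 0 < b -> 0 < b' ->
    b * b' = al * be -> near_ratio G (1 + killing x y (false, l)) b ->
    0 < f -> near_ratio G b' f -> state_factor (false, l) = f * xy^-1 * W ->
    near_ratio (G ^+ 8) (state_size (false, l)) (state_factor (false, l)).
  move=> l0 b_gt0 b'_gt0 bE lb f_gt0 b'f ->.
  have s1 := size_rot l b l0 b_gt0 lb.
  have bV := inv_ge0 _ b_gt0; have b'0 := ltW b'_gt0; have f0 := ltW f_gt0.
  have s2 : near_ratio G ((a0 + a1) * W * b^-1) (b' * si^-1 * W).
    have -> : (a0 + a1) * W * b^-1 = si * (a0 + a1) * (W * b^-1 * si^-1).
      by field; rewrite !gt_eqF.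
    have -> : b' * si^-1 * W = al * be * (W * b^-1 * si^-1).
      by rewrite -bE; field; rewrite !gt_eqF.
    apply: scale; last exact: near_ratio_sym.
    by do ?[apply: mulr_ge0].
  have s3 : near_ratio (G * G) (b' * si^-1 * W) (f * xy^-1 * W).
    by apply: scale => //; exact: near_ratioM.
  have := chain _ _ _ _ _ _ _ (chain _ _ _ _ _ _ _ s1 s2) s3.
  rewrite !mulr_ge0 // => /(_ isT isT isT isT) s4.
  apply: (up 5%N) => //; first by do ?[apply: mulr_ge0].
  by rewrite !exprS expr0 mulr1; move: s4; rewrite !mulrA.
have slow_rot (l : 'I_n) b : 0 <= b ->
    b <= killing x y (false, l) <= rate_ratio R m * b ->
    near_ratio G (1 + killing x y (false, l)) (1 + b).
  move=> b0 /andP[r1 r2]; apply: near_ratio1D => //.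
    by apply: (le_trans r2); rewrite ler_wpM2r.
  by apply: (le_trans r1); rewrite ler_peMl.
have [->|k1] := eqVneq k 1.
  apply: (elementary 1 al be x_ry) => //.
  - by apply: slow_rot (wr_rot1 wr); rewrite !addr_ge0.
  - exact: near_rtilde_r.
  - by rewrite /state_factor /= /W; field; rewrite !gt_eqF.
have [->|kN] := eqVneq k (-1).
  have N1 : -1 != 0 :> 'I_n by rewrite oppr_eq0.
  have N2 : (-1 == 1 :> 'I_n) = false.
    by apply/eqP => /(congr1 (@nat_of_ord _)); rewrite val_opp1.
  apply: (elementary (-1) be al rx_y) => //; first by rewrite mulrC.
  - by apply: slow_rot (wr_rotN1 wr); rewrite !addr_ge0.
  - exact: near_rtilde_l.
  - by rewrite /state_factor /= (negbTE N1) N2 eqxx /W; field; rewrite !gt_eqF.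
have near_si := slow_rot k N N0 (wr_rot wr k0 k1 kN).
have s1 := size_rot k si k0 si_gt0 near_si.
rewrite [state_factor _](_ : _ = rx_y * x_ry * (xy^-1 * xy^-1) * W); last first.
  by rewrite /state_factor /= (negbTE k0) (negbTE k1) (negbTE kN) /W; field; rewrite !gt_eqF.
have s2 : near_ratio G ((a0 + a1) * W * si^-1) (al * be * (si^-1 * si^-1) * W).
  have -> : (a0 + a1) * W * si^-1 = si * (a0 + a1) * (W * si^-1 * si^-1).
    by field; rewrite !gt_eqF.
  have -> : al * be * (si^-1 * si^-1) * W = al * be * (W * si^-1 * si^-1) by ring.
  apply: scale; last exact: near_ratio_sym.
  by do ?[apply: mulr_ge0].
have s3 : near_ratio (G * G * (G * G)) (al * be * (si^-1 * si^-1) * W)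
    (rx_y * x_ry * (xy^-1 * xy^-1) * W).
  apply: scale => //; apply: near_ratioM; [| | | |apply: near_ratioM => //|].
  1-4: exact: mulr_ge0.
    exact: near_rtilde_l.
    exact: near_rtilde_r.
  exact: near_ratioM.
have := chain _ _ _ _ _ _ _ (chain _ _ _ _ _ _ _ s1 s2) s3.
rewrite !mulr_ge0 // => /(_ isT isT isT isT) s4.
apply: (up 7%N) => //.
  by do ?[apply: mulr_ge0].
by rewrite !exprS expr0 mulr1; move: s4; rewrite !mulrA.
Qed.

End Near.
End Factors.

Lemma dotp_continuous (R : realType) (a : 'cV[R]_2) : continuous (dotp a).
Proof.
move=> x; rewrite (_ : dotp a = fun z => a 0 0 * z 0 0 + a 1 0 * z 1 0); last first.
  by apply/funext => z; rewrite dotpE.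
have term (b : R) i : continuous_at x (fun z : 'cV[R]_2 => b * z i 0).
  by apply: (@continuousM _ _ (fun=> b) (fun z : 'cV[R]_2 => z i 0));
    [exact: cst_continuous|exact: coord_continuous].
exact: continuousD (term _ _) (term _ _).
Qed.

Lemma closure_chamber_ge0 (R : realType) (n : nat) (x : 'cV[R]_2) :
  closure (pos_chamber n) x ->
  0 <= dotp (proot R n 0) x /\ 0 <= dotp (proot R n n.-1) x.
Proof.
have half (a : 'cV[R]_2) (A : set 'cV[R]_2) : A `<=` [set z | 0 < dotp a z] ->
    closure A x -> 0 <= dotp a x.
  move=> sub; have cl : closed [set z | 0 <= dotp a z].
    apply: (@preimage_closed _ _ (dotp a) [set r | 0 <= r]); last exact: closed_ge.
    by move=> z _; exact: dotp_continuous.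
  have /closureS : A `<=` [set z | 0 <= dotp a z] by move=> z /sub /ltW.
  by move=> /(_ x) h /h; rewrite -(closure_id _).1.
by move=> cx; split; apply: half cx => z [].
Qed.

Theorem theorem12 (R : realType) (n : nat) (hn : (3 <= n)%N)
    (kappa : 'cV[R]_2 -> R) (hkappa : multiplicity n kappa)
    (E : 'cV[R]_2 -> 'cV[R]_2 -> R) (hE : is_dunkl_kernel n kappa E) :
  exists C1 C2 : R, 0 < C1 /\ 0 < C2 /\
    forall (w : 'M[R]_2) (x y : 'cV[R]_2),
      reflection_group n w ->
      closure (pos_chamber n) x -> closure (pos_chamber n) y ->
      C1 * kernel_estimate n kappa w x y <= E x (w *m y) /\
      E x (w *m y) <= C2 * kernel_estimate n kappa w x y.
Proof.
case: n hn hkappa hE => [|[|[|m]]] // _ hkappa hE.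
have rate1 : 1 <= rate_ratio R m by have := rate_ratio_ge2 R m; lra.
have [C C_gt0 estimate] := dihedral_flow_estimate
  (root_multiplicity_gt0 hkappa) (root_multiplicity_refl hkappa) rate1.
pose G := factor_ratio R m.
have G_gt0 : 0 < G.
  by rewrite /G /factor_ratio; have := rate_ratio_ge2 R m; lra.
have CG_gt0 : 0 < C * G ^+ 8 by rewrite mulr_gt0 // exprn_gt0.
exists (C * G ^+ 8)^-1, (C * G ^+ 8); rewrite invr_gt0; do 2 split=> //.
move=> w x y /reflection_group_state[v0 ->] /closure_chamber_ge0[x0 x1].
move=> /closure_chamber_ge0[y0 y1].
have [v [vE FE]] := F_factor_state x y v0.
rewrite /kernel_estimate FE -vE (kernel_flow1 E).
have wr := chamber_rates x0 x1 y0 y1.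
have [h' fl] := kernel_flowP hkappa hE x y.
have := estimate _ _ _ _ _ _ _ _ wr fl (kernel_flow0 hE x y).
set K := expR (- _) => /= -[h1 hs hr].
have -> : \prod_(j < m.+3) (1 + dotp (proot R m.+3 j) x * dotp (proot R m.+3 j) y)
    `^ (- kappa (proot R m.+3 j)) = K.
  rewrite /K /log_product -sumrN expR_sum; apply: eq_bigr => j _.
  have u0 : 0 <= dotp (proot R m.+3 j) x * dotp (proot R m.+3 j) y.
    by case/andP: (rates_u rate1 wr j).
  by rewrite /powR gt_eqF ?ltr_pwDl // mul1r mulNr.
have [X_ge0 [F_ge0 XF]] := state_size_near x0 x1 y0 y1 v.
have K0 : 0 <= K by exact: expR_ge0.
have hv : near_ratio C (kernel_flow E x y v 1) (K * state_size x y v).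
  rewrite /state_size; case: v {vE FE X_ge0 F_ge0 XF} => [[] k] /=; first exact: hs.
  have [->|k0] := eqVneq k 0; first by rewrite mulr1.
  by rewrite [X in near_ratio _ _ X]mulrA; exact: hr.
have KXF : near_ratio (G ^+ 8) (K * state_size x y v) (K * state_factor x y v).
  by case: XF => XF FX; split; rewrite mulrCA ler_wpM2l.
have [le1 le2] := near_ratio_trans (ltW C_gt0) (exprn_ge0 8 (ltW G_gt0)) hv KXF.
rewrite -mulrA; split.
  by rewrite [leLHS]mulrCA ler_pM2l ?expR_gt0 // ler_pdivrMl.
by rewrite [leRHS]mulrCA ler_pM2l ?expR_gt0.
Qed.
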